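(* Let $X$ be a compact complex manifold with $\dim_{\mathbb{C}}X=n\geq 3$. Fix a Hermitian metric $\rho$ on $X$ and let $\widetilde{L}_\rho:\mathcal{H}_X\to[0,+\infty)$ be the normalised functional $$\widetilde{L}_\rho(\omega):=\frac{L(\omega)}{\big(\int_X\omega\wedge\rho_{n-1}\big)^{n-1}},\qquad L(\omega)=\int_X i(\bar\partial\omega)_{prim}\wedge\overline{(\bar\partial\omega)_{prim}}\wedge\omega_{n-3}.$$ Then, for any Hermitian metric $\omega$ and any smooth real $(1,1)$-form $\gamma$ on $X$, we have $$(d_\omega\widetilde{L}_\rho)(\gamma)=\frac{1}{\big(\int_X\omega\wedge\rho_{n-1}\big)^{n-1}}\left((d_\omega L)(\gamma)-(n-1)\,\frac{\int_X\gamma\wedge\rho_{n-1}}{\int_X\omega\wedge\rho_{n-1}}\,L(\omega)\right),$$ where $$(d_\omega L)(\gamma)=\int_X i(\bar\partial\omega)_{prim}\wedge\overline{(\bar\partial\omega)_{prim}}\wedge\gamma\wedge\omega_{n-4}+2\,\mathrm{Re}\,\langle\langle(\bar\partial\omega)_{prim},(\bar\partial\gamma)_{prim}\rangle\rangle_\omega-2\,\mathrm{Re}\,\langle\langle\theta_\omega^{0,1}\wedge\gamma,(\bar\partial\omega)_{prim}\rangle\rangle_\omega.$$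
   Context: A Hermitian metric is identified with its smooth positive definite $(1,1)$-form; $\mathcal{H}_X$ is the set of all Hermitian metrics on $X$, an open cone in the space of smooth real $(1,1)$-forms. For a $(1,1)$-form $\rho$, $\rho_k:=\rho^k/k!$, with $\omega_0=1$ and $\omega_{-1}=0$ (so the term with $\omega_{n-4}$ is absent when $n=3$). $\langle\cdot,\cdot\rangle_\omega$ is the pointwise Hermitian inner product on forms (linear in the first argument), normalised so that $dz_1,\dots,dz_n$ are orthonormal at a point where $\omega=\sum_a i\,dz_a\wedge d\bar z_a$; $\langle\langle u,v\rangle\rangle_\omega=\int_X\langle u,v\rangle_\omega\,\omega_n$. $\Lambda_\omega$ is the pointwise adjoint of $\omega\wedge\cdot$; a $3$-form is $\omega$-primitive if it lies in $\ker\Lambda_\omega$. Every $3$-form $\alpha$ has a unique Lefschetz decomposition $\alpha=\alpha_{prim}+\omega\wedge\beta$ with $\alpha_{prim}$ $\omega$-primitive and $\beta$ a $1$-form; the primitive parts above are with respect to $\omega$. $\theta_\omega^{0,1}=\frac{1}{n-1}\Lambda_\omega(\bar\partial\omega)$ is the $(0,1)$-component of the Lee form $\theta_\omega=\frac{1}{n-1}\Lambda_\omega(d\omega)$. For a functional $F$ on $\mathcal{H}_X$, $(d_\omega F)(\gamma)=\frac{d}{dt}\big|_{t=0}F(\omega+t\gamma)$. *)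

(* Defs.v *)
(* Differential forms on a complex manifold are handled through their
   coefficients in holomorphic charts: a form is a family, indexed by the charts,
   of functions with values in the exterior algebra of
   C dz_1 + ... + C dz_n + C dzbar_1 + ... + C dzbar_n, satisfying the usual
   transformation law under changes of charts. *)
From HB Require Import structures.
From mathcomp Require Import all_boot all_order all_algebra.
From mathcomp Require Import complex.
From mathcomp Require Import all_classical all_reals all_analysis.

Set Implicit Arguments.
Unset Strict Implicit.
Unset Printing Implicit Defensive.

Import Order.TTheory GRing.Theory Num.Theory.
Import numFieldNormedType.Exports.

Local Open Scope classical_set_scope.
Local Open Scope ring_scope.

(* The complex numbers, as a numClosedFieldType so that they carry their norm and
   topology. *)
Definition Cx (R : realType) : numClosedFieldType := R[i]%type.

Definition mkC {R : realType} (x y : R) : Cx R := Complex x y.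
Definition ofR {R : realType} (x : R) : Cx R := Complex x 0.
Definition reC {R : realType} (z : Cx R) : R := complex.Re z.
Definition imC {R : realType} (z : Cx R) : R := complex.Im z.

Section RealCalculus.
Context {R : realType}.

Definition rderivable (g : R -> Cx R) (t : R) : Prop :=
  derivable (fun s => reC (g s)) t 1 /\
  derivable (fun s => imC (g s)) t 1.

Definition rderive (g : R -> Cx R) (t : R) : Cx R :=
  mkC (derive1 (fun s => reC (g s)) t) (derive1 (fun s => imC (g s)) t).

Context {n : nat}.
Implicit Types (f : 'rV[Cx R]_n -> Cx R) (D : set 'rV[Cx R]_n).

(* The derivative along v for the real structure of C^n = R^2n. *)
Definition dirderivable (v : 'rV[Cx R]_n) f z : Prop :=
  rderivable (fun t => f (z + ofR t *: v)) 0.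

Definition dirderive (v : 'rV[Cx R]_n) f z : Cx R :=
  rderive (fun t => f (z + ofR t *: v)) 0.

(* f is C^k (in the real sense) on the open set D. *)
Fixpoint Ck_on (k : nat) D f : Prop :=
  (forall z, D z -> {for z, continuous f}) /\
  if k is k'.+1 then
    forall v, (forall z, D z -> dirderivable v f z) /\ Ck_on k' D (dirderive v f)
  else True.

Definition smooth_on D f : Prop := forall k, Ck_on k D f.

(* d/dzbar_b = (d/dx_b + i d/dy_b) / 2 *)
Definition dzbar_derive (b : 'I_n) f z : Cx R :=
  2^-1 * (dirderive (delta_mx 0 b) f z + 'i * dirderive ('i *: delta_mx 0 b) f z).

End RealCalculus.

(* Lebesgue integral over C^n = R^2n with respect to dx_1 dy_1 ... dx_n dy_n, as
   an iterated integral. It is only applied to smooth functions with compact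
   support, for which Fubini's theorem holds. *)
Fixpoint int_Cn (R : realType) (n : nat) : ('rV[Cx R]_n -> R) -> R :=
  match n with
  | 0 => fun f => f 0
  | m.+1 => fun f =>
      \int[@lebesgue_measure R]_x \int[@lebesgue_measure R]_y
        @int_Cn R m (fun v => f (row_mx (mkC x y)%:M v : 'rV_(1 + m)))
  end.

Definition cint_Cn (R : realType) (n : nat) (f : 'rV[Cx R]_n -> Cx R) : Cx R :=
  mkC (int_Cn (fun z => reC (f z))) (int_Cn (fun z => imC (f z))).

(* The exterior algebra: the element u stands for the sum over S of u S * e_S,
   where e_S is the product, in increasing order of indices, of the covectors
   indexed by S. The index [lshift n a] is that of dz_a, [rshift n a] that of
   dzbar_a. *)
Definition ext (R : realType) (n : nat) : Type :=
  {ffun {set 'I_(n + n)} -> Cx R}.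

Section ExteriorAlgebra.
Context {R : realType} {n : nat}.
Local Notation E := (ext R n).
Implicit Types (u v w : E) (S T : {set 'I_(n + n)}).

Definition ext1 : E := [ffun S => (S == finset.set0)%:R].

(* e_A /\ e_B = (-1)^(number of inversions) e_(A U B) for disjoint A and B *)
Definition wedge u v : E :=
  [ffun S : {set 'I_(n + n)} => \sum_(A : {set 'I_(n + n)} | A \subset S)
     (-1) ^+ #|[set p in finset.setX A (S :\: A) | (p.2 < p.1)%N]%SET|
       * u A * v (S :\: A)].

Definition covec (s : 'I_(n + n)) : E := [ffun S => (S == [set s]%SET)%:R].
Definition dz (a : 'I_n) : E := covec (lshift n a).
Definition dzbar (a : 'I_n) : E := covec (rshift n a).

(* Substitution of f s for each covector s; [\big[wedge/ext1]_(s in S)] takes the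
   product in increasing order of s. *)
Definition ext_subst (f : 'I_(n + n) -> E) u : E :=
  \sum_(S : {set 'I_(n + n)}) u S *: \big[wedge/ext1]_(s in S) f s.

Definition ext_conj u : E :=
  ext_subst (fun s => match fintype.split s with
                      | inl a => dzbar a
                      | inr a => dz a
                      end) [ffun S => (u S)^*].

(* Pull-back by a holomorphic map g whose Jacobian matrix is J, where
   J b a = d g_a / d z_b as in [jacobian]. *)
Definition ext_pullback (J : 'M[Cx R]_n) u : E :=
  ext_subst (fun s => match fintype.split s with
                      | inl a => \sum_b J b a *: dz b
                      | inr a => \sum_b (J b a)^* *: dzbar b
                      end) u.

Definition has_degree (k : nat) u : Prop := forall S, u S != 0 -> #|S| = k.

Definition has_bidegree (p q : nat) u : Prop := forall S, u S != 0 ->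
  #|[set a : 'I_n | lshift n a \in S]%SET| = p /\
  #|[set a : 'I_n | rshift n a \in S]%SET| = q.

(* u_k = u^k / k!, and 0 for k < 0 *)
Definition divpow u (k : int) : E :=
  match k with
  | Posz m => (m`!%:R : Cx R)^-1 *: iter m (wedge u) ext1
  | Negz _ => 0
  end.

(* The matrix h with w = sum_(a, b) i h_ab dz_a /\ dzbar_b for w of type (1,1). *)
Definition herm_mx w : 'M[Cx R]_n :=
  \matrix_(a, b) (- 'i * w [set lshift n a; rshift n b]%SET).

Definition posdef w : Prop := forall x : 'rV[Cx R]_n, x != 0 ->
  0 < \sum_a \sum_b herm_mx w a b * x 0 a * (x 0 b)^*.

(* Gram matrix of dz_1, ..., dz_n, dzbar_1, ..., dzbar_n for the metric w: in a
   coframe with w = sum_a i eps_a /\ epsbar_a and eps = P dz one has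
   h^T = P^* P, whence <dz_a, dz_b> = (P^-1 P^-1^* )_ab = (h^-1)_ba. *)
Definition gram1 w : 'M[Cx R]_(n + n) :=
  block_mx (invmx (herm_mx w))^T 0 0 (invmx (herm_mx w)).

(* <e_S, e_T> is the Gram determinant of the covectors in S and T. *)
Definition gram w S T : Cx R :=
  (#|S| == #|T|)%:R *
  \det (\matrix_(i < #|S|, j < #|S|)
          gram1 w (enum_val i) (nth (enum_val i) (enum T) j)).

Definition ext_inner w u v : Cx R :=
  \sum_(S : {set 'I_(n + n)}) \sum_(T : {set 'I_(n + n)})
    u S * (v T)^* * gram w S T.

(* Riesz representation: the adjoint of w /\ _ for the inner product of w, which is
   unique when w is positive definite. *)
Definition Lambda w u : E :=
  xget 0 [set v | forall x, ext_inner w v x = ext_inner w u (wedge w x)].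

(* The primitive part of a 3-form u: the p in its Lefschetz decomposition
   u = p + w /\ b. *)
Definition prim w u : E :=
  xget 0 [set p | [/\ has_degree 3 p, Lambda w p = 0 &
                      exists b, has_degree 1 b /\ u = p + wedge w b]].

Definition dx (a : 'I_n) : E := (2 : Cx R)^-1 *: (dz a + dzbar a).
Definition dy (a : 'I_n) : E := (2 * 'i : Cx R)^-1 *: (dz a - dzbar a).

(* The coefficient of a 2n-form with respect to
   dx_1 /\ dy_1 /\ ... /\ dx_n /\ dy_n. *)
Definition density u : Cx R :=
  u [set: 'I_(n + n)]%SET /
  (\big[wedge/ext1]_(a < n) wedge (dx a) (dy a) : E) [set: 'I_(n + n)]%SET.

End ExteriorAlgebra.

(* Complex manifolds of dimension n. Second countability is not required: it
   is automatic for the compact manifolds considered. [chart_inv i] is only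
   meaningful on the image of the chart. Since that image is open, complex
   differentiability of the transition maps means that they are holomorphic. *)
Record complexManifold (R : realType) (n : nat) := ComplexManifold {
  cm_space :> topologicalType;
  chart_index : Type;
  chart_dom : chart_index -> set cm_space;
  chart_map : chart_index -> cm_space -> 'rV[Cx R]_n;
  chart_inv : chart_index -> 'rV[Cx R]_n -> cm_space;
  cm_hausdorff : hausdorff_space cm_space;
  chart_dom_open : forall i, open (chart_dom i);
  chart_img_open : forall i, open (chart_map i @` chart_dom i);
  chart_mapK : forall i x, chart_dom i x -> chart_inv i (chart_map i x) = x;
  chart_map_continuous : forall i x, chart_dom i x ->
    {for x, continuous (chart_map i)};
  chart_inv_continuous : forall i z, (chart_map i @` chart_dom i) z ->
    {for z, continuous (chart_inv i)};
  chart_cover : forall x, exists i, chart_dom i x;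
  chart_transition : forall i j z,
    (chart_map i @` (chart_dom i `&` chart_dom j)) z ->
    differentiable (chart_map j \o chart_inv i) z
}.

Section Manifold.
Context {R : realType} {n : nat} {X : complexManifold R n}.

Definition chart_img (i : chart_index X) : set 'rV[Cx R]_n :=
  chart_map i @` chart_dom i.

(* Only the values at (i, z) with [chart_img i z] matter. *)
Definition dform : Type := chart_index X -> 'rV[Cx R]_n -> ext R n.
Implicit Types u v w : dform.

Definition smooth_form u : Prop :=
  (forall i S, smooth_on (chart_img i) (fun z => u i z S)) /\
  (forall i j z, (chart_map i @` (chart_dom i `&` chart_dom j)) z ->
     let g := chart_map j \o chart_inv i in
     u i z = ext_pullback (jacobian g z) (u j (g z))).

Definition smooth_real11 u : Prop :=
  smooth_form u /\
  forall i z, chart_img i z -> has_bidegree 1 1 (u i z) /\ ext_conj (u i z) = u i z.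

Definition hermitian_metric w : Prop :=
  smooth_real11 w /\ forall i z, chart_img i z -> posdef (w i z).

Definition fadd u v : dform := fun i z => u i z + v i z.
Definition fscale (c : Cx R) u : dform := fun i z => c *: u i z.
Definition fwedge u v : dform := fun i z => wedge (u i z) (v i z).
Definition fconj u : dform := fun i z => ext_conj (u i z).
Definition fdivpow u (k : int) : dform := fun i z => divpow (u i z) k.
Definition fLambda w u : dform := fun i z => Lambda (w i z) (u i z).
Definition fprim w u : dform := fun i z => prim (w i z) (u i z).

(* dbar (sum_S u_S e_S) = sum_S sum_b (d u_S / d zbar_b) dzbar_b /\ e_S *)
Definition dbar u : dform := fun i z =>
  \sum_b wedge (dzbar b)
    ([ffun S => dzbar_derive b (fun z' => u i z' S) z] : ext R n).

Record partition_of_unity := PartitionOfUnity {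
  pu_index : finType;
  pu_chart : pu_index -> chart_index X;
  pu_fun : pu_index -> X -> R;
  pu_ge0 : forall k x, 0 <= pu_fun k x;
  pu_smooth : forall k i,
    smooth_on (chart_img i) (fun z => ofR (pu_fun k (chart_inv i z)));
  pu_support : forall k,
    closure [set x | pu_fun k x != 0] `<=` chart_dom (pu_chart k);
  pu_sum1 : forall x, \sum_k pu_fun k x = 1
}.

(* The integral over X of a 2n-form, for the orientation given by the complex
   structure; it does not depend on the partition of unity P. *)
Definition fint (P : partition_of_unity) u : Cx R :=
  \sum_(k : pu_index P)
    cint_Cn (fun z =>
      if z \in chart_img (pu_chart k)
      then ofR (pu_fun k (chart_inv (pu_chart k) z)) * density (u (pu_chart k) z)
      else 0).

Definition finner (P : partition_of_unity) w u v : Cx R :=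
  fint P (fun i z =>
    ext_inner (w i z) (u i z) (v i z) *: divpow (w i z) n%:Z).

Definition theta01 w : dform :=
  fscale (n%:R - 1)^-1 (fLambda w (dbar w)).

Definition L_functional (P : partition_of_unity) w : Cx R :=
  let u := fprim w (dbar w) in
  fint P (fscale 'i (fwedge (fwedge u (fconj u)) (fdivpow w (n%:Z - 3)))).

Definition Ltilde_functional (P : partition_of_unity) (rho w : dform) : Cx R :=
  L_functional P w / fint P (fwedge w (fdivpow rho (n%:Z - 1))) ^+ (n - 1).

(* F is meant on Hermitian metrics; these form an open cone, so w + t v is one for
   small t when w is. *)
Definition functional_derivable (F : dform -> Cx R) w v : Prop :=
  rderivable (fun t : R => F (fadd w (fscale (ofR t) v))) 0.

Definition functional_derive (F : dform -> Cx R) w v : Cx R :=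
  rderive (fun t : R => F (fadd w (fscale (ofR t) v))) 0.

End Manifold.

Arguments dform {R n} X.
Arguments partition_of_unity {R n} X.

(* Main.v *)
(* The functional is differentiated under the integral sign. In a chart, each form
   built from the metric omega + t gamma is written F + t Q with Q continuous in
   (z, t), including at t = 0; this class is stable under the algebraic operations
   because the adjoint Lambda and the primitive part are given by explicit formulas
   in the inverse of the matrix of the metric. As the supports of the partition of
   unity are compact, the derivative at 0 of the integral of F + t Q is the integral
   of Q at t = 0.

   With u the primitive part of dbar omega, the quotient for u itself is, at t = 0,
   dbar gamma - gamma /\ theta - omega /\ b for some (0,1)-form b. For a primitive
   (1,2)-form u the Hodge star of ubar is i ubar /\ omega_(n-3), hence
   i v /\ ubar /\ omega_(n-3) = <v, u> omega_n for every (1,2)-form v, and the forms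
   omega /\ b do not contribute as <omega /\ b, u> = <b, Lambda u> = 0. The
   normalised functional follows by the quotient rule, the volume being positive
   because omega /\ rho_(n-1) = tr(rho^-1 omega) rho_n; if X is empty everything
   vanishes. *)
Require Import Defs.
From HB Require Import structures.
From mathcomp Require Import all_boot all_order all_algebra.
From mathcomp Require Import complex.
From mathcomp Require Import all_classical all_reals all_analysis.
From mathcomp Require Import ring lra.

Set Implicit Arguments.
Unset Strict Implicit.
Unset Printing Implicit Defensive.

Import Order.TTheory GRing.Theory Num.Theory.
Import numFieldNormedType.Exports.

Local Open Scope ring_scope.
Local Open Scope set_scope.

(** * Exterior algebra *)

(** [Lambda] and [prim] are selected by [xget] from their characterisations, so they must be
    computed before anything can be differentiated. The computation avoids orthonormal coframes: the
    vectors [sharp] and [sharpb] invert contraction with omega, and identities at top degree come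
    from one remark, that a contraction of any form has no top coefficient. Writing a covector as a
    contraction of omega and moving it across a product replaces the usual sl_2 calculus; it gives
    both the star formula and the non-vanishing of omega_n. These arguments run on invertibility of
    the matrix of the metric, which holds for small t uniformly on a compact support; positive
    definiteness supplies it at t = 0 and gives the sign of the volume.

    Differentiation stays exact: the Leibniz rule for F + t Q is taken asymmetrically and leaves no
    error term. On the analytic side the iterated integral is used through linearity and a sup bound
    on continuous functions with support in a fixed box, so that uniform convergence is enough and
    no convergence theorem for integrals is invoked. *)

Fact ext_key : unit. Proof. exact: tt. Qed.

Definition escale (R : realType) (n : nat) : Cx R -> ext R n -> ext R n :=
  locked_with ext_key (fun c u => c *: u).
Notation "c **: u" := (escale c u) (at level 40, left associativity).

Section ExteriorAlgebra.
Context {R : realType} {n : nat}.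
Local Notation E := (ext R n).
Local Notation I := 'I_(n + n).
Implicit Types (u v w x y : E) (s t : I) (S T A B D : {set I}).

(* Sealed copies of the operations: unification must not unfold them, nor search
   for the module structure of [ext], which is why [**:] replaces [*:]. *)
Definition wdg : E -> E -> E := locked_with ext_key wedge.
Definition cov : I -> E := locked_with ext_key covec.
Definition e1 : E := locked_with ext_key ext1.
Definition cnj : E -> E := locked_with ext_key ext_conj.
Definition dpow : E -> int -> E := locked_with ext_key divpow.
Definition dzc (a : 'I_n) : E := cov (lshift n a).
Definition dzbarc (a : 'I_n) : E := cov (rshift n a).

Lemma wdgE : wedge = wdg. Proof. by rewrite /wdg unlock. Qed.
Lemma covE : covec = cov. Proof. by rewrite /cov unlock. Qed.
Lemma e1E : ext1 = e1. Proof. by rewrite /e1 unlock. Qed.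
Lemma cnjE : ext_conj = cnj. Proof. by rewrite /cnj unlock. Qed.
Lemma dpowE : divpow = dpow. Proof. by rewrite /dpow unlock. Qed.
Lemma dzE : dz = dzc. Proof. by apply/funext => a; rewrite /dz covE. Qed.
Lemma dzbarE : dzbar = dzbarc. Proof. by apply/funext => a; rewrite /dzbar covE. Qed.

Lemma wdg_coef u v S : wdg u v S = \sum_(A : {set I} | A \subset S)
  (-1) ^+ #|[set p in finset.setX A (S :\: A) | (p.2 < p.1)%N]|
    * u A * v (S :\: A).
Proof. by rewrite -wdgE ffunE. Qed.

Lemma cov_coef s S : cov s S = (S == [set s])%:R.
Proof. by rewrite -covE ffunE. Qed.

Lemma e1_coef S : e1 S = (S == finset.set0)%:R.
Proof. by rewrite -e1E ffunE. Qed.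

Lemma extDE u v S : (u + v) S = u S + v S.
Proof. by rewrite ffunE. Qed.
Lemma ext0E S : (0 : E) S = 0.
Proof. by rewrite ffunE. Qed.
Lemma extNE u S : (- u) S = - u S.
Proof. by rewrite ffunE. Qed.
Lemma extBE u v S : (u - v) S = u S - v S.
Proof. by rewrite !ffunE. Qed.
Lemma escaleE (c : Cx R) u : c *: u = c **: u.
Proof. by rewrite /escale unlock. Qed.
Lemma extZE (c : Cx R) u S : (c **: u) S = c * u S.
Proof. by rewrite -escaleE ffunE. Qed.
Lemma ext_sumE (J : Type) (r : seq J) (Q : pred J) (F : J -> E) S :
  (\sum_(j <- r | Q j) F j) S = \sum_(j <- r | Q j) F j S.
Proof. by rewrite sum_ffunE. Qed.

Definition elinear (F : E -> E) :=
  forall (c : Cx R) u v, F (c **: u + v) = c **: F u + F v.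

Lemma extZDr (c : Cx R) u v : c **: (u + v) = c **: u + c **: v.
Proof. by apply/ffunP => S; rewrite !(extDE, extZE) mulrDr. Qed.
Lemma extZDl (c d : Cx R) u : (c + d) **: u = c **: u + d **: u.
Proof. by apply/ffunP => S; rewrite !(extDE, extZE) mulrDl. Qed.
Lemma extNZ (c : Cx R) u : - c **: u = - (c **: u).
Proof. by apply/ffunP => S; rewrite extNE !extZE mulNr. Qed.
Lemma extZN (c : Cx R) u : c **: (- u) = - (c **: u).
Proof. by apply/ffunP => S; rewrite extNE !extZE extNE mulrN. Qed.
Lemma extZBl (c d : Cx R) u : (c - d) **: u = c **: u - d **: u.
Proof. by rewrite extZDl extNZ. Qed.
Lemma extZBr (c : Cx R) u v : c **: (u - v) = c **: u - c **: v.
Proof. by rewrite extZDr extZN. Qed.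
Lemma extZA (c d : Cx R) u : c **: (d **: u) = (c * d) **: u.
Proof. by apply/ffunP => S; rewrite !extZE mulrA. Qed.
Lemma extZ1 u : (1 : Cx R) **: u = u.
Proof. by apply/ffunP => S; rewrite extZE mul1r. Qed.
Lemma extZN1 u : (-1 : Cx R) **: u = - u.
Proof. by rewrite extNZ extZ1. Qed.
Lemma ext0Z u : (0 : Cx R) **: u = 0.
Proof. by apply/ffunP => S; rewrite extZE mul0r ffunE. Qed.
Lemma extZ0 (c : Cx R) : c **: (0 : E) = 0.
Proof. by apply/ffunP => S; rewrite extZE ffunE mulr0. Qed.
Lemma extZ_sum (J : finType) (c : Cx R) (F : J -> E) :
  c **: (\sum_j F j) = \sum_j c **: F j.
Proof. exact: (big_morph _ (extZDr c) (extZ0 c)). Qed.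
Lemma ext_sumZ (J : finType) (F : J -> Cx R) u :
  (\sum_j F j) **: u = \sum_j F j **: u.
Proof. exact: (big_morph (fun c => c **: u) (fun c d => extZDl c d u) (ext0Z u)). Qed.

Section Linear.
Variable F : E -> E.
Hypothesis Flin : elinear F.

Lemma elin0 : F 0 = 0.
Proof. by have := Flin (-1) 0 0; rewrite !extZN1 !addNr. Qed.
Lemma elinD u v : F (u + v) = F u + F v.
Proof. by rewrite -[u in LHS]extZ1 Flin extZ1. Qed.
Lemma elinZ (c : Cx R) u : F (c **: u) = c **: F u.
Proof. by rewrite -[c **: u]addr0 Flin elin0 addr0. Qed.
Lemma elinN u : F (- u) = - F u.
Proof. by rewrite -extZN1 elinZ extZN1. Qed.
Lemma elinB u v : F (u - v) = F u - F v.
Proof. by rewrite elinD elinN. Qed.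
Lemma elin_sum (J : finType) (G : J -> E) : F (\sum_j G j) = \sum_j F (G j).
Proof. exact: (big_morph _ elinD elin0). Qed.
End Linear.

Lemma wedgePr u : elinear (wdg u).
Proof.
move=> c x y; apply/ffunP => S; rewrite extDE extZE !wdg_coef mulr_sumr -big_split /=.
by apply: eq_bigr => A _; rewrite extDE extZE mulrDr mulrCA.
Qed.

Lemma wedgePl u (c : Cx R) x y :
  wdg (c **: x + y) u = c **: wdg x u + wdg y u.
Proof.
apply/ffunP => S; rewrite extDE extZE !wdg_coef mulr_sumr -big_split /=.
by apply: eq_bigr => A _; rewrite extDE extZE mulrDr mulrDl mulrCA -!mulrA.
Qed.

Let wedgePl' u : elinear (wdg^~ u) := wedgePl u.

Lemma wedgeDr u x y : wdg u (x + y) = wdg u x + wdg u y.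
Proof. exact: (elinD (wedgePr u)). Qed.
Lemma wedgeDl u x y : wdg (x + y) u = wdg x u + wdg y u.
Proof. exact: (elinD (wedgePl' u)). Qed.
Lemma wedgeZr (c : Cx R) u x : wdg u (c **: x) = c **: wdg u x.
Proof. exact: (elinZ (wedgePr u)). Qed.
Lemma wedgeZl (c : Cx R) u x : wdg (c **: x) u = c **: wdg x u.
Proof. exact: (elinZ (wedgePl' u)). Qed.
Lemma wedge0r u : wdg u 0 = 0.
Proof. exact: (elin0 (wedgePr u)). Qed.
Lemma wedge0l u : wdg 0 u = 0.
Proof. exact: (elin0 (wedgePl' u)). Qed.
Lemma wedgeNr u x : wdg u (- x) = - wdg u x.
Proof. exact: (elinN (wedgePr u)). Qed.
Lemma wedgeNl u x : wdg (- x) u = - wdg x u.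
Proof. exact: (elinN (wedgePl' u)). Qed.
Lemma wedgeBr u x y : wdg u (x - y) = wdg u x - wdg u y.
Proof. exact: (elinB (wedgePr u)). Qed.
Lemma wedgeBl u x y : wdg (x - y) u = wdg x u - wdg y u.
Proof. exact: (elinB (wedgePl' u)). Qed.
Lemma wedge_sumr u (J : finType) (F : J -> E) :
  wdg u (\sum_j F j) = \sum_j wdg u (F j).
Proof. exact: (elin_sum (wedgePr u)). Qed.
Lemma wedge_suml u (J : finType) (F : J -> E) :
  wdg (\sum_j F j) u = \sum_j wdg (F j) u.
Proof. exact: (elin_sum (wedgePl' u)). Qed.

(** The sign in [e_s /\ e_S = ext_sgn s S e_(s |: S)] for [s] outside [S]: on its way to its place,
    [s] passes the elements of [S] below it. *)
Definition ext_sgn s S : Cx R := (-1) ^+ #|[set t in S | (t < s)%N]|.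

(** Interior product with the basis vector dual to [cov s]. The sign is that of left multiplication
    by [cov s], of which this is the transpose in the basis [e_S]. *)
Definition iprod : I -> E -> E := locked_with ext_key (fun s u =>
  [ffun S : {set I} => if s \in S then 0 else ext_sgn s S * u (s |: S)]).

Lemma iprodE s u S :
  iprod s u S = if s \in S then 0 else ext_sgn s S * u (s |: S).
Proof. by rewrite /iprod unlock ffunE. Qed.

Lemma iprodP s : elinear (iprod s).
Proof.
move=> c x y; apply/ffunP => S; rewrite extDE extZE !iprodE; case: ifP => _.
  by rewrite mulr0 addr0.
by rewrite extDE extZE mulrDr mulrCA.
Qed.

Lemma iprodZ s (c : Cx R) x : iprod s (c **: x) = c **: iprod s x.
Proof. exact: (elinZ (iprodP s)). Qed.
Lemma iprod0 s : iprod s 0 = 0.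
Proof. exact: (elin0 (iprodP s)). Qed.
Lemma iprodD s x y : iprod s (x + y) = iprod s x + iprod s y.
Proof. exact: (elinD (iprodP s)). Qed.
Lemma iprodN s x : iprod s (- x) = - iprod s x.
Proof. exact: (elinN (iprodP s)). Qed.
Lemma iprod_sum s (J : finType) (F : J -> E) :
  iprod s (\sum_j F j) = \sum_j iprod s (F j).
Proof. exact: (elin_sum (iprodP s)). Qed.

Lemma ext_sgnM s S : ext_sgn s S * ext_sgn s S = 1.
Proof. by rewrite -expr2 sqrr_sign. Qed.

Lemma ext_sgnD1 s S : ext_sgn s (S :\ s) = ext_sgn s S.
Proof.
congr (_ ^+ _); apply: eq_card => t; rewrite !inE.
by case: eqP => // ->; rewrite ltnn !andbF.
Qed.

Lemma ext_sgnU1 s S : ext_sgn s (s |: S) = ext_sgn s S.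
Proof.
congr (_ ^+ _); apply: eq_card => t; rewrite !inE.
by case: eqP => // ->; rewrite ltnn !andbF.
Qed.

Lemma ext_sgnU1r s t S : t \notin S ->
  ext_sgn s (t |: S) = (-1) ^+ (t < s)%N * ext_sgn s S.
Proof.
move=> tS; rewrite -exprD; congr (_ ^+ _).
rewrite (cardsD1 t) !inE eqxx /=; congr (_ + _)%N.
apply: eq_card => r; rewrite !inE.
by case: (eqVneq r t) => //= ->; rewrite (negbTE tS).
Qed.

Lemma ext_sgnD1r s t S : t \in S ->
  ext_sgn s (S :\ t) = (-1) ^+ (t < s)%N * ext_sgn s S.
Proof.
move=> tS; rewrite -[in RHS](finset.setD1K tS) ext_sgnU1r ?setD11// mulrA -expr2.
by rewrite sqrr_sign mul1r.
Qed.

Lemma wedge_covecE s u S :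
  wdg (cov s) u S = if s \in S then ext_sgn s S * u (S :\ s) else 0.
Proof.
rewrite wdg_coef; case: ifPn => sS; last first.
  rewrite big1 // => A AS; rewrite cov_coef.
  case: eqP => [As|_]; last by rewrite mulr0 mul0r.
  by rewrite As finset.sub1set (negbTE sS) in AS.
rewrite (bigD1 [set s]) ?finset.sub1set //= big1 ?addr0; last first.
  by move=> A /andP[_ /negbTE As]; rewrite cov_coef As mulr0 mul0r.
rewrite cov_coef eqxx mulr1; congr (_ * _).
rewrite -ext_sgnD1 /ext_sgn; congr (_ ^+ _).
set B := [set t in S :\ s | _].
rewrite -(card_imset _ (fun _ _ (e : (s, _) = (s, _)) => congr1 snd e)).
apply: eq_card => p; apply/idP/imsetP.
  rewrite !inE; case: p => p q /= /andP[/andP[/eqP-> h] qs].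
  by exists q => //; rewrite !inE h.
by case=> q; rewrite !inE => /andP[h qs] ->; rewrite /= eqxx h.
Qed.

(** The Clifford relation between exterior and interior multiplication. The derivation rule and the
    commutator of the Lefschetz operators are deduced from it without returning to signs of
    subsets. *)
Lemma iprod_wedge s t u :
  iprod s (wdg (cov t) u) =
  (s == t)%:R **: u - wdg (cov t) (iprod s u).
Proof.
apply/ffunP => S; rewrite extBE extZE iprodE !wedge_covecE iprodE.
have [<-{t}|st] := eqVneq s t.
  rewrite finset.setU11 finset.setD11 mul1r.
  case: ifPn => sS.
    by rewrite finset.setD1K // mulrA ext_sgnD1 ext_sgnM mul1r subrr.
  by rewrite ext_sgnU1 mulrA ext_sgnM mul1r finset.setU1K // subr0.
rewrite mul0r sub0r !inE eq_sym (negbTE st) /=.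
case: (boolP (t \in S)) => tS; last by rewrite mulr0 oppr0 if_same.
rewrite (fun_if (fun z => - (ext_sgn t S * z))) mulr0 oppr0.
case: ifPn => // sS.
rewrite ext_sgnU1r // ext_sgnD1r //.
have -> : (s |: S) :\ t = s |: S :\ t.
  apply/finset.setP => r; rewrite !inE.
  by case: (eqVneq r s) => [->|] //=; rewrite st.
case: ltngtP (st) => //= [_ _|_ _|/ord_inj->]; rewrite ?eqxx // ?expr1 ?expr0; ring.
Qed.

Lemma iprod_wedge_same s u :
  iprod s (wdg (cov s) u) = u - wdg (cov s) (iprod s u).
Proof. by rewrite iprod_wedge eqxx; congr (_ - _); exact: extZ1. Qed.

Lemma iprod_wedge_neq s t u : s != t ->
  iprod s (wdg (cov t) u) = - wdg (cov t) (iprod s u).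
Proof.
move=> /negbTE st; rewrite iprod_wedge st -[RHS]add0r; congr (_ - _).
exact: ext0Z.
Qed.

Lemma wedge_covecC s t u :
  wdg (cov s) (wdg (cov t) u) = - wdg (cov t) (wdg (cov s) u).
Proof.
apply/ffunP => S; rewrite extNE !wedge_covecE !inE.
have [<-|st] := eqVneq s t; first by rewrite /= mulr0 if_same oppr0.
case: (boolP (s \in S)) => sS; case: (boolP (t \in S)) => tS;
  rewrite /= ?mulr0 ?oppr0 //.
rewrite ext_sgnD1r // [ext_sgn s (S :\ t)]ext_sgnD1r //.
have -> : (S :\ t) :\ s = (S :\ s) :\ t.
  by apply/finset.setP => r; rewrite !inE andbCA.
case: ltngtP (st) => //= [_ _|_ _|/ord_inj->]; rewrite ?eqxx // ?expr1 ?expr0; ring.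
Qed.

Lemma iprodC s t u : iprod s (iprod t u) = - iprod t (iprod s u).
Proof.
apply/ffunP => S; rewrite extNE !iprodE !inE.
have [<-|st] := eqVneq s t; first by rewrite /= mulr0 if_same oppr0.
case: (boolP (s \in S)) => sS; case: (boolP (t \in S)) => tS;
  rewrite /= ?mulr0 ?oppr0 //.
rewrite ext_sgnU1r // [ext_sgn s (t |: S)]ext_sgnU1r // finset.setUCA.
case: ltngtP (st) => //= [_ _|_ _|/ord_inj->]; rewrite ?eqxx // ?expr1 ?expr0; ring.
Qed.

Definition ext_basis S : E := [ffun T : {set I} => (T == S)%:R].

Lemma ext_basisE u : u = \sum_S u S **: ext_basis S.
Proof.
apply/ffunP => T; rewrite ext_sumE.
rewrite (bigD1 T) //.
rewrite big1.
rewrite extZE.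
rewrite ffunE eqxx.
by rewrite /= mulr1 addr0.
by move=> S /= /negbTE ST; rewrite extZE ffunE eq_sym ST mulr0.
Qed.

Lemma wedge_covec_basis s S :
  s \notin S -> wdg (cov s) (ext_basis S) = ext_sgn s S **: ext_basis (s |: S).
Proof.
move=> sS; apply/ffunP => T; rewrite wedge_covecE extZE !ffunE.
case: ifPn => sT.
  have [->|ST] := eqVneq T (s |: S).
    by rewrite finset.setU1K // eqxx ext_sgnU1.
  case: eqP => [TS|]; last by rewrite !mulr0.
  by case/eqP: ST; rewrite -TS finset.setD1K.
case: eqP => [TS|]; last by rewrite mulr0.
by rewrite TS finset.setU11 in sT.
Qed.

Lemma ext_basis_ind (Q : E -> Prop) :
  (forall (c : Cx R) u v, Q u -> Q v -> Q (c **: u + v)) -> Q 0 ->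
  (forall S, Q (ext_basis S)) -> forall u, Q u.
Proof.
move=> Qlin Q0 Qb u; rewrite [u]ext_basisE.
apply: (big_ind Q) => // [x y Qx Qy|S _]; first by rewrite -[x]extZ1; exact: Qlin.
by rewrite -[_ **: _]addr0; exact: Qlin.
Qed.

(** Every monomial arises from [e1] by left multiplication with covectors, so an identity linear in
    [u] is checked by inserting one covector at a time. Associativity and compatibility with
    conjugation are proved this way. *)
Lemma ext_ind (Q : E -> Prop) :
  (forall (c : Cx R) u v, Q u -> Q v -> Q (c **: u + v)) -> Q 0 -> Q e1 ->
  (forall s u, Q u -> Q (wdg (cov s) u)) -> forall u, Q u.
Proof.
move=> Qlin Q0 Q1 Qw.
have QZ (c : Cx R) u : Q u -> Q (c **: u) by move=> Qu; rewrite -[_ **: _]addr0; exact: Qlin.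
have Qb k : forall S, #|S| = k -> Q (ext_basis S).
  elim: k => [|k IH] S Sk.
    move/eqP: Sk; rewrite cards_eq0 => /eqP->.
    have -> : ext_basis finset.set0 = e1 by apply/ffunP => S'; rewrite e1_coef ffunE.
    by [].
  have /card_gt0P[s sS] : (0 < #|S|)%N by rewrite Sk.
  have -> : ext_basis S = ext_sgn s S **: wdg (cov s) (ext_basis (S :\ s)).
    rewrite wedge_covec_basis ?finset.setD11 // extZA ext_sgnD1 ext_sgnM extZ1.
    by rewrite finset.setD1K.
  apply/QZ/Qw/IH; move: Sk; rewrite (cardsD1 s) sS => -[]; exact.
by apply: ext_basis_ind => // S; exact: Qb.
Qed.

Lemma wedge1l u : wdg e1 u = u.
Proof.
apply/ffunP => S; rewrite wdg_coef (bigD1 finset.set0) ?finset.sub0set //= big1 ?addr0.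
  rewrite e1_coef eqxx finset.setD0 mulr1 (_ : [set p in _ | _] = finset.set0) ?cards0 ?mul1r//.
  by apply/finset.setP => -[p q]; rewrite !inE.
by move=> A /andP[_ /negbTE A0]; rewrite e1_coef A0 mulr0 mul0r.
Qed.

Lemma card_inversions A D :
  #|[set p in finset.setX A D | (p.2 < p.1)%N]| =
  (\sum_(i in A) #|[set t in D | (t < i)%N]|)%N.
Proof.
under [RHS]eq_bigr do rewrite -sum1_card.
rewrite -sum1_card pair_big_dep /=; apply: eq_bigl => -[p q].
by rewrite !inE andbA.
Qed.

(** The subsets of [S] containing [s] are written [s |: B]. With [D] the complement, the elements of
    [S] below [s] split into those of [B] and those of [D], and the inversions of [s |: B] against
    [D] split into those of [s] and those of [B]. *)
Lemma wedge_covecA s u v :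
  wdg (wdg (cov s) u) v = wdg (cov s) (wdg u v).
Proof.
apply/ffunP => S; rewrite wedge_covecE [LHS]wdg_coef.
under eq_bigr do rewrite wedge_covecE.
case: ifPn => sS; last first.
  apply: big1 => A AS; case: ifPn => [sA|_]; last by rewrite mulr0 mul0r.
  by rewrite (fintype.subsetP AS _ sA) in sS.
rewrite (bigID (fun A => s \in A)) /= [X in _ + X]big1 ?addr0; last first.
  by move=> A /andP[_ /negbTE->]; rewrite mulr0 mul0r.
rewrite wdg_coef mulr_sumr (reindex_onto (fun B => s |: B) (fun A => A :\ s)) /=; last first.
  by move=> A /andP[_ sA]; rewrite finset.setD1K.
apply: eq_big => [B|B].
  rewrite finset.subUset finset.sub1set sS /= finset.setU11 andbT finset.subsetD1; congr (_ && _).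
  apply/eqP/idP => [<-|sB]; first by rewrite finset.setD11.
  by rewrite finset.setU1K.
rewrite finset.subUset finset.sub1set sS /= finset.setU11 andbT => /andP[BS /eqP Bs].
have sB : s \notin B by rewrite -Bs finset.setD11.
have BE : (S :\ s) :\: B = S :\: (s |: B).
  by apply/finset.setP => r; rewrite !inE negb_or andbCA andbA.
rewrite Bs BE -!mulrA; set D := S :\: _; rewrite !mulrA; congr (_ * _ * _).
rewrite ext_sgnU1 /ext_sgn -!exprD; congr (_ ^+ _).
have -> : #|[set t in S | (t < s)%N]| =
    (#|[set t in B | (t < s)%N]| + #|[set t in D | (t < s)%N]|)%N.
  rewrite -(cardsID B); congr (_ + _)%N; apply: eq_card => t; rewrite !inE.
    have [tB|] := boolP (t \in B); last by rewrite andbF.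
    by rewrite (fintype.subsetP BS) // andbT.
  have [->|ts] := eqVneq t s; first by rewrite ltnn !andbF.
  by rewrite /= -andbA.
rewrite !card_inversions big_setU1 //= addnC addnA; congr (_ + _)%N.
Qed.

Lemma wedgeA u v w : wdg (wdg u v) w = wdg u (wdg v w).
Proof.
elim/ext_ind: u => [c x y IHx IHy|||s u IH].
- by rewrite !wedgePl IHx IHy.
- by rewrite !wedge0l.
- by rewrite !wedge1l.
- by rewrite !wedge_covecA IH.
Qed.

Lemma wedge1r u : wdg u e1 = u.
Proof.
elim/ext_ind: u => [c x y IHx IHy|||s u IH].
- by rewrite wedgePl IHx IHy.
- by rewrite wedge0l.
- by rewrite wedge1l.
- by rewrite wedge_covecA IH.
Qed.

(** The parity involution. It carries the sign produced when a covector or a contraction passes a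
    form, so that the derivation rule holds for inhomogeneous forms. *)
Definition grade : E -> E :=
  locked_with ext_key (fun u => [ffun S : {set I} => (-1) ^+ #|S| * u S]).

Lemma gradeE u S : grade u S = (-1) ^+ #|S| * u S.
Proof. by rewrite /grade unlock ffunE. Qed.

Lemma gradeP : elinear grade.
Proof.
move=> c x y; apply/ffunP => S; rewrite gradeE !extDE !extZE !gradeE.
by rewrite mulrDr mulrCA.
Qed.

Lemma grade0 : grade 0 = 0.
Proof. exact: (elin0 gradeP). Qed.

Lemma grade1 : grade e1 = e1.
Proof.
apply/ffunP => S; rewrite gradeE e1_coef; case: eqP => [->|_]; last by rewrite mulr0.
by rewrite cards0 mul1r.
Qed.

Lemma grade_covec s u : grade (wdg (cov s) u) = - wdg (cov s) (grade u).
Proof.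
apply/ffunP => S; rewrite extNE gradeE !wedge_covecE gradeE.
case: ifPn => sS; last by rewrite mulr0 oppr0.
by rewrite [in LHS](cardsD1 s) sS exprS; ring.
Qed.

Lemma gradeK : involutive grade.
Proof. by move=> u; apply/ffunP => S; rewrite !gradeE mulrA -expr2 sqrr_sign mul1r. Qed.

Lemma iprod1 s : iprod s e1 = 0.
Proof.
apply/ffunP => S; rewrite iprodE e1_coef ffunE; case: ifPn => // sS.
case: eqP => [e|]; last by rewrite mulr0.
by have := finset.setU11 s S; rewrite e inE.
Qed.

Lemma iprodM s u v :
  iprod s (wdg u v) = wdg (iprod s u) v + wdg (grade u) (iprod s v).
Proof.
elim/ext_ind: u => [c x y IHx IHy|||t u IH].
- rewrite wedgeDl wedgeZl !iprodP gradeP IHx IHy.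
  rewrite (wedgePl v c (iprod s x)).
  rewrite (wedgePl _ c (grade x)).
  rewrite extZDr.
  by rewrite addrACA.
- by rewrite wedge0l iprod0 grade0 !wedge0l addr0.
- by rewrite wedge1l iprod1 wedge0l grade1 wedge1l add0r.
- rewrite wedge_covecA !iprod_wedge IH grade_covec wedgeBl wedgeZl wedgeNl.
  by rewrite !wedge_covecA wedgeDr opprD addrA.
Qed.

Lemma covec_comm s u : wdg (cov s) u = wdg (grade u) (cov s).
Proof.
elim/ext_ind: u => [c x y IHx IHy|||t u IH].
- by rewrite wedgeDr wedgeZr IHx IHy gradeP wedgePl.
- by rewrite wedge0r grade0 wedge0l.
- by rewrite wedge1r grade1 wedge1l.
- by rewrite wedge_covecC IH grade_covec wedgeNl wedge_covecA.
Qed.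

End ExteriorAlgebra.

(** * Degrees and divided powers *)

Section Degrees.
Context {R : realType} {n : nat}.
Local Notation E := (ext R n).
Local Notation I := 'I_(n + n).
Implicit Types (u v w x y : E) (s t : I) (S T A B D : {set I}).

(** [has_degree] and [has_bidegree] are both instances up to conversion, so the closure rules below
    serve for both once [Q] is given. *)
Definition graded (Q : {set I} -> Prop) u := forall S, u S != 0 -> Q S.

Section Graded.
Variable Q : {set I} -> Prop.

Lemma graded0 : graded Q 0.
Proof. by move=> S; rewrite ffunE eqxx. Qed.

Lemma gradedP (c : Cx R) u v : graded Q u -> graded Q v -> graded Q (c **: u + v).
Proof.
move=> Qu Qv S; rewrite extDE extZE.
have [u0|/Qu//] := eqVneq (u S) 0.
by rewrite u0 mulr0 add0r; exact: Qv.
Qed.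

Lemma gradedD u v : graded Q u -> graded Q v -> graded Q (u + v).
Proof. by move=> Qu Qv; rewrite -[u]extZ1; exact: gradedP. Qed.

Lemma gradedZ (c : Cx R) u : graded Q u -> graded Q (c **: u).
Proof. by move=> Qu; rewrite -[_ **: _]addr0; apply: gradedP => //; exact: graded0. Qed.

Lemma gradedN u : graded Q u -> graded Q (- u).
Proof. by move=> Qu; rewrite -extZN1; exact: gradedZ. Qed.

Lemma gradedB u v : graded Q u -> graded Q v -> graded Q (u - v).
Proof. by move=> Qu Qv; apply: gradedD => //; exact: gradedN. Qed.

Lemma graded_sum (J : finType) (F : J -> E) :
  (forall j, graded Q (F j)) -> graded Q (\sum_j F j).
Proof.
move=> QF; apply: (big_ind (graded Q)) => //; [exact: graded0|exact: gradedD].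
Qed.
End Graded.

Lemma has_degree_covec k s u : has_degree k u -> has_degree k.+1 (wdg (cov s) u).
Proof.
move=> ku S; rewrite wedge_covecE; case: ifPn => [sS|]; last by rewrite eqxx.
rewrite mulf_eq0 negb_or => /andP[_ /ku]; rewrite (cardsD1 s S) sS => ->; exact: add1n.
Qed.

Lemma has_degree_iprod k s u : has_degree k.+1 u -> has_degree k (iprod s u).
Proof.
move=> ku S; rewrite iprodE; case: ifPn => [|sS]; first by rewrite eqxx.
by rewrite mulf_eq0 negb_or => /andP[_ /ku]; rewrite cardsU1 sS => -[].
Qed.

Lemma degree0E u : has_degree 0 u -> u = u finset.set0 **: e1.
Proof.
move=> u0; apply/ffunP => S; rewrite extZE e1_coef.
have [->|S0] := eqVneq S finset.set0; first by rewrite mulr1.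
rewrite mulr0; apply/eqP/negPn/negP => /u0/eqP; rewrite cards_eq0.
exact/negP.
Qed.

Lemma iprod_degree0 s u : has_degree 0 u -> iprod s u = 0.
Proof. by move/degree0E ->; rewrite iprodZ iprod1 extZ0. Qed.

Definition hol S := [set a : 'I_n | lshift n a \in S].
Definition ahol S := [set a : 'I_n | rshift n a \in S].

Lemma card_hol_ahol S : (#|hol S| + #|ahol S|)%N = #|S|.
Proof.
rewrite -[in RHS]sum1_card big_mkcond /= big_split_ord /= -!big_mkcond /= !sum1_card.
by congr (_ + _)%N; apply: eq_card => a; rewrite !inE.
Qed.

Lemma bidegree_degree p q u : has_bidegree p q u -> has_degree (p + q) u.
Proof. by move=> pq S /pq[<- <-]; rewrite -card_hol_ahol. Qed.

Lemma hol_card a S : (lshift n a \in S -> #|hol S| = #|hol (S :\ lshift n a)|.+1)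
  /\ #|hol (S :\ rshift n a)| = #|hol S|.
Proof.
split=> [aS|].
  rewrite (cardsD1 a) inE aS; congr _.+1; apply: eq_card => b; rewrite !inE.
  by rewrite (inj_eq (@lshift_inj _ _)).
by apply: eq_card => b; rewrite !inE eq_lrshift.
Qed.

Lemma ahol_card a S : (rshift n a \in S -> #|ahol S| = #|ahol (S :\ rshift n a)|.+1)
  /\ #|ahol (S :\ lshift n a)| = #|ahol S|.
Proof.
split=> [aS|].
  rewrite (cardsD1 a) inE aS; congr _.+1; apply: eq_card => b; rewrite !inE.
  by rewrite (inj_eq (@rshift_inj _ _)).
by apply: eq_card => b; rewrite !inE eq_rlshift.
Qed.

Lemma has_bidegree_dz p q a u :
  has_bidegree p q u -> has_bidegree p.+1 q (wdg (dzc a) u).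
Proof.
move=> pq S; rewrite wedge_covecE; case: ifPn => [sS|]; last by rewrite eqxx.
rewrite mulf_eq0 negb_or => /andP[_ /pq[<- <-]].
by have [/(_ sS) <- _] := hol_card a S; have [_ ->] := ahol_card a S.
Qed.

Lemma has_bidegree_dzbar p q a u :
  has_bidegree p q u -> has_bidegree p q.+1 (wdg (dzbarc a) u).
Proof.
move=> pq S; rewrite wedge_covecE; case: ifPn => [sS|]; last by rewrite eqxx.
rewrite mulf_eq0 negb_or => /andP[_ /pq[<- <-]].
by have [/(_ sS) <- _] := ahol_card a S; have [_ ->] := hol_card a S.
Qed.

Lemma has_bidegree_iprod_dz p q a u :
  has_bidegree p.+1 q u -> has_bidegree p q (iprod (lshift n a) u).
Proof.
move=> pq S; rewrite iprodE; case: ifPn => [|sS]; first by rewrite eqxx.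
rewrite mulf_eq0 negb_or => /andP[_ /pq].
set T := _ |: S; have ST : S = T :\ lshift n a by rewrite finset.setU1K.
have aT : lshift n a \in T by rewrite finset.setU11.
have [/(_ aT)] := hol_card a T; have [_] := ahol_card a T.
by rewrite -ST -/(hol T) -/(ahol T) => -> -> _ [[-> ->]].
Qed.

Lemma has_bidegree_iprod_dzbar p q a u :
  has_bidegree p q.+1 u -> has_bidegree p q (iprod (rshift n a) u).
Proof.
move=> pq S; rewrite iprodE; case: ifPn => [|sS]; first by rewrite eqxx.
rewrite mulf_eq0 negb_or => /andP[_ /pq].
set T := _ |: S; have ST : S = T :\ rshift n a by rewrite finset.setU1K.
have aT : rshift n a \in T by rewrite finset.setU11.
have [/(_ aT)] := ahol_card a T; have [_] := hol_card a T.
by rewrite -ST -/(hol T) -/(ahol T) => -> -> _ [-> [->]].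
Qed.

Lemma wedge_iprodE s u S :
  wdg (cov s) (iprod s u) S = (s \in S)%:R * u S.
Proof.
rewrite wedge_covecE iprodE; case: ifPn => sS; last by rewrite mul0r.
by rewrite finset.setD11 ext_sgnD1 mulrA ext_sgnM finset.setD1K.
Qed.

(** [wdg (cov s) (iprod s u)] keeps exactly the coefficients on sets containing [s], so the
    coefficient on [S] is counted once for each element of [S]. Dividing by the degree writes a form
    as a sum of covectors times forms of lower degree. *)
Lemma euler k u : has_degree k u ->
  \sum_s wdg (cov s) (iprod s u) = k%:R **: u.
Proof.
move=> ku; apply/ffunP => S; rewrite ext_sumE extZE.
under eq_bigr do rewrite wedge_iprodE; rewrite -mulr_suml -natr_sum.
have [->|/ku <-] := eqVneq (u S) 0; first by rewrite !mulr0.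
by rewrite -big_mkcond sum1_card.
Qed.

Lemma euler_dz p q u : has_bidegree p q u ->
  \sum_a wdg (dzc a) (iprod (lshift n a) u) = p%:R **: u.
Proof.
move=> pq; apply/ffunP => S; rewrite ext_sumE extZE.
under eq_bigr do rewrite wedge_iprodE; rewrite -mulr_suml -natr_sum.
have [->|/pq[<- _]] := eqVneq (u S) 0; first by rewrite !mulr0.
by rewrite -big_mkcond -sum1_card; congr (_%:R * _); apply: eq_bigl => a; rewrite inE.
Qed.

Lemma euler_dzbar p q u : has_bidegree p q u ->
  \sum_a wdg (dzbarc a) (iprod (rshift n a) u) = q%:R **: u.
Proof.
move=> pq; apply/ffunP => S; rewrite ext_sumE extZE.
under eq_bigr do rewrite wedge_iprodE; rewrite -mulr_suml -natr_sum.
have [->|/pq[_ <-]] := eqVneq (u S) 0; first by rewrite !mulr0.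
by rewrite -big_mkcond -sum1_card; congr (_%:R * _); apply: eq_bigl => a; rewrite inE.
Qed.

Definition top : E -> Cx R := locked_with ext_key (fun u => u [set: I]).

Lemma topE u : top u = u [set: I].
Proof. by rewrite /top unlock. Qed.

Lemma top0 : top 0 = 0.
Proof. by rewrite topE ffunE. Qed.

Lemma topP (c : Cx R) u v : top (c **: u + v) = c * top u + top v.
Proof. by rewrite !topE extDE extZE. Qed.

Lemma topD u v : top (u + v) = top u + top v.
Proof. by rewrite !topE extDE. Qed.

Lemma topZ (c : Cx R) u : top (c **: u) = c * top u.
Proof. by rewrite !topE extZE. Qed.

Lemma topN u : top (- u) = - top u.
Proof. by rewrite !topE extNE. Qed.

Lemma top_sum (J : finType) (F : J -> E) : top (\sum_j F j) = \sum_j top (F j).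
Proof. exact: (big_morph _ topD top0). Qed.

Lemma top_iprod s u : top (iprod s u) = 0.
Proof. by rewrite topE iprodE inE. Qed.

Lemma degree1E u : has_degree 1 u ->
  u = \sum_s iprod s u finset.set0 **: cov s.
Proof.
move=> u1; rewrite -[LHS]extZ1 -[1]/(1%:R) -(euler u1).
apply: eq_bigr => s _; have /degree0E -> := has_degree_iprod (s := s) u1.
rewrite wedgeZr wedge1r; congr (_ **: _).
by rewrite [RHS]extZE e1_coef eqxx mulr1.
Qed.

(** Euler's formula, applied twice, writes [w] as half a combination of products of two covectors;
    passing [x] across both applies [grade] twice, which is the identity. *)
Lemma degree2_comm w x : has_degree 2 w -> wdg w x = wdg x w.
Proof.
move=> w2; rewrite -[w]extZ1 -(@mulVf (Cx R) 2%:R) ?pnatr_eq0 // -extZA.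
rewrite -(euler w2) !(wedgeZl, wedgeZr); congr (_ **: _).
rewrite wedge_suml wedge_sumr; apply: eq_bigr => s _.
rewrite [iprod s w](degree1E (has_degree_iprod w2)).
rewrite wedge_sumr wedge_suml wedge_sumr; apply: eq_bigr => t _.
rewrite !(wedgeZl, wedgeZr); congr (_ **: _).
by rewrite wedgeA (covec_comm t) -wedgeA (covec_comm s) gradeK wedgeA.
Qed.

Lemma grade_degree k u : has_degree k u -> grade u = (-1) ^+ k **: u.
Proof.
move=> ku; apply/ffunP => S; rewrite gradeE extZE.
by have [->|/ku ->//] := eqVneq (u S) 0; rewrite !mulr0.
Qed.

Lemma divpowS w m : dpow w m.+1%:Z = (m.+1%:R)^-1 **: wdg w (dpow w m%:Z).
Proof.
rewrite -dpowE /divpow wdgE e1E !escaleE iterS wedgeZr extZA factS natrM invfM.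
by congr (_ **: _); rewrite mulrC.
Qed.

Lemma divpow0 w : dpow w 0 = e1.
Proof. by rewrite -dpowE -e1E /divpow /= fact0 invr1 escaleE extZ1. Qed.

Lemma dpowN1 w : dpow w (0%:Z - 1) = 0.
Proof. by rewrite -dpowE. Qed.

Lemma wedge_divpow w m : wdg w (dpow w m%:Z) = m.+1%:R **: dpow w m.+1%:Z.
Proof. by rewrite divpowS extZA mulfV ?extZ1 // pnatr_eq0. Qed.

(** A form of degree 2 commutes with everything, so a derivation acts on its divided powers as on
    those of a scalar variable. The convention [w_(-1) = 0] covers [m = 0]. *)
Lemma iprod_divpow s w m : has_degree 2 w ->
  iprod s (dpow w m%:Z) = wdg (iprod s w) (dpow w (m%:Z - 1)).
Proof.
move=> w2; elim: m => [|m IH]; first by rewrite divpow0 iprod1 dpowN1 wedge0r.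
rewrite divpowS iprodZ iprodM (grade_degree w2) sqrrN expr1n extZ1 IH.
have -> : m.+1%:Z - 1 = m%:Z by rewrite intS addrC addKr.
case: m {IH} => [|m]; first by rewrite divpow0 dpowN1 wedge0r wedge0r addr0 invr1 extZ1.
have -> : m.+1%:Z - 1 = m%:Z by rewrite intS addrC addKr.
rewrite (degree2_comm _ w2) wedgeA -(degree2_comm _ w2) wedge_divpow (wedgeZr m.+1%:R).
rewrite -[X in X + _]extZ1 -extZDl extZA nat1r.
by rewrite mulVf ?extZ1 // pnatr_eq0.
Qed.

End Degrees.

HB.instance Definition _ (R : realType) (n : nat) :=
  Monoid.isLaw.Build (ext R n) e1 wdg
    (fun x y z => esym (wedgeA x y z)) wedge1l wedge1r.

(** * Morphisms of the exterior algebra defined by anticommuting images of the covectors *)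

Section Substitution.
Context {R : realType} {n : nat}.
Local Notation E := (ext R n).
Local Notation I := 'I_(n + n).
Implicit Types (u v w x y : E) (s t : I) (S T A B D : {set I}).
Variable f : I -> E.
Hypothesis fC : forall s t x, wdg (f s) (wdg (f t) x) = - wdg (f t) (wdg (f s) x).

Lemma wedge_sqr0 s x : wdg (f s) (wdg (f s) x) = 0.
Proof.
have /eqP := fC s s x; rewrite -addr_eq0 -mulr2n -scaler_nat scaler_eq0 pnatr_eq0.
by move=> /eqP.
Qed.

Lemma ext_substP : elinear (ext_subst f).
Proof.
move=> c x y; rewrite /ext_subst extZ_sum -big_split /=; apply: eq_bigr => S _.
by rewrite !escaleE extDE extZE extZDl extZA.
Qed.

Lemma ext_substZ (c : Cx R) x : ext_subst f (c **: x) = c **: ext_subst f x.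
Proof. exact: (elinZ ext_substP). Qed.

Lemma ext_subst0 : ext_subst f 0 = 0.
Proof. exact: (elin0 ext_substP). Qed.

Lemma ext_subst_basis S :
  ext_subst f (ext_basis S) = \big[wdg/e1]_(s in S) f s.
Proof.
rewrite -wdgE -e1E.
rewrite /ext_subst (bigD1 S) //= [X in _ + X]big1 /= => [|T /negbTE TS].
  by rewrite addr0 ffunE eqxx escaleE extZ1.
by rewrite ffunE TS escaleE ext0Z.
Qed.

Lemma ext_subst1 : ext_subst f e1 = e1.
Proof.
have e : e1 = ext_basis finset.set0 :> E by apply/ffunP => S; rewrite e1_coef !ffunE.
by rewrite [in LHS]e ext_subst_basis big_set0.
Qed.

(** Induction along the sorted list: each factor of [S] met before [s] has a smaller index and costs
    one anticommutation with [f s]. *)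
Lemma big_wedge_insert (r : seq I) s S : sorted ltn (map val r) -> s \in r ->
  s \notin S ->
  \big[wdg/e1]_(t <- r | t \in s |: S) f t =
  (-1) ^+ count (fun t => (t \in S) && (t < s)%N) r **:
    wdg (f s) (\big[wdg/e1]_(t <- r | t \in S) f t).
Proof.
move=> + + sS; elim: r => // t r IH /= rsrt.
have rsorted := path_sorted rsrt.
have rt : forall q, q \in r -> (t < q)%N.
  move=> q qr; have /allP := order_path_min ltn_trans rsrt.
  by apply; exact: map_f.
rewrite inE; case: (eqVneq s t) => [ts _|st /= sr].
  move: ts => /esym ts; subst t.
  rewrite !big_cons finset.setU11 (negbTE sS) /= add0n.
  rewrite (@eq_in_count _ _ pred0) => [|q qr]; last first.
    by rewrite /= ltnNge (ltnW (rt q qr)) andbF.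
  rewrite count_pred0 extZ1; congr wdg.
  rewrite big_seq_cond [RHS]big_seq_cond; apply: eq_bigl => q.
  rewrite !inE; case: (eqVneq q s) => // ->; rewrite (negbTE sS) andbF.
  by apply/negbTE/negP => /andP[/rt]; rewrite ltnn.
rewrite !big_cons !inE eq_sym (negbTE st) /= rt // andbT.
case: ifPn => tS; rewrite IH //=.
by rewrite wedgeZr fC extZN exprS mulN1r extNZ.
Qed.

Lemma big_wedge_setU1 s S : s \notin S ->
  \big[wdg/e1]_(t in s |: S) f t =
  ext_sgn s S **: wdg (f s) (\big[wdg/e1]_(t in S) f t).
Proof.
move=> sS.
have e T : \big[wdg/e1]_(t in T) f t = \big[wdg/e1]_(t <- enum I | t \in T) f t.
  by rewrite enumT [index_enum _]unlock.
rewrite !e big_wedge_insert ?mem_enum //; last first.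
  by rewrite val_enum_ord iota_ltn_sorted.
congr (_ ^+ _ **: _); rewrite -sum1_count big_enum_cond -sum1_card.
by apply: eq_bigl => t; rewrite !inE.
Qed.

(** For [s] outside [S], inserting [s] produces the same sign before and after substitution. For [s]
    in [S], both sides vanish because [cov s] and [f s] square to zero. *)
Lemma ext_subst_covec s u :
  ext_subst f (wdg (cov s) u) = wdg (f s) (ext_subst f u).
Proof.
move: u; apply: ext_basis_ind => [c x y IHx IHy||S].
- by rewrite wedgeDr wedgeZr !ext_substP IHx IHy wedgeDr wedgeZr.
- by rewrite wedge0r ext_subst0 wedge0r.
have notin T : s \notin T -> ext_subst f (wdg (cov s) (ext_basis T)) =
    wdg (f s) (ext_subst f (ext_basis T)).
  move=> sT; rewrite wedge_covec_basis // ext_substZ !ext_subst_basis big_wedge_setU1 //.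
  by rewrite extZA ext_sgnM extZ1.
case: (boolP (s \in S)) => sS; last exact: notin.
have -> : ext_basis S = ext_sgn s S **: wdg (cov s) (ext_basis (S :\ s)) :> E.
  rewrite wedge_covec_basis ?finset.setD11 // extZA ext_sgnD1 ext_sgnM extZ1.
  by rewrite finset.setD1K.
rewrite (wedgeZr (ext_sgn s S) (cov s)).
have -> : wdg (cov s) (wdg (cov s) (ext_basis (S :\ s))) = 0 :> E.
  apply/ffunP => T; rewrite !wedge_covecE finset.setD11 mulr0 if_same.
  by rewrite ffunE.
rewrite extZ0 ext_subst0.
rewrite (ext_substZ (ext_sgn s S)).
rewrite notin ?finset.setD11 //.
by rewrite (wedgeZr (ext_sgn s S) (f s)) wedge_sqr0 extZ0.
Qed.

End Substitution.

(** * Conjugation *)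

Section Conjugation.
Context {R : realType} {n : nat}.
Local Notation E := (ext R n).
Local Notation I := 'I_(n + n).
Implicit Types (u v w x y : E) (s t : I) (S T A B D : {set I}).

Lemma conjCD (a b : Cx R) : (a + b)^* = a^* + b^*.
Proof. exact: rmorphD. Qed.
Lemma conjCM (a b : Cx R) : (a * b)^* = a^* * b^*.
Proof. exact: rmorphM. Qed.
Lemma conjCN (a : Cx R) : (- a)^* = - a^*.
Proof. exact: rmorphN. Qed.
Lemma conjCV (a : Cx R) : (a^-1)^* = (a^*)^-1.
Proof. exact: fmorphV. Qed.
Lemma conjC_sum (J : finType) (F : J -> Cx R) : (\sum_j F j)^* = \sum_j (F j)^*.
Proof. exact: rmorph_sum. Qed.

Definition conj_index s : I :=
  match fintype.split s with inl a => rshift n a | inr a => lshift n a end.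

Lemma conj_indexl a : conj_index (lshift n a) = rshift n a.
Proof. by rewrite /conj_index -[lshift n a]/(unsplit (inl a)) unsplitK. Qed.

Lemma conj_indexr a : conj_index (rshift n a) = lshift n a.
Proof. by rewrite /conj_index -[rshift n a]/(unsplit (inr a)) unsplitK. Qed.

Lemma conj_indexK : involutive conj_index.
Proof.
move=> s; rewrite -(splitK s); case: (fintype.split s) => a /=.
  by rewrite conj_indexl conj_indexr.
by rewrite conj_indexr conj_indexl.
Qed.

Definition conj_coef u : E := [ffun S => (u S)^*].

Lemma conj_coefE u S : conj_coef u S = (u S)^*.
Proof. by rewrite ffunE. Qed.

Lemma ext_conjE u : cnj u = ext_subst (fun s => cov (conj_index s)) (conj_coef u).
Proof.
rewrite -cnjE -covE; congr ext_subst; apply/funext => s.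
by rewrite /conj_index; case: fintype.split.
Qed.

Lemma ext_conjP (c : Cx R) x y :
  cnj (c **: x + y) = c^* **: cnj x + cnj y.
Proof.
rewrite !ext_conjE -ext_substP; congr ext_subst; apply/ffunP => S.
by rewrite extDE extZE !conj_coefE extDE extZE rmorphD rmorphM.
Qed.

Lemma ext_conj0 : cnj (0 : E) = 0.
Proof.
have := ext_conjP 0 0 (0 : E).
rewrite conjC0 !ext0Z !add0r => e; have := ext_conjP 1 0 (0 : E).
by rewrite [1 **: _]extZ1 addr0 conjC1 extZ1 -[LHS]addr0 => /addrI<-.
Qed.

Lemma ext_conjD x y : cnj (x + y) = cnj x + cnj y.
Proof. by rewrite -[x]extZ1 ext_conjP conjC1 !extZ1. Qed.

Lemma ext_conjZ (c : Cx R) x : cnj (c **: x) = c^* **: cnj x.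
Proof. by rewrite -[c **: x]addr0 ext_conjP ext_conj0 addr0. Qed.

Lemma ext_conjN x : cnj (- x) = - cnj x.
Proof. by rewrite -extZN1 ext_conjZ (rmorphN1 Num.conj) extZN1. Qed.

Lemma ext_conjB x y : cnj (x - y) = cnj x - cnj y.
Proof. by rewrite ext_conjD ext_conjN. Qed.

Lemma ext_conj_sum (J : finType) (F : J -> E) :
  cnj (\sum_j F j) = \sum_j cnj (F j).
Proof. exact: (big_morph _ ext_conjD ext_conj0). Qed.

Lemma ext_conj1 : cnj (e1 : E) = e1.
Proof.
rewrite ext_conjE -[RHS](ext_subst1 (fun s => cov (conj_index s))); congr ext_subst.
by apply/ffunP => S; rewrite conj_coefE !e1_coef conjC_nat.
Qed.

Lemma ext_conj_covec s u :
  cnj (wdg (cov s) u) = wdg (cov (conj_index s)) (cnj u).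
Proof.
rewrite !ext_conjE -(@ext_subst_covec _ _ (fun s => cov (conj_index s))) => [|t r x];
  last exact: wedge_covecC.
congr ext_subst; apply/ffunP => S; rewrite conj_coefE !wedge_covecE conj_coefE.
by case: ifPn => _; rewrite ?conjC0 // rmorphM /= /ext_sgn rmorph_sign.
Qed.

Lemma ext_conjM u v : cnj (wdg u v) = wdg (cnj u) (cnj v).
Proof.
move: u; apply: ext_ind => [c x y IHx IHy|||s u IH].
- by rewrite wedgePl !ext_conjP IHx IHy wedgePl.
- by rewrite wedge0l ext_conj0 wedge0l.
- by rewrite wedge1l ext_conj1 wedge1l.
- by rewrite wedge_covecA !ext_conj_covec IH wedge_covecA.
Qed.

Lemma ext_conjK : involutive (cnj : E -> E).
Proof.
apply: ext_ind => [c x y IHx IHy|||s u IH].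
- by rewrite (ext_conjP c x) (ext_conjP c^*) conjCK; congr (_ **: _ + _).
- by rewrite !ext_conj0.
- by rewrite !ext_conj1.
- by rewrite !ext_conj_covec IH conj_indexK.
Qed.

Lemma ext_conj_iprod s u : cnj (iprod s u) = iprod (conj_index s) (cnj u).
Proof.
move: u; apply: ext_ind => [c x y IHx IHy|||t u IH].
- by rewrite !iprodP !ext_conjP iprodP IHx IHy.
- by rewrite iprod0 ext_conj0 iprod0.
- by rewrite iprod1 ext_conj0 ext_conj1 iprod1.
- rewrite iprod_wedge ext_conjB ext_conjZ !ext_conj_covec iprod_wedge IH.
  by rewrite conjC_nat (inj_eq (inv_inj conj_indexK)).
Qed.

Lemma covecE s : cov s = wdg (cov s) e1 :> E.
Proof. by rewrite wedge1r. Qed.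

Lemma ext_conj_dz a : cnj (dzc a) = dzbarc a :> E.
Proof. by rewrite /dzc (covecE (lshift n a)) ext_conj_covec ext_conj1 wedge1r conj_indexl. Qed.

Lemma ext_conj_dzbar a : cnj (dzbarc a) = dzc a :> E.
Proof. by rewrite /dzbarc (covecE (rshift n a)) ext_conj_covec ext_conj1 wedge1r conj_indexr. Qed.

Lemma has_bidegree1 : has_bidegree 0 0 (e1 : E).
Proof.
move=> S; rewrite e1_coef; have [-> _|_] := eqVneq S finset.set0; last by rewrite eqxx.
by split; apply/eqP; rewrite cards_eq0; apply/eqP/finset.setP => a; rewrite !inE.
Qed.

Lemma has_bidegree_conj p q u : has_bidegree p q u -> has_bidegree q p (cnj u).
Proof.
have Hb k : forall S, #|S| = k ->
    has_bidegree #|ahol S| #|hol S| (cnj (ext_basis S) : E).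
  elim: k => [|k IH] S Sk.
    move/eqP: Sk; rewrite cards_eq0 => /eqP->.
    have -> : ext_basis finset.set0 = e1 :> E by apply/ffunP => S'; rewrite e1_coef ffunE.
    rewrite ext_conj1.
    have -> : #|ahol (finset.set0 : {set I})| = 0%N.
      by apply/eqP; rewrite cards_eq0; apply/eqP/finset.setP => a; rewrite !inE.
    have -> : #|hol (finset.set0 : {set I})| = 0%N.
      by apply/eqP; rewrite cards_eq0; apply/eqP/finset.setP => a; rewrite !inE.
    exact: has_bidegree1.
  have /card_gt0P[s sS] : (0 < #|S|)%N by rewrite Sk.
  have -> : ext_basis S = ext_sgn s S **: wdg (cov s) (ext_basis (S :\ s)) :> E.
    rewrite wedge_covec_basis ?finset.setD11 // extZA ext_sgnD1 ext_sgnM extZ1.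
    by rewrite finset.setD1K.
  have {}IH := IH (S :\ s) _.
  rewrite ext_conjZ ext_conj_covec; apply: (@gradedZ _ _ (fun S => _ /\ _)).
  have {IH} : has_bidegree #|ahol (S :\ s)| #|hol (S :\ s)| (cnj (ext_basis (S :\ s)) : E).
    by apply: IH; move: Sk; rewrite (cardsD1 s) sS => -[].
  rewrite -(splitK s) in sS *; case: (fintype.split s) sS => a /= aS.
    rewrite conj_indexl; have [-> // _] := hol_card a S; have [_ ->] := ahol_card a S.
    exact: has_bidegree_dzbar.
  rewrite conj_indexr; have [-> // _] := ahol_card a S; have [_ ->] := hol_card a S.
  exact: has_bidegree_dz.
move=> pq; rewrite [u]ext_basisE ext_conj_sum; apply: (@graded_sum _ _ (fun S => _ /\ _)) => S.
rewrite ext_conjZ; have [->|/pq[<- <-]] := eqVneq (u S) 0.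
  by rewrite conjC0 ext0Z; exact: (@graded0 _ _ (fun S => _ /\ _)).
by apply: (@gradedZ _ _ (fun S => _ /\ _)); exact: Hb.
Qed.

Lemma ext_conj_degree0 u : has_degree 0 u ->
  (cnj u) finset.set0 = (u finset.set0)^*.
Proof.
move/degree0E => e; rewrite {1}e ext_conjZ ext_conj1.
by rewrite [LHS]extZE e1_coef eqxx mulr1.
Qed.

(** Conjugation preserves the total degree, so no smaller monomial reaches the top, and the top
    monomial goes to a multiple of itself. The multiple stays implicit: its sign is never
    computed. *)
Lemma top_conj u :
  top (cnj u) = (top u)^* * top (cnj (ext_basis [set: I]) : E).
Proof.
move: u; apply: ext_basis_ind => [c x y IHx IHy||S].
- rewrite ext_conjP topP (topP c x) conjCD conjCM mulrDl -mulrA.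
  by congr (_ * _ + _).
- by rewrite ext_conj0 top0 conjC0 mul0r.
have [->|ST] := eqVneq S [set: I]; first by rewrite (topE (ext_basis _)) ffunE eqxx conjC1 mul1r.
rewrite (topE (ext_basis S)) ffunE eq_sym (negbTE ST) conjC0 mul0r topE.
apply/eqP/negPn/negP => /(has_bidegree_conj (p := #|hol S|) (q := #|ahol S|) _).
have H : has_bidegree #|hol S| #|ahol S| (ext_basis S : E).
  move=> T; rewrite ffunE; have [->|_] := eqVneq T S => //; by rewrite eqxx.
move=> /(_ H)[h1 h2]; case/eqP: ST; apply/eqP.
rewrite eqEcard finset.subsetT /= -(card_hol_ahol S) -(card_hol_ahol [set: I]).
by rewrite /hol h1 /ahol h2 addnC.
Qed.

Lemma ext_conj_dx a : cnj (dx a) = dx a :> E.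
Proof.
by rewrite /dx dzE dzbarE escaleE ext_conjZ ext_conjD ext_conj_dz ext_conj_dzbar addrC conjCV conjC_nat.
Qed.

Lemma ext_conj_dy a : cnj (dy a) = dy a :> E.
Proof.
rewrite /dy dzE dzbarE escaleE ext_conjZ ext_conjB ext_conj_dz ext_conj_dzbar conjCV conjCM conjC_nat.
by rewrite conjCi -opprB extZN mulrN invrN extNZ opprK.
Qed.

(** The reference form [dx_1 /\ dy_1 /\ ...] is real. Its top coefficient therefore undergoes the
    same unknown factor under conjugation as that of [u], and the factor cancels in the quotient. *)
Lemma density_conj u : density (cnj u) = (density u)^*.
Proof.
rewrite /density wdgE e1E; set V := \big[_/_]_(a < n) _.
have VV : cnj V = V.
  rewrite (big_morph _ ext_conjM ext_conj1); apply: eq_bigr => a _.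
  by rewrite ext_conjM ext_conj_dx ext_conj_dy.
rewrite -!topE top_conj conjCM conjCV.
have := top_conj V; rewrite VV; move: (top (cnj _)) (top V) => c v vE.
(* That the reference form is non-zero comes only later, with the standard metric; here a zero
   coefficient makes both sides zero by the convention on inverses. *)
have [->|v0] := eqVneq v 0; first by rewrite conjC0 invr0 !mulr0.
have c0 : c != 0 by apply: contra_eq_neq vE => ->; rewrite mulr0.
by rewrite {1}vE invfM mulrA mulrAC mulfK.
Qed.

Lemma densityP (c : Cx R) u v : density (c **: u + v) = c * density u + density v.
Proof. by rewrite /density -!topE topP mulrDl mulrA. Qed.

End Conjugation.

(** * Coefficients of a (1,1)-form *)

Section Hermitian.
Context {R : realType} {n : nat}.
Local Notation E := (ext R n).
Local Notation I := 'I_(n + n).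
Local Notation C := (Cx R).
Implicit Types (u v x y : E) (s t : I) (S T A B D : {set I}).
Variable w : E.
Hypothesis w11 : has_bidegree 1 1 w.
Local Notation h := (herm_mx w).

Lemma degree2_w : has_degree 2 w.
Proof. exact: bidegree_degree w11. Qed.

Lemma lshift_lt_rshift (a b : 'I_n) : (lshift n a < rshift n b)%N.
Proof. by rewrite /= (leq_trans (ltn_ord a)) // leq_addr. Qed.

(** No sign appears: [lshift n a] precedes [rshift n b] and is contracted first. The factor [i]
    undoes the [-i] in [herm_mx]. *)
Lemma iprod2_w a b :
  iprod (rshift n b) (iprod (lshift n a) w) = ('i * h a b) **: e1.
Proof.
have d0 := bidegree_degree
  (has_bidegree_iprod_dzbar (a := b) (has_bidegree_iprod_dz (a := a) w11)).
rewrite (degree0E d0); congr (_ **: _).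
rewrite mxE mulrA mulrN -expr2 sqrCi opprK mul1r !iprodE !inE.
rewrite orbF eq_lrshift finset.setU0.
rewrite (_ : ext_sgn _ finset.set0 = 1).
  rewrite mul1r (_ : ext_sgn _ _ = 1) ?mul1r //.
  rewrite /ext_sgn (_ : [set t in _ | _] = finset.set0) ?cards0 //.
  apply/finset.setP => t; rewrite !inE; case: eqVneq => //= ->.
  by apply/negbTE; rewrite -leqNgt ltnW // lshift_lt_rshift.
rewrite /ext_sgn (_ : [set t in _ | _] = finset.set0) ?cards0 //.
by apply/finset.setP => t; rewrite !inE.
Qed.

Lemma iprod_dz_w a : iprod (lshift n a) w = \sum_b ('i * h a b) **: dzbarc b.
Proof.
have := euler_dzbar (has_bidegree_iprod_dz (a := a) w11).
rewrite extZ1 => <-; apply: eq_bigr => b _.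
by rewrite iprod2_w wedgeZr wedge1r.
Qed.

Lemma iprod_dzbar_w b : iprod (rshift n b) w = - \sum_a ('i * h a b) **: dzc a.
Proof.
have := euler_dz (has_bidegree_iprod_dzbar (a := b) w11).
rewrite extZ1 => <-; rewrite -sumrN; apply: eq_bigr => a _.
by rewrite iprodC iprod2_w wedgeNr wedgeZr wedge1r.
Qed.

Lemma wE : w = \sum_a \sum_b ('i * h a b) **: wdg (dzc a) (dzbarc b).
Proof.
have := euler_dz w11; rewrite extZ1 => {1}<-; apply: eq_bigr => a _.
by rewrite iprod_dz_w wedge_sumr; apply: eq_bigr => b _; rewrite wedgeZr.
Qed.

Lemma herm_conj : cnj w = w -> forall a b, (h a b)^* = h b a.
Proof.
move=> wr a b.
have := iprod2_w b a; rewrite iprodC -{1}wr.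
rewrite -(conj_indexl a) -(conj_indexr b) -!ext_conj_iprod iprod2_w.
rewrite ext_conjZ ext_conj1 conjCM conjCi mulNr extNZ opprK.
move=> /(congr1 (fun u : E => u finset.set0)); rewrite !extZE e1_coef eqxx !mulr1.
by move=> /(mulfI (neq0Ci _)).
Qed.

End Hermitian.

(** * Contractions and the Lefschetz operators *)

Section Contraction.
Context {R : realType} {n : nat}.
Local Notation E := (ext R n).
Local Notation I := 'I_(n + n).
Local Notation C := (Cx R).
Implicit Types (u v x y : E) (s t : I) (S T A B D : {set I}) (f g : I -> C).

Definition contr : (I -> C) -> E -> E :=
  locked_with ext_key (fun f u => \sum_s f s **: iprod s u).

Lemma contrE f u : contr f u = \sum_s f s **: iprod s u.
Proof. by rewrite /contr unlock. Qed.

Lemma contrP f (c : C) u v : contr f (c **: u + v) = c **: contr f u + contr f v.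
Proof.
rewrite !contrE extZ_sum -big_split /=; apply: eq_bigr => s _.
by rewrite iprodP extZDr !extZA mulrC.
Qed.

Lemma contr0 f : contr f 0 = 0.
Proof. by rewrite !contrE big1 // => s _; rewrite iprod0 extZ0. Qed.

Lemma contrD f u v : contr f (u + v) = contr f u + contr f v.
Proof. by rewrite -[u]extZ1 contrP !extZ1. Qed.

Lemma contrZ f (c : C) u : contr f (c **: u) = c **: contr f u.
Proof. by rewrite -[c **: u]addr0 contrP contr0 addr0. Qed.

Lemma contr_sum f (J : finType) (F : J -> E) :
  contr f (\sum_j F j) = \sum_j contr f (F j).
Proof. exact: (big_morph _ (contrD f) (contr0 f)). Qed.

Lemma contrM f u v : contr f (wdg u v) = wdg (contr f u) v + wdg (grade u) (contr f v).
Proof.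
rewrite !contrE wedge_suml wedge_sumr -big_split /=; apply: eq_bigr => s _.
by rewrite iprodM extZDr wedgeZl wedgeZr.
Qed.

Lemma contr_covec f s u :
  contr f (wdg (cov s) u) = f s **: u - wdg (cov s) (contr f u).
Proof.
rewrite !contrE; under eq_bigr => t _ do rewrite iprod_wedge (extZBr (f t)).
rewrite sumrB wedge_sumr; congr (_ - _); last first.
  by apply: eq_bigr => t _; rewrite (wedgeZr (f t)).
rewrite (bigD1 s) //= [X in _ + X]big1 => [|t /negbTE ->].
  by rewrite eqxx extZA mulr1 addr0.
by rewrite extZA mulr0 ext0Z.
Qed.

Lemma contr_iprod f s u : contr f (iprod s u) = - iprod s (contr f u).
Proof.
rewrite !contrE iprod_sum -sumrN; apply: eq_bigr => t _.
by rewrite iprodC iprodZ extZN.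
Qed.

Lemma contrC f g u : contr f (contr g u) = - contr g (contr f u).
Proof.
rewrite [X in contr f X]contrE contr_sum [X in - X]contrE -sumrN; apply: eq_bigr => t _.
by rewrite contrZ contr_iprod extZN.
Qed.

Lemma top_contr f u : top (contr f u) = 0.
Proof.
rewrite !contrE; apply: (big_ind (fun u : E => top u = 0)) => [|x y x0 y0|s _].
- exact: top0.
- by rewrite -[x]extZ1 topP x0 y0 mulr0 addr0.
- by rewrite -[_ **: _]addr0 topP top_iprod top0 mulr0 addr0.
Qed.

Lemma contr_divpow f w m : has_degree 2 w ->
  contr f (dpow w m.+1%:Z) = wdg (contr f w) (dpow w m%:Z).
Proof.
have -> : m%:Z = m.+1%:Z - 1 by rewrite intS addrC addKr.
move=> w2; rewrite !contrE wedge_suml; apply: eq_bigr => s _.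
by rewrite iprod_divpow // wedgeZl.
Qed.

Lemma has_degree_contr k f u : has_degree k.+1 u -> has_degree k (contr f u).
Proof.
move=> ku; rewrite contrE; apply: graded_sum => s; apply: gradedZ; exact: has_degree_iprod.
Qed.

Lemma conj_contr f u :
  cnj (contr f u) = contr (fun s => (f (conj_index s))^*) (cnj u).
Proof.
rewrite !contrE ext_conj_sum [RHS](reindex_inj (inv_inj conj_indexK)).
by apply: eq_bigr => s _; rewrite ext_conjZ ext_conj_iprod conj_indexK.
Qed.

(* A contraction has no top coefficient, so that a derivation can be moved from
   one factor to the other as in an integration by parts. *)
Lemma top_move f s w y m : has_degree 2 w -> contr f w = cov s ->
  top (wdg (wdg (cov s) y) (dpow w m%:Z)) =
  - top (wdg (contr f y) (dpow w m.+1%:Z)).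
Proof.
move=> w2 fw; have := top_contr f (wdg y (dpow w m.+1%:Z)).
rewrite contrM contr_divpow // fw -wedgeA -covec_comm.
rewrite -[X in top (X + _)]extZ1 topP mul1r addrC => /eqP.
by rewrite addr_eq0 => /eqP.
Qed.

End Contraction.

(** * Metric duals of the coordinate covectors and the contraction operator of a metric *)

Section Metric.
Context {R : realType} {n : nat}.
Local Notation E := (ext R n).
Local Notation I := 'I_(n + n).
Local Notation C := (Cx R).
Implicit Types (u v x y : E) (s t : I) (S T A B D : {set I}) (f g : I -> C).
Variable w : E.
Hypothesis w11 : has_bidegree 1 1 w.
Hypothesis wr : cnj w = w.
Hypothesis hu : herm_mx w \in unitmx.
Local Notation h := (herm_mx w).
Local Notation k := (invmx (herm_mx w)).

Lemma kh a b : \sum_c k a c * h c b = (a == b)%:R.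
Proof. by have := congr1 (fun M : 'M[C]_n => M a b) (mulVmx hu); rewrite !mxE. Qed.

Lemma hk a b : \sum_c h a c * k c b = (a == b)%:R.
Proof. by have := congr1 (fun M : 'M[C]_n => M a b) (mulmxV hu); rewrite !mxE. Qed.

Lemma k_herm a b : (k a b)^* = k b a.
Proof.
have hh : (map_mx Num.conj h)^T = h.
  by apply/matrixP => i j; rewrite mxE [LHS]mxE herm_conj.
have -> : (k a b)^* = ((map_mx Num.conj k)^T) b a by rewrite [RHS]mxE [RHS]mxE.
by rewrite map_invmx trmx_inv hh.
Qed.

(** Together with [sharpb], the inverse of [v |-> iota_v w]: contracting [w] with [sharp c] gives
    [dzbarc c], with [sharpb c] it gives [dzc c]. The constants [-i] and [i] cancel the one in
    [w = sum i h_ab dz_a /\ dzbar_b]. *)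
Definition sharp (c : 'I_n) s : C :=
  match fintype.split s with inl a => - 'i * k c a | inr _ => 0 end.
Definition sharpb (c : 'I_n) s : C :=
  match fintype.split s with inl _ => 0 | inr b => 'i * k b c end.

Lemma sharpl c a : sharp c (lshift n a) = - 'i * k c a.
Proof. by rewrite /sharp -[lshift n a]/(unsplit (inl a)) unsplitK. Qed.
Lemma sharpr c a : sharp c (rshift n a) = 0.
Proof. by rewrite /sharp -[rshift n a]/(unsplit (inr a)) unsplitK. Qed.
Lemma sharpbl c a : sharpb c (lshift n a) = 0.
Proof. by rewrite /sharpb -[lshift n a]/(unsplit (inl a)) unsplitK. Qed.
Lemma sharpbr c b : sharpb c (rshift n b) = 'i * k b c.
Proof. by rewrite /sharpb -[rshift n b]/(unsplit (inr b)) unsplitK. Qed.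

Local Notation up c := (contr (sharp c)).
Local Notation upb c := (contr (sharpb c)).

Lemma upE c u : up c u = \sum_a (- 'i * k c a) **: iprod (lshift n a) u.
Proof.
rewrite !contrE big_split_ord /= [X in _ + X]big1 ?addr0; last first.
  by move=> a _; rewrite sharpr ext0Z.
by apply: eq_bigr => a _; rewrite sharpl.
Qed.

Lemma upbE c u : upb c u = \sum_b ('i * k b c) **: iprod (rshift n b) u.
Proof.
rewrite !contrE big_split_ord /= [X in X + _]big1 ?add0r; last first.
  by move=> a _; rewrite sharpbl ext0Z.
by apply: eq_bigr => a _; rewrite sharpbr.
Qed.

Lemma up_w c : up c w = dzbarc c.
Proof.
rewrite upE; under eq_bigr do rewrite iprod_dz_w // extZ_sum.
rewrite exchange_big /= (bigD1 c) //= [X in _ + X]big1 ?addr0 => [|b bc].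
  rewrite /=; under eq_bigr do rewrite extZA mulrACA mulNr -expr2 sqrCi opprK mul1r.
  by rewrite -ext_sumZ kh eqxx extZ1.
under eq_bigr do rewrite extZA mulrACA mulNr -expr2 sqrCi opprK mul1r.
by rewrite -ext_sumZ kh eq_sym (negbTE bc) ext0Z.
Qed.

Lemma upb_w c : upb c w = dzc c.
Proof.
rewrite upbE; under eq_bigr do rewrite iprod_dzbar_w // extZN extZ_sum -sumrN.
rewrite exchange_big /= (bigD1 c) //= [X in _ + X]big1 ?addr0 => [|b bc].
  rewrite /=; under eq_bigr do rewrite extZA mulrACA -expr2 sqrCi mulN1r extNZ opprK mulrC.
  by rewrite -ext_sumZ hk eqxx extZ1.
under eq_bigr do rewrite extZA mulrACA -expr2 sqrCi mulN1r extNZ opprK mulrC.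
by rewrite -ext_sumZ hk (negbTE bc) ext0Z.
Qed.

Lemma up_iprod a u : \sum_d ('i * h a d) **: up d u = iprod (lshift n a) u.
Proof.
under eq_bigr do rewrite upE extZ_sum.
rewrite exchange_big /= (bigD1 a) //= [X in _ + X]big1 ?addr0 => [|b bc].
  rewrite /=; under eq_bigr do rewrite extZA mulrACA mulrN -expr2 sqrCi opprK mul1r.
  by rewrite -ext_sumZ hk eqxx extZ1.
under eq_bigr do rewrite extZA mulrACA mulrN -expr2 sqrCi opprK mul1r.
by rewrite -ext_sumZ hk eq_sym (negbTE bc) ext0Z.
Qed.

Lemma upb_iprod a u : \sum_b (- 'i * h b a) **: upb b u = iprod (rshift n a) u.
Proof.
under eq_bigr do rewrite upbE extZ_sum.
rewrite exchange_big /= (bigD1 a) //= [X in _ + X]big1 ?addr0 => [|b bc].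
  rewrite /=; under eq_bigr do rewrite extZA mulrACA mulNr -expr2 sqrCi opprK mul1r mulrC.
  by rewrite -ext_sumZ kh eqxx extZ1.
under eq_bigr do rewrite extZA mulrACA mulNr -expr2 sqrCi opprK mul1r mulrC.
by rewrite -ext_sumZ kh (negbTE bc) ext0Z.
Qed.

Lemma conj_up c u : cnj (up c u) = upb c (cnj u).
Proof.
rewrite conj_contr; congr contr; apply/funext => s; rewrite -(splitK s).
case: (fintype.split s) => a /=; rewrite ?conj_indexl ?conj_indexr.
  by rewrite sharpr sharpbl conjC0.
by rewrite sharpl sharpbr conjCM conjCN conjCi opprK k_herm.
Qed.

Lemma conj_upb c u : cnj (upb c u) = up c (cnj u).
Proof. by rewrite -[u in LHS]ext_conjK -conj_up ext_conjK. Qed.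

(** The explicit double contraction that [LambdaE] identifies with the adjoint [Lambda]; on [w]
    itself it gives [n]. *)
Definition lam u : E := \sum_d iprod (rshift n d) (up d u).

(** The same double sum with the metric dual applied last, the form in which [top_move] can be used
    through [upb_w]. *)
Lemma lamE u : lam u = - \sum_a upb a (iprod (lshift n a) u).
Proof.
rewrite /lam; under eq_bigr do rewrite upE iprod_sum.
rewrite exchange_big -sumrN; apply: eq_bigr => a _.
rewrite upbE -sumrN; apply: eq_bigr => b _.
by rewrite iprodZ mulNr extNZ.
Qed.

Lemma lamP (c : C) u v : lam (c **: u + v) = c **: lam u + lam v.
Proof.
rewrite /lam extZ_sum -big_split; apply: eq_bigr => d _.
by rewrite contrP iprodP.
Qed.

Lemma has_degree_lam m u : has_degree m.+2 u -> has_degree m (lam u).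
Proof.
move=> mu; apply: graded_sum => d.
by apply: has_degree_iprod; apply: has_degree_contr.
Qed.

Lemma has_bidegree_up p q c u : has_bidegree p.+1 q u -> has_bidegree p q (up c u).
Proof.
move=> pq; rewrite upE; apply: (@graded_sum _ _ (fun S => _ /\ _)) => a.
by apply: (@gradedZ _ _ (fun S => _ /\ _)); exact: has_bidegree_iprod_dz.
Qed.

Lemma has_bidegree_upb p q c u : has_bidegree p q.+1 u -> has_bidegree p q (upb c u).
Proof.
move=> pq; rewrite upbE; apply: (@graded_sum _ _ (fun S => _ /\ _)) => a.
by apply: (@gradedZ _ _ (fun S => _ /\ _)); exact: has_bidegree_iprod_dzbar.
Qed.

Lemma has_bidegree_lam p q u : has_bidegree p.+1 q.+1 u -> has_bidegree p q (lam u).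
Proof.
move=> pq; apply: (@graded_sum _ _ (fun S => _ /\ _)) => a.
by apply: has_bidegree_iprod_dzbar; apply: has_bidegree_up.
Qed.

Lemma lam_contr f u : lam (contr f u) = contr f (lam u).
Proof.
rewrite /lam contr_sum; apply: eq_bigr => d _.
by rewrite contrC iprodN contr_iprod.
Qed.

(** Euler's formula in the holomorphic directions writes [p y] as the sum of the [dz_a /\ iota_a y].
    Since [dz_a] is a contraction of [w], [top_move] transfers each contraction to [iota_a y], and
    the sum becomes [lam y]. *)
Lemma top_lam p q y m : has_bidegree p q y ->
  p%:R * top (wdg y (dpow w m%:Z)) = top (wdg (lam y) (dpow w m.+1%:Z)).
Proof.
have w2 := degree2_w w11.
move=> pq; rewrite -topZ -wedgeZl -(euler_dz pq) lamE wedgeNl !wedge_suml.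
rewrite -sumrN.
rewrite !top_sum; apply: eq_bigr => a _.
by rewrite (top_move _ _ w2 (upb_w a)) topN.
Qed.

(** The commutator of the two Lefschetz operators. The [n] counts the double contractions falling on
    [w]; the mixed terms are the antiholomorphic and holomorphic halves of Euler's formula for
    [y]. *)
Lemma lam_wedge m y : has_degree m y ->
  lam (wdg w y) = wdg w (lam y) + (n%:R - m%:R) **: y.
Proof.
have w2 := degree2_w w11; have gw : grade w = w.
  by rewrite (grade_degree w2) sqrrN expr1n extZ1.
move=> my; rewrite /lam.
transitivity (\sum_d (y - wdg (dzbarc d) (iprod (rshift n d) y)
   + wdg (iprod (rshift n d) w) (up d y) + wdg w (iprod (rshift n d) (up d y)))).
  apply: eq_bigr => d _; rewrite contrM up_w gw iprodD iprod_wedge_same.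
  by rewrite [iprod _ (wdg w _)]iprodM gw addrA.
rewrite !big_split /= -wedge_sumr addrC; congr (_ + _).
rewrite sumr_const card_ord -scaler_nat escaleE extZBl -addrA; congr (_ + _).
rewrite -(euler my) big_split_ord /= sumrN addrC opprD; congr (_ - _).
under eq_bigr do rewrite iprod_dzbar_w // wedgeNl wedge_suml.
rewrite sumrN exchange_big /=; congr (- _); apply: eq_bigr => a _.
rewrite -(up_iprod a) wedge_sumr; apply: eq_bigr => d _.
by rewrite wedgeZl wedgeZr.
Qed.

Lemma top_bidegree_pp y m p : has_bidegree p.+1 p.+1 y -> lam y = 0 ->
  top (wdg y (dpow w m%:Z)) = 0.
Proof.
move=> pp y0; apply/eqP; have := top_lam m pp; rewrite y0 wedge0l top0 => /eqP.
by rewrite mulf_eq0 pnatr_eq0.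
Qed.

Local Notation ev u := (u finset.set0).

Lemma up_dzbar c b u : up c (wdg (dzbarc b) u) = - wdg (dzbarc b) (up c u).
Proof. by rewrite contr_covec sharpr ext0Z sub0r. Qed.

Lemma upb_dzbar c b u :
  upb c (wdg (dzbarc b) u) = ('i * k b c) **: u - wdg (dzbarc b) (upb c u).
Proof. by rewrite contr_covec sharpbr. Qed.

Section Primitive.
Variables (m : nat) (y : E).
Hypotheses (y21 : has_bidegree 2 1 y) (y0 : lam y = 0).

(** Moving [dzbarc c] leaves [up c y], which has bidegree (1,1) and is still annihilated by [lam]
    because [lam] commutes with contractions; [top_bidegree_pp] then applies. *)
Lemma top_dzbar_primitive c : top (wdg (wdg (dzbarc c) y) (dpow w m%:Z)) = 0.
Proof.
rewrite (top_move _ _ (degree2_w w11) (up_w c)).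
suff -> : top (wdg (up c y) (dpow w m.+1%:Z)) = 0 by rewrite oppr0.
apply: (@top_bidegree_pp _ m.+1 0); first exact: has_bidegree_up.
by rewrite lam_contr y0 contr0.
Qed.

End Primitive.

(* The Hodge star of a primitive form, tested against a monomial. *)
Lemma top_star_monomial m y a b c : has_bidegree 2 1 y -> lam y = 0 ->
  top (wdg (wdg (dzc a) (wdg (dzbarc b) (wdg (dzbarc c) y))) (dpow w m%:Z)) =
  ev (up c (up b (upb a y))) * top (dpow w m.+3%:Z).
Proof.
move=> y21 y0; have w2 := degree2_w w11.
rewrite (top_move _ _ w2 (upb_w a)) !upb_dzbar wedgeBr wedgeZr.
rewrite !wedgeBl.
rewrite !(wedgeZl ('i * _)).
 rewrite topD topN topD topN.
 rewrite !(topZ ('i * _)).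
(* The terms with a factor [i k] are of the form [dzbar /\ y] and vanish. The remaining term, where
   the contraction has reached [y], is treated by moving the two other covectors. *)
rewrite !(top_dzbar_primitive _ y21 y0) !mulr0 !sub0r !opprK.
rewrite (top_move _ _ w2 (up_w b)) up_dzbar wedgeNl topN opprK.
rewrite (top_move _ _ w2 (up_w c)).
have d0 : has_degree 0 (up c (up b (upb a y))).
  apply: (bidegree_degree (p := 0) (q := 0)).
  by apply/has_bidegree_up/has_bidegree_up/has_bidegree_upb.
by rewrite opprK {1}(degree0E d0) (wedgeZl (ev _)) wedge1l (topZ (ev _)).
Qed.

End Metric.

(** * The inner product and primitive forms *)

Section EnumSet.
Context {N : nat}.
Local Notation I := 'I_N.
Implicit Types (s t : I) (S T : {set I}).

Lemma sorted_enum_set S : sorted (fun s t : I => (s < t)%N) (enum S).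
Proof.
rewrite {1}/enum_mem; apply: sorted_filter; first by move=> ? ? ?; exact: ltn_trans.
have : sorted ltn (map val (enum I)) by rewrite val_enum_ord iota_ltn_sorted.
by rewrite sorted_map enumT.
Qed.

Lemma enum_split S s0 i : (i < #|S|)%N -> exists l1 l2,
  [/\ enum S = l1 ++ nth s0 (enum S) i :: l2, size l1 = i,
      all (fun t : I => (t < nth s0 (enum S) i)%N) l1 &
      all (fun t : I => (nth s0 (enum S) i < t)%N) l2].
Proof.
rewrite cardE => iS; exists (take i (enum S)), (drop i.+1 (enum S)).
have e : enum S = take i (enum S) ++ nth s0 (enum S) i :: drop i.+1 (enum S).
  by rewrite -drop_nth // cat_take_drop.
have tr : transitive (fun s t : I => (s < t)%N) by move=> ? ? ?; exact: ltn_trans.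
have := sorted_enum_set S; rewrite (sorted_pairwise tr) {1}e pairwise_cat /=.
rewrite allrel_consr => /and3P[/andP[h1 _] _ /andP[h2 _]].
by split=> //; rewrite size_take iS.
Qed.

(** [bump i] is the index map of [lift], so removing the i-th element of a set corresponds to
    deleting the i-th row or column of a Gram matrix. *)
Lemma enum_setD1_nth S s0 i j : (i < #|S|)%N ->
  nth s0 (enum (S :\ nth s0 (enum S) i)) j = nth s0 (enum S) (bump i j).
Proof.
move=> iS; have [l1 [l2 [e sz h1 h2]]] := enum_split s0 iS.
set t := nth s0 (enum S) i in e h1 h2 *.
have -> : enum (S :\ t) = l1 ++ l2.
  have -> : enum (S :\ t) = seq.filter (predC1 t) (enum S).
    by rewrite {2}/enum_mem -filter_predI; apply: eq_filter => r; rewrite !inE.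
  rewrite e filter_cat /= eqxx /=; congr (_ ++ _); apply/all_filterP.
    by apply: sub_all h1 => r; apply: contraTneq => ->; rewrite ltnn.
  by apply: sub_all h2 => r; apply: contraTneq => ->; rewrite ltnn.
rewrite e !nth_cat sz /bump; have [ij|ij] := leqP i j.
  by rewrite ltnNge (leq_trans ij) ?leq_addl // add1n subSn.
by rewrite add0n ij.
Qed.

(** Turns the sign [ext_sgn] into the sign [(-1)^i] of a cofactor. *)
Lemma card_lt_nth S s0 i : (i < #|S|)%N ->
  #|[set t in S | (t < nth s0 (enum S) i)%N]| = i.
Proof.
move=> iS; have [l1 [l2 [e sz h1 h2]]] := enum_split s0 iS.
set t := nth s0 (enum S) i in e h1 h2 *.
rewrite -sum1_card (eq_bigl (fun r : I => (r \in S) && (r < t)%N)); last first.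
  by move=> r; rewrite !inE.
rewrite -big_enum_cond sum1_count e count_cat /= ltnn add0n.
move: h1; rewrite all_count sz => /eqP ->.
rewrite (@eq_in_count _ _ pred0) ?count_pred0 ?addn0 // => r rl.
by have /(allP h2) := rl; rewrite /= ltnNge => /negbTE rt; apply/negbTE; rewrite -leqNgt ltnW // ltnNge rt.
Qed.

End EnumSet.

(** * Gram determinants and the adjoint of multiplication by a covector *)

Section Gram.
Context {R : realType} {n : nat}.
Local Notation E := (ext R n).
Local Notation I := 'I_(n + n).
Local Notation C := (Cx R).
Implicit Types (u v x y : E) (s t : I) (S T A B D : {set I}) (f g : I -> C).
Variable w : E.
Local Notation G := (gram1 w).

Lemma gramD m s0 S T : #|S| = m -> #|T| = m ->
  gram w S T = \det (\matrix_(i < m, j < m) G (nth s0 (enum S) i) (nth s0 (enum T) j)).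
Proof.
move=> <- TS; rewrite /gram TS eqxx mul1r; congr (\det _); apply/matrixP => i j.
rewrite [LHS]mxE [RHS]mxE (enum_val_nth s0); congr (gram1 w _ _); apply: set_nth_default.
by rewrite -cardE TS.
Qed.

Lemma gram_neq S T : #|S| != #|T| -> gram w S T = 0.
Proof. by move=> /negbTE ST; rewrite /gram ST mul0r. Qed.

Lemma ext_sgn_nth s0 S i : (i < #|S|)%N ->
  ext_sgn (nth s0 (enum S) i) S = (-1) ^+ i :> C.
Proof. by move=> iS; rewrite /ext_sgn card_lt_nth. Qed.

(** Laplace expansion along the column of [s]; the positions of [s] in [s |: T] and of [t] in [S]
    give the two signs of the cofactor. *)
Lemma gram_setU1 S T s : s \notin T ->
  gram w S (s |: T) =
  \sum_(t in S) ext_sgn s T * (G t s * (ext_sgn t S * gram w (S :\ t) T)).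
Proof.
move=> sT; have Ts : #|s |: T| = #|T|.+1 by rewrite cardsU1 sT.
have [ST|ST] := eqVneq #|S| #|T|.+1; last first.
  rewrite gram_neq ?Ts //; symmetry; apply: big1 => t tS.
  rewrite [gram _ _ _]gram_neq ?mulr0 //; apply: contra ST => /eqP <-.
  by rewrite (cardsD1 t) tS.
rewrite (gramD s ST Ts).
have pT : (index s (enum (s |: T)) < #|T|.+1)%N.
  by rewrite -Ts cardE index_mem mem_enum finset.setU11.
have ps : nth s (enum (s |: T)) (index s (enum (s |: T))) = s.
  by rewrite nth_index // mem_enum finset.setU11.
rewrite -[RHS]big_enum [RHS](big_nth s) -cardE ST [RHS]big_mkord.
rewrite (expand_det_col _ (Ordinal pT)).
have sp : ext_sgn s T = (-1) ^+ index s (enum (s |: T)) :> C.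
  by rewrite -ext_sgnU1 -{1}ps ext_sgn_nth // Ts.
apply: eq_bigr => i _; rewrite mxE [nth _ _ (Ordinal pT)]ps /cofactor.
have iS : (i < #|S|)%N by rewrite ST.
rewrite ext_sgn_nth // sp exprD mulrA.
have -> : gram w (S :\ nth s (enum S) i) T =
    \det (row' i (col' (Ordinal pT) (\matrix_(i, j) G (nth s (enum S) i) (nth s (enum (s |: T)) j)))).
  rewrite (gramD s (m := #|T|)) //; last first.
    move: ST; rewrite (cardsD1 (nth s (enum S) i)) -mem_enum mem_nth -?cardE //.
    by case.
  congr (\det _); apply/matrixP => j k; rewrite [LHS]mxE [RHS]mxE [RHS]mxE [RHS]mxE; congr (gram1 w _ _).
    by rewrite enum_setD1_nth.
  have -> : nat_of_ord (lift (Ordinal pT) k) = bump (index s (enum (s |: T))) k by [].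
  move: (nat_of_ord k) => l.
  rewrite -enum_setD1_nth ?Ts //; congr (nth s (enum _) l).
  by rewrite ps finset.setU1K.
by set X := \det _; ring.
Qed.

Lemma inner_basis S T : ext_inner w (ext_basis S) (ext_basis T) = gram w S T.
Proof.
rewrite /ext_inner (bigD1 S) //= [X in _ + X]big1 => [|A AS]; last first.
  by apply: big1 => B _; rewrite ffunE (negbTE AS) !mul0r.
rewrite (bigD1 T) //= [X in _ + X + _]big1 => [|B BT]; last first.
  by rewrite [ext_basis T B]ffunE (negbTE BT) conjC0 mulr0 mul0r.
by rewrite !addr0 !ffunE !eqxx conjC1 !mul1r.
Qed.

Lemma innerPl (c : C) u v x :
  ext_inner w (c **: u + v) x = c * ext_inner w u x + ext_inner w v x.
Proof.
rewrite /ext_inner mulr_sumr -big_split; apply: eq_bigr => S _ /=.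
rewrite mulr_sumr -big_split; apply: eq_bigr => T _ /=.
by rewrite extDE extZE; ring.
Qed.

Lemma innerPr (c : C) u v x :
  ext_inner w x (c **: u + v) = c^* * ext_inner w x u + ext_inner w x v.
Proof.
rewrite /ext_inner mulr_sumr -big_split; apply: eq_bigr => S _ /=.
rewrite mulr_sumr -big_split; apply: eq_bigr => T _ /=.
by rewrite extDE extZE conjCD conjCM; ring.
Qed.

Lemma inner0l x : ext_inner w 0 x = 0.
Proof. by have := innerPl (-1) 0 0 x; rewrite extZN1 !addNr mulN1r addNr. Qed.
Lemma inner0r x : ext_inner w x 0 = 0.
Proof.
have := innerPr (-1) 0 0 x; rewrite extZN1 addNr conjCN conjC1 mulN1r addNr.
exact.
Qed.
Lemma innerDl u v x : ext_inner w (u + v) x = ext_inner w u x + ext_inner w v x.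
Proof. by rewrite -[u in LHS]extZ1 innerPl mul1r. Qed.
Lemma innerDr u v x : ext_inner w x (u + v) = ext_inner w x u + ext_inner w x v.
Proof. by rewrite -[u in LHS]extZ1 innerPr conjC1 mul1r. Qed.
Lemma innerZl (c : C) u x : ext_inner w (c **: u) x = c * ext_inner w u x.
Proof. by rewrite -[c **: u]addr0 innerPl inner0l addr0. Qed.
Lemma innerZr (c : C) u x : ext_inner w x (c **: u) = c^* * ext_inner w x u.
Proof. by rewrite -[c **: u]addr0 innerPr inner0r addr0. Qed.
Lemma inner_suml (J : finType) (F : J -> E) x :
  ext_inner w (\sum_j F j) x = \sum_j ext_inner w (F j) x.
Proof. exact: (big_morph (fun u => ext_inner w u x) (fun u v => innerDl u v x) (inner0l x)). Qed.
Lemma inner_sumr (J : finType) (F : J -> E) x :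
  ext_inner w x (\sum_j F j) = \sum_j ext_inner w x (F j).
Proof. exact: (big_morph (ext_inner w x) (fun u v => innerDr u v x) (inner0r x)). Qed.

Lemma iprod_basis t S : iprod t (ext_basis S : E) =
  if t \in S then ext_sgn t S **: ext_basis (S :\ t) else 0.
Proof.
case: ifPn => tS; last first.
  apply/ffunP => T; rewrite iprodE ext0E ffunE; case: ifPn => // _.
  case: eqP => [TS|]; last by rewrite mulr0.
  by rewrite -TS finset.setU11 in tS.
rewrite -{1}(finset.setD1K tS).
have tS' : t \notin S :\ t by rewrite finset.setD11.
have := wedge_covec_basis (R := R) tS' => /(congr1 (iprod t)).
rewrite iprodZ iprod_wedge_same.
have -> : iprod t (ext_basis (S :\ t)) = 0 :> E.
  apply/ffunP => T; rewrite iprodE ext0E ffunE; case: ifPn => // _.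
  case: eqP => [TS|]; last by rewrite mulr0.
  by rewrite -TS finset.setU11 in tS'.
rewrite wedge0r subr0 ext_sgnD1 => ->.
by rewrite extZA ext_sgnM extZ1.
Qed.

(** On basis elements with [s] outside [T] this is the Laplace expansion of [gram_setU1]. For [s] in
    [T], both sides vanish, since multiplication by [cov s] and the contraction both square to
    zero. *)
Lemma inner_covec s y x :
  ext_inner w y (wdg (cov s) x) = ext_inner w (contr (fun t => G t s) y) x.
Proof.
have notin S T : s \notin T -> ext_inner w (ext_basis S) (wdg (cov s) (ext_basis T)) =
    ext_inner w (contr (fun t => G t s) (ext_basis S)) (ext_basis T).
  move=> sT; rewrite wedge_covec_basis // innerZr inner_basis gram_setU1 //.
  rewrite mulr_sumr contrE inner_suml big_mkcond; apply: eq_bigr => t _.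
  rewrite iprod_basis; case: ifPn => tS; last by rewrite extZ0 inner0l.
  rewrite !innerZl inner_basis [X in X * _]rmorph_sign -/(ext_sgn s T).
  by rewrite mulrA ext_sgnM mul1r.
have {}notin z T : s \notin T -> ext_inner w z (wdg (cov s) (ext_basis T)) =
    ext_inner w (contr (fun t => G t s) z) (ext_basis T).
  move=> sT; move: z; apply: ext_basis_ind => [c u v hu hv||S].
  - by rewrite contrP !innerPl hu hv.
  - by rewrite contr0 !inner0l.
  - exact: notin.
move: x; apply: ext_basis_ind => [c u v hu hv||T].
- by rewrite wedgePr !innerPr hu hv.
- by rewrite wedge0r !inner0r.
have [sT|sT] := boolP (s \in T); last exact: notin.
have sT' : s \notin T :\ s by rewrite finset.setD11.
have -> : ext_basis T = ext_sgn s T **: wdg (cov s) (ext_basis (T :\ s)) :> E.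
  by rewrite wedge_covec_basis // extZA ext_sgnD1 ext_sgnM extZ1 finset.setD1K.
rewrite wedgeZr !innerZr notin //.
have -> : contr (fun t => G t s) (contr (fun t => G t s) y) = 0.
  apply/ffunP => A; have := contrC (fun t => G t s) (fun t => G t s) y.
  move/ffunP/(_ A)/eqP; rewrite extNE -addr_eq0 -mulr2n -mulr_natl mulf_eq0 pnatr_eq0 /=.
  by move/eqP => ->; rewrite ffunE.
rewrite inner0l; have -> : wdg (cov s) (wdg (cov s) (ext_basis (T :\ s))) = 0 :> E.
  apply/ffunP => A; rewrite !wedge_covecE finset.setD11 mulr0 if_same.
  by rewrite ffunE.
by rewrite inner0r.
Qed.

End Gram.

(** * The adjoint of multiplication by the metric, primitive parts and the star formula *)

Section Adjoint.
Context {R : realType} {n : nat}.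
Local Notation E := (ext R n).
Local Notation I := 'I_(n + n).
Local Notation C := (Cx R).
Implicit Types (u v x y : E) (s t : I) (S T A B D : {set I}) (f g : I -> C).
Variable w : E.
Hypothesis w11 : has_bidegree 1 1 w.
Hypothesis wr : cnj w = w.
Hypothesis hu : herm_mx w \in unitmx.
Local Notation h := (herm_mx w).
Local Notation k := (invmx (herm_mx w)).
Local Notation up c := (contr (sharp w c)).
Local Notation upb c := (contr (sharpb w c)).
Local Notation ev u := (u finset.set0).
Local Notation "<< u , v >>" := (ext_inner w u v).

Lemma inner_dz a y x : <<y, wdg (dzc a) x>> = 'i * <<up a y, x>>.
Proof.
rewrite inner_covec -innerZl; congr (ext_inner w _ x).
rewrite !contrE extZ_sum; apply: eq_bigr => s _; rewrite extZA; congr (_ **: _).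
rewrite -(splitK s); case: (fintype.split s) => c /=.
  rewrite sharpl mulrA mulrN -expr2 sqrCi opprK mul1r /gram1 block_mxEul.
  by rewrite mxE.
by rewrite sharpr mulr0 /gram1 block_mxEdl mxE.
Qed.

Lemma inner_dzbar b y x : <<y, wdg (dzbarc b) x>> = - 'i * <<upb b y, x>>.
Proof.
rewrite inner_covec -innerZl; congr (ext_inner w _ x).
rewrite !contrE extZ_sum; apply: eq_bigr => s _; rewrite extZA; congr (_ **: _).
rewrite -(splitK s); case: (fintype.split s) => c /=.
  by rewrite sharpbl mulr0 /gram1 block_mxEur mxE.
by rewrite sharpbr mulrA mulNr -expr2 sqrCi opprK mul1r /gram1 block_mxEdr.
Qed.

(** Expanding [w] and moving each covector to the other side as a contraction produces the double
    sum [lam]. The conjugate coefficients of the second argument are matched by the hermitian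
    symmetry of [h]. *)
Lemma inner_wedge y x : <<lam w y, x>> = <<y, wdg w x>>.
Proof.
transitivity (<<y, wdg (\sum_a \sum_b ('i * h a b) **: wdg (dzc a) (dzbarc b)) x>>);
  last by rewrite -(wE w11).
rewrite wedge_suml inner_sumr /lam inner_suml; apply: eq_bigr => d _.
rewrite wedge_suml inner_sumr.
transitivity (\sum_b (- 'i * h b d) * <<upb b (up d y), x>>).
  by rewrite -(upb_iprod hu) inner_suml; apply: eq_bigr => b _; rewrite innerZl.
apply: eq_bigr => b _; rewrite wedgeZl innerZr wedge_covecA inner_dz inner_dzbar.
rewrite conjCM conjCi herm_conj //.
congr (_ * _).
by rewrite mulrA mulrN -expr2 sqrCi opprK mul1r.
Qed.

Lemma inner1 : <<e1, e1>> = 1.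
Proof.
have -> : e1 = ext_basis finset.set0 :> E.
  by apply/ffunP => S; rewrite e1_coef ffunE.
rewrite inner_basis /gram eqxx mul1r.
by move: (\matrix_(i, j) _); rewrite cards0 => M; exact: det_mx00.
Qed.

(** The kernel is stable under all interior products, because multiplication by a covector is
    adjoint to a contraction and [h] is invertible. Contracting down to degree 0 then reads off each
    coefficient. *)
Lemma inner_nondeg v : (forall x, <<v, x>> = 0) -> v = 0.
Proof.
have Niprod u s : (forall x, <<u, x>> = 0) -> forall x, <<iprod s u, x>> = 0.
  move=> u0 x; rewrite -(splitK s); case: (fintype.split s) => a /=.
    rewrite -(up_iprod hu) inner_suml big1 // => d _; rewrite innerZl.
    have /eqP := u0 (wdg (dzc d) x); rewrite inner_dz mulf_eq0.
    by rewrite (negbTE (neq0Ci _)) /= => /eqP ->; rewrite mulr0.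
  rewrite -(upb_iprod hu) inner_suml big1 // => d _; rewrite innerZl.
  have /eqP := u0 (wdg (dzbarc d) x); rewrite inner_dzbar mulf_eq0 oppr_eq0.
  by rewrite (negbTE (neq0Ci _)) /= => /eqP ->; rewrite mulr0.
(* For a form of the kernel without coefficients above size [m], contracting by an element of [T]
   lowers both sizes by one; at size 0 the pairing with [e1] gives the coefficient. *)
have K m : forall u, (forall x, <<u, x>> = 0) ->
    (forall T, (m < #|T|)%N -> u T = 0) -> forall T, #|T| = m -> u T = 0.
  elim: m => [|m IH] u u0 um T Tm.
    have ud : has_degree 0 u.
      move=> S uS; apply/eqP; apply: contraNT uS; rewrite -lt0n => /um ->.
      by rewrite eqxx.
    have := u0 e1; rewrite (degree0E ud) innerZl inner1 mulr1.
    by move=> ->; rewrite ext0Z ext0E.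
  have /card_gt0P[s sT] : (0 < #|T|)%N by rewrite Tm.
  have : iprod s u (T :\ s) = 0.
    apply: (IH _ (Niprod u s u0)).
      move=> S mS; rewrite iprodE; case: ifPn => // sS.
      by rewrite um ?mulr0 // cardsU1 sS.
    by move: Tm; rewrite (cardsD1 s) sT => -[].
  rewrite iprodE finset.setD11 finset.setD1K // => /eqP; rewrite mulf_eq0 signr_eq0 /=.
  by move/eqP.
(* Descending induction on the size of [T], started above the number of indices. *)
move=> v0; suff H m : forall T, (#|[set: I]| < #|T| + m)%N -> v T = 0.
  apply/ffunP => T; rewrite ext0E; apply: (H #|[set: I]|.+1).
  by rewrite addnS ltnS leq_addl.
elim: m => [|m IH] T.
  by rewrite addn0 ltnNge subset_leq_card // finset.subsetT.
rewrite addnS ltnS leq_eqVlt => /orP[/eqP Tm|/IH//].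
apply: (K #|T|) => // S TS; apply: IH; rewrite Tm.
by rewrite ltn_add2r.
Qed.

Lemma LambdaE u : Lambda w u = lam w u.
Proof.
apply: xget_unique => [x|y yE]; first by rewrite inner_wedge wdgE.
apply/eqP; rewrite -subr_eq0; apply/eqP/inner_nondeg => x.
by rewrite -extZN1 addrC innerPl yE inner_wedge wdgE mulN1r addNr.
Qed.

Lemma has_degree_wedge_w m b : has_degree m b -> has_degree m.+2 (wdg w b).
Proof.
move=> mb; rewrite [w](wE w11) wedge_suml; apply: graded_sum => a.
rewrite wedge_suml; apply: graded_sum => c; rewrite wedgeZl wedge_covecA.
by apply: gradedZ; apply: (has_degree_covec (k := m.+1)); exact: has_degree_covec.
Qed.

Lemma lam_wedge1 b : has_degree 1 b -> lam w (wdg w b) = (n%:R - 1) **: b.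
Proof.
move=> b1; rewrite (lam_wedge w11 hu b1).
have -> : lam w b = 0.
  rewrite /lam big1 // => d _; apply: iprod_degree0.
  exact: has_degree_contr.
by rewrite wedge0r add0r.
Qed.

Lemma lamD x y : lam w (x + y) = lam w x + lam w y.
Proof. by rewrite -[x in LHS]extZ1 lamP extZ1. Qed.

Lemma lamB x y : lam w (x - y) = lam w x - lam w y.
Proof. by rewrite addrC -extZN1 lamP extZN1 addrC. Qed.

Section Prim.
Hypothesis n1 : (1 < n)%N.
Variable u : E.
Hypothesis u3 : has_degree 3 u.
Let b := (n%:R - 1)^-1 **: lam w u.

Lemma n1_neq0 : (n%:R - 1 : C) != 0.
Proof. by rewrite subr_eq0 pnatr_eq1; case: n n1 => [|[]]. Qed.

Lemma has_degree_prim_form : has_degree 1 b.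
Proof. by apply: gradedZ; exact: has_degree_lam. Qed.

Lemma lam_prim_formula : lam w (u - wdg w b) = 0.
Proof.
by rewrite lamB (lam_wedge1 has_degree_prim_form) // extZA mulfV ?n1_neq0 // extZ1 subrr.
Qed.

(** Applying [lam] to a decomposition [u = p + w /\ b'] leaves [(n - 1) b'], which determines [b']
    and hence [p]; the same computation shows that this choice of [b] works. *)
Lemma primE : prim w u = u - wdg w b.
Proof.
have n10 := n1_neq0; have b1 := has_degree_prim_form.
apply: xget_unique.
  split; first exact: gradedB (has_degree_wedge_w b1).
    by rewrite LambdaE lam_prim_formula.
  by exists b; split=> //; rewrite wdgE subrK.
move=> p [p3]; rewrite LambdaE => p0 [b' [b1' ub]].
have lu : lam w u = (n%:R - 1) **: b'.
  by rewrite ub wdgE lamD p0 add0r lam_wedge1.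
by rewrite /b lu extZA mulVf // extZ1 ub wdgE addrK.
Qed.

Lemma lam_prim : lam w (prim w u) = 0.
Proof. by rewrite primE lam_prim_formula. Qed.
End Prim.

Lemma gram1_herm s t : (gram1 w s t)^* = gram1 w t s.
Proof.
rewrite -(splitK s) -(splitK t); case: (fintype.split s) => a; case: (fintype.split t) => b /=;
  rewrite /gram1 ?(block_mxEul, block_mxEur, block_mxEdl, block_mxEdr) ?mxE ?conjC0 //.
- exact: k_herm.
- exact: k_herm.
Qed.

Lemma inner_herm u v : <<u, v>> = (<<v, u>>)^*.
Proof.
have gramC S T : gram w S T = (gram w T S)^*.
  have [ST|ST] := eqVneq #|S| #|T|; last first.
    by rewrite !gram_neq ?conjC0 // eq_sym.
  (* Comparing the two enumerations uses a default index, available unless [S] is empty; there both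
     determinants have size 0. *)
  case: (set_0Vmem S) => [S0|[s0 _]].
    move/eqP: ST; rewrite S0 cards0 eq_sym cards_eq0 => /eqP->.
    rewrite /gram eqxx mul1r; symmetry; rewrite conj_Creal //.
    by move: (\matrix_(i, j) _); rewrite cards0 => M; rewrite det_mx00 rpred1.
  rewrite (gramD w s0 (erefl _) (esym ST)) (gramD w s0 (esym ST) (erefl _)).
  rewrite -det_tr -[RHS]det_map_mx; congr (\det _); apply/matrixP => i j.
  rewrite [LHS]mxE [LHS]mxE [RHS]mxE -gram1_herm; congr (Num.conj _).
  by rewrite [RHS]mxE.
rewrite /ext_inner conjC_sum exchange_big; apply: eq_bigr => S _.
rewrite conjC_sum; apply: eq_bigr => T _.
by rewrite gramC !conjCM conjCK; ring.
Qed.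

(* For a primitive form u of bidegree (1, 2), the Hodge star of the conjugate of
   u is i w_(n-3) /\ ubar. *)
Lemma star_primitive m u v : has_bidegree 1 2 u -> has_bidegree 1 2 v -> lam w u = 0 ->
  'i * top (wdg (wdg v (cnj u)) (dpow w m%:Z)) = <<v, u>> * top (dpow w m.+3%:Z).
Proof.
move=> u12 v12 u0.
have y21 : has_bidegree 2 1 (cnj u) by exact: has_bidegree_conj.
have y0 : lam w (cnj u) = 0.
  rewrite -ext_conj0 -u0 [in RHS]lamE ext_conjN ext_conj_sum -sumrN /lam.
  apply: eq_bigr => d _.
  by rewrite conj_upb // ext_conj_iprod conj_indexl contr_iprod opprK.
pose Q x := 'i * top (wdg (wdg x (cnj u)) (dpow w m%:Z)) = <<x, u>> * top (dpow w m.+3%:Z).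
have Q0 : Q 0 by rewrite /Q !wedge0l top0 inner0l mulr0 mul0r.
have QD x y : Q x -> Q y -> Q (x + y).
  by rewrite /Q => qx qy; rewrite !wedgeDl topD mulrDr qx qy innerDl mulrDl.
have QZ c x : Q x -> Q (c **: x).
  by rewrite /Q => qx; rewrite !wedgeZl topZ innerZl mulrCA qx mulrA.
have Qsum (F : 'I_n -> E) : (forall j, Q (F j)) -> Q (\sum_j F j).
  by move=> QF; apply: (big_ind Q).
(* Both sides are linear in [v], and Euler's formula in each direction reduces [v] to monomials. The
   factor 1/2 below accounts for the antiholomorphic degree 2. *)
suff Qm a b c : Q (wdg (dzc a) (wdg (dzbarc b) (wdg (dzbarc c) e1))).
  have ve := euler_dz v12; rewrite extZ1 in ve; rewrite -/(Q v) -ve; apply: (Qsum) => a.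
  have a02 := has_bidegree_iprod_dz (a := a) v12.
  have -> : iprod (lshift n a) v = (2%:R)^-1 **: (2%:R **: iprod (lshift n a) v).
    by rewrite extZA mulVf ?extZ1 // pnatr_eq0.
  rewrite -(euler_dzbar a02) wedgeZr; apply: (QZ); rewrite wedge_sumr; apply: (Qsum) => b.
  have b01 := has_bidegree_iprod_dzbar (a := b) a02.
  have be := euler_dzbar b01; rewrite extZ1 in be; rewrite -be !wedge_sumr; apply: (Qsum) => c.
  have /bidegree_degree/degree0E -> := has_bidegree_iprod_dzbar (a := c) b01.
  by rewrite !wedgeZr; apply: (QZ); exact: Qm.
have mE : wdg (wdg (dzc a) (wdg (dzbarc b) (wdg (dzbarc c) e1))) (cnj u) =
    wdg (dzc a) (wdg (dzbarc b) (wdg (dzbarc c) (cnj u))).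
  by rewrite !wedgeA wedge1l.
rewrite /Q mE (top_star_monomial w11 hu) //.
rewrite inner_herm inner_dz !inner_dzbar.
have d0 : has_degree 0 (upb c (upb b (up a u))).
  apply: (bidegree_degree (p := 0) (q := 0)).
  by apply/has_bidegree_upb/has_bidegree_upb/has_bidegree_up.
(* The constants [i], [-i], [-i] of the three adjunctions have conjugates with product [i], the
   factor on the left-hand side. *)
rewrite (degree0E d0) innerZl inner1 mulr1 !conjCM !conjCN !conjCi.
rewrite -ext_conj_degree0 // !conj_upb // conj_up //.
rewrite !mulrA; congr (_ * _ * _).
by rewrite opprK -!mulrA -expr2 sqrCi mulrN1 opprK.
Qed.

End Adjoint.

Close Scope set_scope.
Local Open Scope classical_set_scope.

(** * Continuity of families of forms *)

Section ComplexContinuity.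
Context {R : realType}.
Local Notation C := (Cx R).

Lemma ofRE (x : R) : ofR x = (x%:C)%C.
Proof. by []. Qed.

Lemma conjCxE (z : C) : z^* = mkC (reC z) (- imC z).
Proof. by case: z. Qed.

Lemma CxE (z : C) : z = ofR (reC z) + 'i * ofR (imC z).
Proof.
case: z => x y; apply/eqP; rewrite eq_complex /=.
by rewrite !mul0r !mul1r subr0 !add0r addr0 !eqxx.
Qed.

Lemma ofR_gt0 (e : R) : (0 < ofR e :> C) = (0 < e).
Proof. exact: (ltcR 0 e). Qed.

Lemma gt0_ofR (e : C) : 0 < e -> e = ofR (reC e) /\ 0 < reC e.
Proof. by case: e => x y; rewrite ltcE /= => /andP[/eqP -> ->]. Qed.

Lemma norm_ofR (x : R) : `|ofR x : C| = ofR `|x|.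
Proof. by rewrite normc_def /= expr0n addr0 sqrtr_sqr. Qed.

Lemma norm_reC (z : C) (e : R) : `|z| < ofR e -> `|reC z| < e.
Proof. by move=> ze; rewrite -ltcR; exact: le_lt_trans (normc_ge_Re z) ze. Qed.

Lemma reCD (z w : C) : reC (z + w) = reC z + reC w.
Proof. by case: z w => ? ? []. Qed.
Lemma imCD (z w : C) : imC (z + w) = imC z + imC w.
Proof. by case: z w => ? ? []. Qed.
Lemma reCN (z : C) : reC (- z) = - reC z.
Proof. by case: z. Qed.
Lemma imCN (z : C) : imC (- z) = - imC z.
Proof. by case: z. Qed.
Lemma reCB (z w : C) : reC (z - w) = reC z - reC w.
Proof. by rewrite reCD reCN. Qed.

Lemma reCM (z w : C) : reC (z * w) = reC z * reC w - imC z * imC w.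
Proof. by case: z w => ? ? []. Qed.
Lemma imCM (z w : C) : imC (z * w) = reC z * imC w + imC z * reC w.
Proof. by case: z w => ? ? [] /= ? ?. Qed.

Lemma reC_im (z : C) : imC z = reC (- 'i * z).
Proof. by rewrite reCM reCN imCN /= oppr0 mul0r sub0r mulN1r opprK. Qed.

Lemma continuous_reC : continuous (@reC R).
Proof.
move=> z; apply/(@cvgrPdist_lt _ _ _ (nbhs z)) => e e0.
have /(@cvgrPdist_lt _ _ _ (nbhs z))/(_ (ofR e)) : (fun w : C => w) @ z --> z by [].
rewrite ofR_gt0 => /(_ e0); apply: filterS => w.
by rewrite -reCB; exact: norm_reC.
Qed.

Lemma continuous_ofR : continuous (@ofR R).
Proof.
move=> x; apply/(@cvgrPdist_lt _ _ _ (nbhs x)) => e /gt0_ofR[-> e0].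
have /(@cvgrPdist_lt _ _ _ (nbhs x))/(_ _ e0) : (fun w : R => w) @ x --> x by [].
apply: filterS => w xw.
have -> : ofR x - ofR w = ofR (x - w) :> C.
  by apply/eqP; rewrite eq_complex /= subrr !eqxx.
by rewrite norm_ofR ltcR.
Qed.

Lemma continuous_imC : continuous (@imC R).
Proof.
move=> z; rewrite (_ : imC = fun w : C => reC (- 'i * w)); last first.
  by apply/funext => w; exact: reC_im.
apply: (@continuous_comp _ _ _ (fun w : C => - 'i * w) (@reC R)).
  apply: continuousM; [exact: cst_continuous|exact].
exact: continuous_reC.
Qed.

(** A one-constructor wrapper around the limit, so that unification treats continuity at a point as
    an opaque predicate. *)
Variant contat {T U : topologicalType} (x : T) (f : T -> U) : Prop :=
  Contat of f @ x --> f x.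

Lemma contat_ext {T U : topologicalType} (x : T) (f g : T -> U) :
  f =1 g -> contat x g -> contat x f.
Proof. by move=> /funext ->. Qed.

Lemma contat_near_ext {T U : topologicalType} (x : T) (f g : T -> U) :
  (\forall t \near x, f t = g t) -> contat x g -> contat x f.
Proof.
move=> fg [gx]; split; rewrite (nbhs_singleton fg).
apply: cvg_trans gx; apply: near_eq_cvg; apply: filterS fg => t ->; exact.
Qed.

Lemma contat_comp {T U V : topologicalType} (x : T) (f : T -> U) (g : U -> V) :
  contat x f -> contat (f x) g -> contat x (fun t => g (f t)).
Proof. by move=> [fx] [gx]; split; exact: (continuous_comp fx gx). Qed.

Section Pointwise.
Context {T : topologicalType}.
Implicit Types (f g : T -> C) (x : T).

Lemma ccontD f g x : contat x f -> contat x g ->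
  contat x (fun t => f t + g t).
Proof. by move=> [fx] [gx]; split; exact: (continuousD fx gx). Qed.
Lemma ccontB f g x : contat x f -> contat x g ->
  contat x (fun t => f t - g t).
Proof. by move=> [fx] [gx]; split; exact: (continuousB fx gx). Qed.
Lemma ccontM f g x : contat x f -> contat x g ->
  contat x (fun t => f t * g t).
Proof. by move=> [fx] [gx]; split; exact: (continuousM fx gx). Qed.
Lemma ccontV f x : f x != 0 -> contat x f ->
  contat x (fun t => (f t)^-1).
Proof. by move=> f0 [fx]; split; exact: (continuousV f0 fx). Qed.
Lemma ccont_cst (c : C) x : contat x (fun _ : T => c).
Proof. by split; exact: cst_continuous. Qed.
Lemma ccont_sum (J : Type) (r : seq J) (Q : pred J) (F : J -> T -> C) x :
  (forall j, Q j -> contat x (F j)) ->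
  contat x (fun t => \sum_(j <- r | Q j) F j t).
Proof.
move=> Fc; elim: r => [|j r IH].
  by apply: contat_ext (ccont_cst _ _) => t; rewrite big_nil.
case Qj: (Q j); last by apply: contat_ext IH => t; rewrite big_cons Qj.
apply: contat_ext => [t|]; first by rewrite big_cons Qj.
by apply: ccontD => //; exact: Fc.
Qed.
Lemma ccont_prod (J : Type) (r : seq J) (Q : pred J) (F : J -> T -> C) x :
  (forall j, Q j -> contat x (F j)) ->
  contat x (fun t => \prod_(j <- r | Q j) F j t).
Proof.
move=> Fc; elim: r => [|j r IH].
  by apply: contat_ext (ccont_cst _ _) => t; rewrite big_nil.
case Qj: (Q j); last by apply: contat_ext IH => t; rewrite big_cons Qj.
apply: contat_ext => [t|]; first by rewrite big_cons Qj.
by apply: ccontM => //; exact: Fc.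
Qed.
Lemma cont_reC f x : contat x f -> contat x (fun t => reC (f t)).
Proof. by move=> fx; apply: contat_comp fx _; split; exact: continuous_reC. Qed.
Lemma cont_imC f x : contat x f -> contat x (fun t => imC (f t)).
Proof. by move=> fx; apply: contat_comp fx _; split; exact: continuous_imC. Qed.
Lemma ccont_ofR (f : T -> R) x :
  contat x f -> contat x (fun t => ofR (f t)).
Proof. by move=> fx; apply: contat_comp fx _; split; exact: continuous_ofR. Qed.
Lemma ccont_mkC (f g : T -> R) x : contat x f -> contat x g ->
  contat x (fun t => mkC (f t) (g t)).
Proof.
move=> fx gx; apply: contat_ext => [t|]; first by rewrite [mkC _ _]CxE.
exact: (ccontD (ccont_ofR fx) (ccontM (ccont_cst _ _) (ccont_ofR gx))).
Qed.
Lemma ccont_conj f x : contat x f -> contat x (fun t => (f t)^*).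
Proof.
move=> fx; apply: contat_ext => [t|]; first exact: conjCxE.
apply: ccont_mkC; first exact: cont_reC.
by have [h] := cont_imC fx; split; exact: (continuousN h).
Qed.

Section Ext.
Context {n : nat}.
Local Notation E := (ext R n).
Implicit Types (F G : T -> E).

(** Continuity coefficient by coefficient, which spares a topology on the exterior algebra. *)
Variant econt F x : Prop := Econt of forall S, contat x (fun t => F t S).

Lemma econt_ext F G x : F =1 G -> econt G x -> econt F x.
Proof. by move=> /funext ->. Qed.

Lemma econt_cst (u : E) x : econt (fun _ => u) x.
Proof. by split=> S; exact: ccont_cst. Qed.
Lemma econtD F G x : econt F x -> econt G x -> econt (fun t => F t + G t) x.
Proof.
move=> [Fx] [Gx]; split=> S; apply: contat_ext (ccontD (Fx S) (Gx S)) => t.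
exact: extDE.
Qed.
Lemma econtZ (f : T -> C) F x : contat x f -> econt F x ->
  econt (fun t => f t **: F t) x.
Proof.
move=> fx [Fx]; split=> S; apply: contat_ext (ccontM fx (Fx S)) => t.
exact: extZE.
Qed.
Lemma econtN F x : econt F x -> econt (fun t => - F t) x.
Proof.
move=> Fx; have [h] := econtZ (ccont_cst (-1) x) Fx; split=> S.
by apply: contat_ext (h S) => t; rewrite extZN1.
Qed.
Lemma econtB F G x : econt F x -> econt G x -> econt (fun t => F t - G t) x.
Proof. by move=> Fx Gx; exact: (econtD Fx (econtN Gx)). Qed.
Lemma econt_sum (J : finType) (F : J -> T -> E) x :
  (forall j, econt (F j) x) -> econt (fun t => \sum_j F j t) x.
Proof.
move=> Fx; split=> S; apply: contat_ext => [t|]; first exact: ext_sumE.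
by apply: ccont_sum => j _; have [] := Fx j.
Qed.
Lemma econt_wdg F G x : econt F x -> econt G x -> econt (fun t => wdg (F t) (G t)) x.
Proof.
move=> [Fx] [Gx]; split=> S; apply: contat_ext => [t|]; first exact: wdg_coef.
by apply: ccont_sum => A _; exact: (ccontM (ccontM (ccont_cst _ _) (Fx _)) (Gx _)).
Qed.
Lemma econt_dpow F m x : econt F x -> econt (fun t => dpow (F t) m%:Z) x.
Proof.
move=> Fx; elim: m => [|m IH].
  by apply: econt_ext (econt_cst e1 x) => t; exact: divpow0.
apply: econt_ext (econtZ (ccont_cst (m.+1%:R)^-1 x) (econt_wdg Fx IH)) => t.
exact: divpowS.
Qed.
Lemma econt_iprod s F x : econt F x -> econt (fun t => iprod s (F t)) x.
Proof.
move=> [Fx]; split=> S; apply: contat_ext => [t|]; first exact: iprodE.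
by case: (s \in S); [exact: ccont_cst|exact: (ccontM (ccont_cst _ _) (Fx _))].
Qed.
Lemma econt_cnj F x : econt F x -> econt (fun t => cnj (F t)) x.
Proof.
move=> [Fx]; have H : econt (fun t => \sum_(S : {set 'I_(n + n)})
    (F t S)^* **: (\big[wedge/ext1]_(s in S) cov (conj_index s) : E)) x.
  by apply: econt_sum => S; exact: (econtZ (ccont_conj (Fx S)) (econt_cst _ _)).
have [{}H] := H; split=> S; apply: contat_ext (H S) => t.
rewrite ext_conjE /ext_subst; congr (fun_of_fin _ S); apply: eq_bigr => A _.
by rewrite escaleE conj_coefE.
Qed.
Lemma ccont_density F x : econt F x -> contat x (fun t => density (F t)).
Proof.
by move=> [Fx]; rewrite /density; exact: (ccontM (Fx _) (ccont_cst _ _)).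
Qed.
Lemma ccont_herm F x a b : econt F x ->
  contat x (fun t => herm_mx (F t) a b).
Proof.
move=> [Fx]; apply: contat_ext => [t|]; first exact: mxE.
exact: (ccontM (ccont_cst _ _) (Fx _)).
Qed.
End Ext.

Lemma ccont_det m (M : T -> 'M[C]_m) x :
  (forall i j, contat x (fun t => M t i j)) ->
  contat x (fun t => \det (M t)).
Proof.
move=> Mx; rewrite /determinant; apply: ccont_sum => s _.
apply: ccontM; first exact: ccont_cst.
by apply: ccont_prod => i _.
Qed.

(** The determinant stays non-zero near [x], and there the inverse is given by cofactors; on
    singular matrices [invmx] has a default value unrelated to this formula. *)
Lemma ccont_invmx m (M : T -> 'M[C]_m) x i j : M x \in unitmx ->
  (forall i j, contat x (fun t => M t i j)) ->
  contat x (fun t => invmx (M t) i j).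
Proof.
move=> Mu Mx.
have d0 : \det (M x) != 0 by rewrite -unitfE -unitmxE.
have dc : contat x (fun t => \det (M t)) by exact: ccont_det.
have e : \forall t \near x, invmx (M t) i j = (\det (M t))^-1 * cofactor (M t) j i.
  have [dc'] := dc.
  apply: filterS (@cvgr_neq0 _ _ _ (nbhs x) _ _ _ dc' d0) => t dt.
  by rewrite /invmx unitmxE unitfE dt !mxE.
apply: contat_near_ext e _; apply: ccontM; first exact: ccontV.
rewrite /cofactor; apply: ccontM; first exact: ccont_cst.
by apply: ccont_det => i' j'; apply: contat_ext (Mx _ _) => t; rewrite !mxE.
Qed.
End Pointwise.
End ComplexContinuity.

(** * Iterated integrals of compactly supported functions *)

Section Integrals.
Context {R : realType}.

Section Continuity.
Context {T U V : topologicalType}.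

Lemma contat_fst (p : T * U) : contat p fst.
Proof. split; exact: cvg_fst. Qed.
Lemma contat_snd (p : T * U) : contat p snd.
Proof. split; exact: cvg_snd. Qed.
Lemma contat_pair (x : V) (f : V -> T) (g : V -> U) :
  contat x f -> contat x g -> contat x (fun v => (f v, g v)).
Proof. by move=> [fx] [gx]; split; exact: (cvg_pair fx gx). Qed.
Lemma contat_id (x : T) : contat x id.
Proof. by split. Qed.
Lemma contat_const (x : T) (u : U) : contat x (fun _ => u).
Proof. by split; exact: cst_continuous. Qed.
End Continuity.

Lemma contat_mx {T U : topologicalType} m n (x : T) (M : T -> 'M[U]_(m, n)) :
  (forall i j, contat x (fun t => M t i j)) -> contat x M.
Proof.
move=> Mx; split => A [P Px PA].
have H : \forall t \near x, forall ij : 'I_m * 'I_n, P ij.1 ij.2 (M t ij.1 ij.2).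
  by apply: filter_forall => ij; have [h] := Mx ij.1 ij.2; exact: h (Px _ _).
apply: filterS H => t Ht; apply: PA => i j; exact: (Ht (i, j)).
Qed.

(** What is retained of an integral: linearity and a sup bound on continuous functions supported in
    [K]. This suffices for continuity in a parameter and is inherited by iterated integrals. *)
Record integral_on (V : topologicalType) (K : set V) (J : (V -> R) -> R) (B : R) := {
  int_bound_ge0 : 0 <= B;
  int_linear : forall (a : R) f g,
    (forall v, contat v f) -> (forall v, contat v g) ->
    (forall v, ~ K v -> f v = 0) -> (forall v, ~ K v -> g v = 0) ->
    J (fun v => a * f v + g v) = a * J f + J g;
  int_bound : forall (c : R) f, (forall v, contat v f) ->
    (forall v, ~ K v -> f v = 0) -> 0 <= c ->
    (forall v, `|f v| <= c) -> `|J f| <= B * c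
}.

Section ParametricIntegral.
Context {T V : topologicalType} {K : set V} {J : (V -> R) -> R} {B : R}.
Hypothesis JK : integral_on K J B.
Hypothesis Kc : compact K.

(** Compactness of [K] makes joint continuity at the points [(v, t0)] uniform in [v], and the sup
    bound carries uniform closeness over to [J]. *)
Lemma contat_integral (g : T -> V -> R) (t0 : T) :
  (\forall t \near t0, forall v, contat v (g t)) ->
  (forall t v, ~ K v -> g t v = 0) ->
  (forall v, K v -> contat (v, t0) (fun p => g p.2 p.1)) ->
  contat t0 (fun t => J (g t)).
Proof.
move=> gc gK gj; split; apply/(@cvgrPdist_le _ _ _ (nbhs t0)) => e e0.
have B1 : 0 < B + 1 by rewrite ltr_wpDl // (int_bound_ge0 JK).
(* [B] may be zero, hence the division by [B + 1]. *)
pose c := e / (B + 1); have c0 : 0 < c by rewrite divr_gt0.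
have gc0 := nbhs_singleton gc.
have H : \forall t \near t0, K `<=` [set v | `|g t0 v - g t v| < c].
  move/compact_near_coveringP : Kc; apply => v Kv.
  have d : contat (v, t0) (fun p => g t0 p.1 - g p.2 p.1).
    have [h1] : contat (v, t0) (fun p : V * T => g t0 p.1).
      exact: (contat_comp (contat_fst _) (gc0 _)).
    by have [h2] := gj v Kv; split; exact: (continuousB h1 h2).
  have [{}d] := d; move/(@cvgrPdist_lt _ _ _ (nbhs (v, t0))) : d => /(_ _ c0).
  by apply: filterS => -[v' t'] /=; rewrite subrr sub0r normrN.
apply: filterS2 gc H => t gct Ht.
have -> : J (g t0) - J (g t) = J (fun v => - 1 * g t v + g t0 v).
  rewrite (int_linear JK) //; [by rewrite mulN1r addrC|exact: gK|exact: gK].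
apply: (@le_trans _ _ (B * c)).
  apply: (int_bound JK) => [v|v Kv||v].
  - have [h1] := gct v; have [h2] := gc0 v.
    have [h3] : contat v (fun v => g t0 v - g t v) by split; exact: (continuousB h2 h1).
    by apply: contat_ext (Contat h3) => v'; rewrite mulN1r addrC.
  - by rewrite !gK // mulr0 addr0.
  - exact: ltW.
  - rewrite mulN1r addrC; have [Kv|Kv] := pselect (K v).
      by apply/ltW; exact: Ht.
    by rewrite !gK // subrr normr0 ltW.
rewrite /c mulrC mulrAC -mulrA ler_piMr ?ltW // ltr_pdivrMr // mul1r.
by rewrite ltrDl.
Qed.
End ParametricIntegral.

Lemma contatD {T : topologicalType} (x : T) (f g : T -> R) :
  contat x f -> contat x g -> contat x (fun t => f t + g t).
Proof. by move=> [fx] [gx]; split; exact: (continuousD fx gx). Qed.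

Lemma contatM {T : topologicalType} (x : T) (f g : T -> R) :
  contat x f -> contat x g -> contat x (fun t => f t * g t).
Proof. by move=> [fx] [gx]; split; exact: (continuousM fx gx). Qed.

Lemma int_eq (V : topologicalType) (J : (V -> R) -> R) f g : f =1 g -> J f = J g.
Proof. by move=> /funext ->. Qed.

Lemma Rintegral_itv_cst (a b c : R) : a <= b ->
  \int[@lebesgue_measure R]_(x in `[a, b]) c = c * (b - a).
Proof.
move=> ab; have mA : @measurable _ (measurableTypeR R) `[a, b] by exact: measurable_itv.
apply: etrans (Rintegral_cst _ mA c) _; congr (_ * _).
have /(congr1 fine) e := @lebesgue_measure_itv R (Interval (BLeft a) (BRight b)).
apply: etrans e _ => /=; rewrite lte_fin.
by case: ltgtP ab => //= -> _; rewrite subrr.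
Qed.

Section OneDim.
Variable M : R.
Hypothesis M0 : 0 <= M.
Local Notation mu := (@lebesgue_measure R).
Local Notation int1 := (fun f : R -> R => \int[mu]_x f x).
Let D : set R := `[(- M), M].

Lemma restrict_supp (f : R -> R) : (forall x, ~ D x -> f x = 0) -> f \_ D = f.
Proof.
move=> fD; apply/funext => x; rewrite patchE; case: ifPn => // /negP xD.
by rewrite fD // => Dx; apply: xD; exact/mem_set.
Qed.

Lemma integrable_supp (f : R -> R) : (forall x, contat x f) ->
  (forall x, ~ D x -> f x = 0) -> mu.-integrable setT (EFin \o f).
Proof.
move=> fc fD.
have : mu.-integrable D (EFin \o f).
  apply: continuous_compact_integrable; first exact: segment_compact.
  by apply: continuous_subspaceT => x; have [] := fc x.
have mD : @measurable _ (measurableTypeR R) D by exact: measurable_itv.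
have [h _] := integrable_mkcond (mu := mu) (EFin \o f) mD.
move=> /h; congr (_.-integrable _ _); apply/funext => x.
rewrite patchE; case: ifPn => // /negP xD.
by rewrite /= fD // => Dx; apply: xD; exact/mem_set.
Qed.

Lemma Rintegral_supp (f : R -> R) : (forall x, ~ D x -> f x = 0) ->
  int1 f = \int[mu]_(x in D) f x.
Proof. by move=> fD; rewrite Rintegral_mkcond restrict_supp. Qed.

Lemma int1_bound (c : R) (f : R -> R) : (forall x, contat x f) ->
  (forall x, ~ D x -> f x = 0) -> 0 <= c -> (forall x, `|f x| <= c) ->
  `|int1 f| <= 2 * M * c.
Proof.
move=> fc fD c0 fb; have -> : int1 f = \int[mu]_(x in D) f x by exact: Rintegral_supp.
have mD : @measurable _ (measurableTypeR R) D by exact: measurable_itv.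
have cD (g : R -> R) : (forall x, contat x g) -> mu.-integrable D (EFin \o g).
  move=> gc; apply: continuous_compact_integrable; first exact: segment_compact.
  by apply: continuous_subspaceT => x; have [] := gc x.
have iD := cD _ fc.
apply: (@le_trans _ _ (\int[mu]_(x in D) `|f x|)); first exact: (le_normr_Rintegral mD iD).
have iabs : mu.-integrable D (EFin \o (fun x => `|f x|)).
  apply: cD => x; have [h] := fc x; split.
  exact: (continuous_comp h (@norm_continuous _ _ _)).
apply: (@le_trans _ _ (\int[mu]_(x in D) c)).
  by apply: (@le_Rintegral _ _ _ mu D (fun x => `|f x|) (cst c) mD iabs
    (cD _ (fun x => contat_const x c))) => x _; exact: fb.
rewrite Rintegral_itv_cst; last by rewrite (@le_trans _ _ 0) // oppr_le0.
by have -> : c * (M - - M) = 2 * M * c by ring.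
Qed.

Lemma integral_on_R : integral_on D int1 (2 * M).
Proof.
split=> [|a f g fc gc fD gD|c f fc fD c0 fb].
- by rewrite mulr_ge0.
- rewrite RintegralD //; [| |exact: integrable_supp].
    by rewrite RintegralZl //; exact: integrable_supp.
  apply: (@integrable_supp (fun x => a * f x)) => [x|x Dx].
    by apply: contatM => //; exact: contat_const.
  by rewrite fD // mulr0.
- exact: int1_bound.
Qed.

(** By continuity [f] is at least [f x0 / 2] on an interval around [x0]; the integral over that
    interval is a positive lower bound. *)
Lemma int1_gt0 (f : R -> R) x0 : (forall x, contat x f) ->
  (forall x, ~ D x -> f x = 0) -> (forall x, 0 <= f x) -> 0 < f x0 -> 0 < int1 f.
Proof.
move=> fc fD f0 fx0.
have [d d0 fd] : exists2 d : R, 0 < d & forall x, x0 - d <= x <= x0 + d -> f x0 / 2 <= f x.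
  have [fcx] := fc x0; have e0 : 0 < f x0 / 2 by rewrite divr_gt0.
  move/(@cvgrPdist_lt _ _ _ (nbhs x0)) : fcx => /(_ _ e0) /nbhs_ballP[d /= d0 dP].
  exists (d / 2); first by rewrite divr_gt0.
  move=> x /andP[xl xr].
  have /dP /= : ball x0 d x.
    rewrite /ball /= ltr_norml; apply/andP; split; lra.
  by rewrite ltr_norml => /andP[_]; lra.
pose A : set R := `[(x0 - d), (x0 + d)].
have mA : @measurable _ (measurableTypeR R) A by exact: measurable_itv.
have cA (g : R -> R) : (forall x, contat x g) -> mu.-integrable A (EFin \o g).
  move=> gc; apply: continuous_compact_integrable; first exact: segment_compact.
  by apply: continuous_subspaceT => x; have [] := gc x.
have iT := integrable_supp fc fD.
have iA : mu.-integrable setT (EFin \o (f \_ A)).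
  have [h _] := integrable_mkcond (mu := mu) (EFin \o f) mA.
  move: (cA _ fc) => /h; congr (_.-integrable _ _).
  by apply/funext => x; rewrite /= !patchE; case: ifP.
apply: (@lt_le_trans _ _ (\int[mu]_(x in A) f x)); last first.
  rewrite Rintegral_mkcond; apply: (le_Rintegral measurableT iA iT) => x _.
  by rewrite patchE; case: ifP.
apply: (@lt_le_trans _ _ (\int[mu]_(x in A) (f x0 / 2))).
  have dd : x0 - d <= x0 + d by rewrite lerD2l; lra.
  rewrite (Rintegral_itv_cst _ dd) mulr_gt0 ?divr_gt0 //.
  by rewrite opprD addrACA subrr add0r opprK addr_gt0.
apply: (le_Rintegral mA (cA _ (fun x => contat_const x _)) (cA _ fc)) => x.
by rewrite /A /= in_itv /=; exact: fd.
Qed.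

End OneDim.

Definition box (M : R) n : set 'rV[Cx R]_n :=
  [set v | forall j, (`|reC (v 0 j)| <= M) /\ (`|imC (v 0 j)| <= M)].

Lemma compact_box M n : compact (@box M n).
Proof.
pose Q : set (Cx R) := [set z | `|reC z| <= M /\ `|imC z| <= M].
have cQ : compact Q.
  have -> : Q = (fun p : R * R => mkC p.1 p.2) @` (`[(- M), M] `*` `[(- M), M]).
    apply/seteqP; split=> [[x y] [/= xM yM]|_ [[x y] /= [xM yM] <-]].
      by exists (x, y) => //=; split; rewrite in_itv /= -ler_norml.
    by move: xM yM; rewrite !in_itv /= -!ler_norml.
  apply: continuous_compact; last by apply: compact_setX; exact: segment_compact.
  apply: continuous_subspaceT => p.
  by have [] := ccont_mkC (contat_fst p) (contat_snd p).
exact: (rV_compact (A := fun _ => Q)).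
Qed.

Section IntCn.
Variable M : R.
Hypothesis M0 : 0 <= M.
Let D : set R := `[(- M), M].

Let slice n (f : 'rV[Cx R]_n.+1 -> R) (p : R * R) (v : 'rV[Cx R]_n) : R :=
  f (row_mx (mkC p.1 p.2)%:M v : 'rV_(1 + n)).

Lemma contat_row_mx n (q : 'rV[Cx R]_n * (R * R)) :
  contat q (fun q : 'rV[Cx R]_n * (R * R) =>
    row_mx (mkC q.2.1 q.2.2)%:M q.1 : 'rV_(1 + n)).
Proof.
apply: contat_mx => i j; rewrite ord1; case: (split_ordP j) => k ->.
  apply: (contat_ext (g := fun t : 'rV[Cx R]_n * (R * R) => mkC t.2.1 t.2.2)) => [t|].
    by rewrite row_mxEl ord1 mxE eqxx mulr1n.
  apply: ccont_mkC; apply: contat_comp (contat_snd _) _; [exact: contat_fst|exact: contat_snd].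
apply: contat_ext => [t|]; first by rewrite row_mxEr.
apply: (contat_comp (g := fun v : 'rV[Cx R]_n => v 0 k) (contat_fst q)).
split; exact: coord_continuous.
Qed.

Lemma box_row_mx n (p : R * R) (v : 'rV[Cx R]_n) :
  box M (row_mx (mkC p.1 p.2)%:M v : 'rV_(1 + n)) <->
  [/\ D p.1, D p.2 & box M v].
Proof.
split=> [H|[Hx Hy Hv] j].
  have := H (lshift n ord0); rewrite row_mxEl mxE eqxx mulr1n /= => -[H1 H2].
  split; [by rewrite /D /= in_itv /= -ler_norml|by rewrite /D /= in_itv /= -ler_norml|].
  by move=> j; have := H (rshift 1 j); rewrite row_mxEr.
case: (split_ordP j) => k ->; last by rewrite row_mxEr; exact: Hv.
rewrite row_mxEl ord1 mxE eqxx mulr1n /=.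
by move: Hx Hy; rewrite /D /= !in_itv /= -!ler_norml.
Qed.

Section Slices.
Variables (n : nat) (f : 'rV[Cx R]_n.+1 -> R).
Hypothesis fc : forall v, contat v f.
Hypothesis fM : forall v, ~ box M v -> f v = 0.

Lemma slice_joint v p : contat (v, p) (fun q => slice f q.2 q.1).
Proof. exact: (contat_comp (contat_row_mx (v, p)) (fc _)). Qed.

Lemma slice_cont p v : contat v (slice f p).
Proof.
exact: (contat_comp (contat_pair (contat_id v) (contat_const v p)) (slice_joint v p)).
Qed.

Lemma slice_supp p v : ~ box M v -> slice f p v = 0.
Proof. by move=> vM; apply: fM => /box_row_mx[]. Qed.

Lemma slice_suppD p v : ~ (D p.1 /\ D p.2) -> slice f p v = 0.
Proof. by move=> vM; apply: fM => /box_row_mx[? ? _]; exact: vM. Qed.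
End Slices.

Section Step.
Variables (n : nat) (B : R).
Hypothesis IH : integral_on (@box M n) (@int_Cn R n) B.
Variable f : 'rV[Cx R]_n.+1 -> R.
Hypothesis fc : forall v, contat v f.
Hypothesis fM : forall v, ~ box M v -> f v = 0.
Let F (p : R * R) := int_Cn (slice f p).
Let G (x : R) := \int[@lebesgue_measure R]_y F (x, y).

Lemma int_Cn0 m : @int_Cn R m (fun _ => 0) = 0.
Proof.
elim: m => [//|m IHm] /=; rewrite /Rintegral; under eq_integral do under eq_integral do rewrite IHm.
by rewrite integral0 /= integral0.
Qed.

Lemma F_cont p : contat p F.
Proof.
apply: (contat_integral IH (@compact_box M n)) => [|q v|v _].
- by apply: filterE => q v; exact: slice_cont.
- exact: slice_supp.
- exact: slice_joint.
Qed.

Lemma F_supp p : ~ (D p.1 /\ D p.2) -> F p = 0.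
Proof.
move=> pD; rewrite /F -[RHS](int_Cn0 n); congr int_Cn; apply/funext => v.
exact: slice_suppD.
Qed.

Lemma F1_cont x y : contat y (fun y => F (x, y)).
Proof. exact: (contat_comp (contat_pair (contat_const y x) (contat_id y)) (F_cont (x, y))). Qed.

Lemma F1_supp x y : ~ D y -> F (x, y) = 0.
Proof. by move=> yD; apply: F_supp => -[]. Qed.

Lemma G_cont x : contat x G.
Proof.
apply: (contat_integral (integral_on_R M0) (@segment_compact _ _ _)) => [|x' y|y _].
- by apply: filterE => x' y; exact: F1_cont.
- exact: F1_supp.
- exact: (contat_comp (contat_pair (contat_snd (y, x)) (contat_fst (y, x))) (F_cont (x, y))).
Qed.

Lemma G_supp x : ~ D x -> G x = 0.
Proof.
move=> xD; rewrite /G /Rintegral; under eq_integral do rewrite F_supp => [|[]//].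
by rewrite integral0.
Qed.

Lemma int_CnSE : int_Cn f = \int[@lebesgue_measure R]_x G x.
Proof. by []. Qed.
End Step.

(** A complex variable contributes two real integrals over [[-M, M]], each multiplying the bound by
    [2 M]. The partial integrals [F] and [G] are again continuous by [contat_integral] and supported
    in the interval, which lets the induction continue. *)
Lemma integral_on_Cn n : exists B, integral_on (@box M n) (@int_Cn R n) B.
Proof.
elim: n => [|n [B IH]].
  exists 1; split=> //= [c f fc fM c0 fb]; by rewrite mul1r.
exists (2 * M * (2 * M * B)); split.
- by rewrite !mulr_ge0 // (int_bound_ge0 IH).
- move=> a f g fc gc fM gM.
  have I1 := integral_on_R M0.
  rewrite !int_CnSE; apply: etrans (int_linear I1 a (G_cont IH fc fM)
    (G_cont IH gc gM) (G_supp fM) (G_supp gM)).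
  apply: int_eq => x; apply: etrans (int_linear I1 a (F1_cont IH fc fM x)
    (F1_cont IH gc gM x) (F1_supp fM x) (F1_supp gM x)).
  apply: int_eq => y; exact: (int_linear IH a (slice_cont fc (x, y))
    (slice_cont gc (x, y)) (slice_supp fM (x, y)) (slice_supp gM (x, y))).
- move=> c f fc fM c0 fb; have I1 := integral_on_R M0.
  have B0 := int_bound_ge0 IH; have Bc0 : 0 <= B * c by rewrite mulr_ge0.
  have Fb p : `|int_Cn (slice f p)| <= B * c.
    exact: (int_bound IH (slice_cont fc p) (slice_supp fM p) c0 (fun v => fb _)).
  have Gb x := int_bound I1 (F1_cont IH fc fM x) (F1_supp fM x) Bc0 (fun y => Fb _).
  have -> : 2 * M * (2 * M * B) * c = 2 * M * (2 * M * (B * c)) by rewrite !mulrA.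
  apply: (int_bound I1 (G_cont IH fc fM) (G_supp fM) _ Gb).
  by rewrite !mulr_ge0.
Qed.

Lemma int_Cn_ge0 n (f : 'rV[Cx R]_n -> R) : (forall v, 0 <= f v) -> 0 <= int_Cn f.
Proof.
elim: n f => [f f0|n IH f f0] /=; first exact: f0.
by apply: Rintegral_ge0 => x _; apply: Rintegral_ge0 => y _; exact: IH.
Qed.

(** Strict positivity is followed along the slice through [v0]: the inner integral is positive
    there, and [int1_gt0] passes this through the two real variables. *)
Lemma int_Cn_gt0 n (f : 'rV[Cx R]_n -> R) v0 : (forall v, contat v f) ->
  (forall v, ~ box M v -> f v = 0) -> (forall v, 0 <= f v) -> 0 < f v0 ->
  0 < int_Cn f.
Proof.
elim: n f v0 => [f v0 _ _ _|n IHn f v0 fc fM f0 fv0].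
  by rewrite (_ : v0 = 0) //; apply/rowP => -[].
have [B IH] := integral_on_Cn n.
pose w0 : 'rV_(1 + n) := v0.
have fw0 : 0 < slice f (reC (lsubmx w0 0 0), imC (lsubmx w0 0 0)) (rsubmx w0).
  rewrite /slice /= (_ : row_mx _ _ = w0) //.
  rewrite -[RHS]hsubmxK; congr row_mx; apply/matrixP => i j; rewrite !ord1 mxE eqxx mulr1n.
  by case: (lsubmx w0 0 0).
have F0 p : 0 <= int_Cn (slice f p) by exact: (int_Cn_ge0 (fun v => f0 _)).
have Fw0 : 0 < int_Cn (slice f (reC (lsubmx w0 0 0), imC (lsubmx w0 0 0))).
  exact: (IHn _ _ (slice_cont fc _) (slice_supp fM _) (fun v => f0 _) fw0).
have Gw0 := int1_gt0 (F1_cont IH fc fM _) (F1_supp fM _) (fun y => F0 _) Fw0.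
exact: (int1_gt0 (G_cont IH fc fM) (G_supp fM)
  (fun x => Rintegral_ge0 _ (fun y _ => F0 _)) Gw0).
Qed.

End IntCn.
End Integrals.

(** * Positivity of the volume form *)

Section PositiveMatrices.
Context {C : numClosedFieldType} {n : nat}.
Implicit Types H K P : 'M[C]_n.

Definition mxposdef H := forall x : 'rV[C]_n, x != 0 ->
  0 < \sum_a \sum_b H a b * x 0 a * (x 0 b)^*.

Lemma mxform_mul P H i : (P *m H *m (map_mx Num.conj P)^T) i i =
  \sum_a \sum_b H a b * (row i P) 0 a * ((row i P) 0 b)^*.
Proof.
rewrite mxE exchange_big; apply: eq_bigr => b _.
rewrite mxE mulr_suml; apply: eq_bigr => a _.
by rewrite !mxE (mulrC (P i a)).
Qed.

Lemma mxposdef_unit H : mxposdef H -> H \in unitmx.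
Proof.
move=> Hpos; rewrite unitmxE unitfE; apply/negP => /det0P[x x0 xH].
have := Hpos x x0; rewrite exchange_big big1 ?ltxx // => b _.
have e : \sum_a H a b * x 0 a = (x *m H) 0 b.
  by rewrite mxE; apply: eq_bigr => a _; rewrite mulrC.
by rewrite -mulr_suml e xH mxE mul0r.
Qed.

(** A unitary [P] diagonalises [K] with eigenvalues [D_i > 0]; the trace becomes the sum of
    [(P H P^-1)_ii / D_i], and each diagonal entry is the form of [H] at a row of [P]. *)
Lemma mxtrace_inv_gt0 K H : (0 < n)%N -> (forall a b, (K a b)^* = K b a) ->
  mxposdef K -> mxposdef H -> 0 < \tr (invmx K *m H).
Proof.
move=> n0 Kh Kpos Hpos.
have Kt : (map_mx Num.conj K)^T = K.
  by apply/matrixP => a b; rewrite mxE [LHS]mxE Kh.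
have Knormal : K \is normalmx.
  by apply/normalmxP; rewrite -map_trmx Kt.
have /orthomx_spectralP := Knormal.
set P := spectralmx K; set D := spectral_diag K => KE.
have Pu := spectral_unit K; rewrite -/P in Pu.
have Pinv : invmx P = (map_mx Num.conj P)^T.
  by rewrite (invmx_unitary (spectral_unitarymx K)) -map_trmx.
have row0 i : row i P != 0.
  apply/eqP => ri; have := congr1 (fun M : 'M[C]_n => M i i) (mulmxV Pu).
  rewrite !mxE eqxx big1 => [/esym/eqP|j _]; first by rewrite oner_eq0.
  by have := congr1 (fun M : 'rV[C]_n => M 0 j) ri; rewrite !mxE => ->; rewrite mul0r.
have DE : P *m K *m invmx P = diag_mx D.
  by rewrite KE !mulmxA mulmxV // mul1mx -mulmxA mulmxV // mulmx1.
have D0 i : 0 < D 0 i.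
  have := Kpos _ (row0 i); rewrite -mxform_mul -Pinv DE.
  by rewrite mxE eqxx mulr1n.
have Z : P *m invmx K *m invmx P *m diag_mx D = 1%:M.
  rewrite -DE !mulmxA mulmxKV // -(mulmxA P) mulVmx ?mxposdef_unit // mulmx1.
  by rewrite mulmxV.
have ZE i j : (P *m invmx K *m invmx P) i j = (i == j)%:R / D 0 j.
  have := congr1 (fun M : 'M[C]_n => M i j) Z.
  by rewrite mul_mx_diag !mxE => <-; rewrite mulfK // lt0r_neq0.
have -> : \tr (invmx K *m H) =
    \tr ((P *m invmx K *m invmx P) *m (P *m H *m invmx P)).
  rewrite !mulmxA mulmxKV // [RHS]mxtrace_mulC !mulmxA mulVmx // mul1mx.
  by [].
rewrite /mxtrace; apply: (@lt_le_trans _ _ (\sum_i (D 0 i)^-1 * (P *m H *m invmx P) i i)).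
  have pos i : 0 < (D 0 i)^-1 * (P *m H *m invmx P) i i.
    by rewrite mulr_gt0 ?invr_gt0 // Pinv mxform_mul; exact: Hpos.
  rewrite (bigD1 (Ordinal n0)) //= ltr_wpDr ?pos // sumr_ge0 // => i _.
  exact: ltW.
apply: ler_sum => i _; rewrite [X in _ <= X]mxE (bigD1 i) //= big1.
  by rewrite ZE eqxx mul1r addr0.
by move=> j /negbTE ji; rewrite ZE eq_sym ji !mul0r.
Qed.

End PositiveMatrices.

Section Positivity.
Context {R : realType} {n : nat}.
Local Notation E := (ext R n).
Local Notation I := 'I_(n + n).
Local Notation C := (Cx R).
Implicit Types (u v w x y : E).
Local Notation ev u := (u finset.set0).

Lemma herm_mxP (c : C) u v a b :
  herm_mx (c **: u + v) a b = c * herm_mx u a b + herm_mx v a b.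
Proof. by rewrite !mxE extDE extZE mulrDr mulrCA. Qed.

Section Volume.
Variable w : E.
Hypothesis w11 : has_bidegree 1 1 w.
Hypothesis hu : herm_mx w \in unitmx.

Lemma has_bidegree_top : has_bidegree n n (ext_basis [set: I] : E).
Proof.
move=> S; rewrite ffunE; have [->|_] := eqVneq S [set: I]%SET; last by rewrite eqxx.
by split; rewrite -[RHS]card_ord -cardsT; apply: eq_card => a; rewrite !inE.
Qed.

(** If [w_n] had no top coefficient, then [top_lam] would give by induction on [p] that
    [y /\ w_(n-p)] has none for every [y] of bidegree (p,p). At [p = n] this contradicts the choice
    of [y] as the top monomial, so no determinant has to be computed. *)
Lemma top_dpow_neq0 : top (dpow w n%:Z) != 0.
Proof.
apply/eqP => w0.
have H p : (p <= n)%N -> forall y, has_bidegree p p y ->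
    top (wdg y (dpow w (n - p)%:Z)) = 0.
  elim: p => [_ y /bidegree_degree/degree0E ->|p IH pn y pp].
    by rewrite subn0 wedgeZl wedge1l topZ w0 mulr0.
  have := top_lam w11 hu (n - p.+1) pp.
  rewrite -[(n - p.+1).+1]subSn // subSS IH ?(ltnW pn) //; last exact: has_bidegree_lam.
  by move/eqP; rewrite mulf_eq0 pnatr_eq0 => /eqP.
have := H n (leqnn n) _ has_bidegree_top.
rewrite subnn divpow0 wedge1r topE ffunE eqxx => /eqP.
by rewrite oner_eq0.
Qed.

Lemma lam_11 x : has_bidegree 1 1 x -> lam w x = \tr (invmx (herm_mx w) *m herm_mx x) **: e1.
Proof.
move=> x11; rewrite /lam /mxtrace ext_sumZ; apply: eq_bigr => d _.
rewrite upE iprod_sum mxE ext_sumZ; apply: eq_bigr => a _.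
by rewrite iprodZ iprod2_w // extZA mulrACA mulNr -expr2 sqrCi opprK mul1r.
Qed.

Lemma top_wdg_dpow x : (0 < n)%N -> has_bidegree 1 1 x ->
  top (wdg x (dpow w (n - 1)%:Z)) =
  \tr (invmx (herm_mx w) *m herm_mx x) * top (dpow w n%:Z).
Proof.
move=> n0 x11; have := top_lam w11 hu (n - 1) x11; rewrite mul1r => ->.
by rewrite lam_11 // wedgeZl wedge1l topZ subn1 prednK.
Qed.
End Volume.

Lemma dpow1 w : dpow w 1 = w.
Proof. by rewrite -[1]/(1%:Z) divpowS divpow0 wedge1r invr1 extZ1. Qed.

(** The binomial formula for divided powers, cut after the first order in [e] because [e] has square
    zero. *)
Lemma dpow_addsq0 (e x : E) m : has_degree 2 e -> wdg e e = 0 ->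
  dpow (e + x) m.+1%:Z = dpow x m.+1%:Z + wdg e (dpow x m%:Z).
Proof.
move=> e2 ee; elim: m => [|m IH].
  by rewrite !dpow1 divpow0 wedge1r addrC.
have m0 : (m.+2%:R : C) != 0 by rewrite pnatr_eq0.
have inj (u v : E) : m.+2%:R **: u = m.+2%:R **: v -> u = v.
  by move=> uv; rewrite -[u]extZ1 -(mulVf m0) -extZA uv extZA mulVf // extZ1.
apply: inj; rewrite -wedge_divpow IH wedgeDl !wedgeDr extZDr -wedge_divpow.
rewrite -wedgeA ee wedge0l addr0 addrC -addrA; congr (_ + _).
rewrite -wedgeA -(degree2_comm x e2) wedgeA wedge_divpow wedgeZr.
by rewrite -[X in _ + X]extZ1 -extZDl natr1.
Qed.

(** Since each [eta a] has square zero, only the product of all summands survives in this degree.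
    The vanishing one degree higher is what the induction consumes. *)
Lemma dpow_sum (eta : 'I_n -> E) (r : seq 'I_n) :
  (forall a, has_degree 2 (eta a)) -> (forall a, wdg (eta a) (eta a) = 0) ->
  dpow (\sum_(a <- r) eta a) (size r)%:Z = \big[wdg/e1]_(a <- r) eta a /\
  dpow (\sum_(a <- r) eta a) (size r).+1%:Z = 0.
Proof.
move=> e2 ee.
have H : forall (r : seq 'I_n) m, (size r < m)%N -> dpow (\sum_(a <- r) eta a) m%:Z = 0.
  elim=> [[//|m] _|a r' IH [//|m] rm]; first by rewrite big_nil divpowS wedge0l extZ0.
  rewrite big_cons dpow_addsq0 // (IH m) // wedge0r addr0.
  by apply: IH; rewrite (leq_trans _ (ltnW rm)).
split; last exact: H.
elim: r => [|a r IH]; first by rewrite !big_nil divpow0.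
by rewrite !big_cons /= dpow_addsq0 // IH H // add0r.
Qed.

Definition stdw : E := \sum_a 'i **: wdg (dzc a) (dzbarc a).

Lemma bidegree_dz_dzbar a : has_bidegree 1 1 (wdg (dzc a) (dzbarc a) : E).
Proof.
rewrite -[dzbarc a]wedge1r; apply: has_bidegree_dz; apply: has_bidegree_dzbar.
exact: has_bidegree1.
Qed.

Lemma degree2_dz_dzbar a : has_degree 2 (wdg (dzc a) (dzbarc a) : E).
Proof. exact: (bidegree_degree (bidegree_dz_dzbar (a := a))). Qed.

Lemma stdw11 : has_bidegree 1 1 stdw.
Proof.
apply: (@graded_sum _ _ (fun S => _ /\ _)) => a.
by apply: (@gradedZ _ _ (fun S => _ /\ _)); exact: bidegree_dz_dzbar.
Qed.

Lemma cnj_dz_dzbar a : cnj ('i **: wdg (dzc a) (dzbarc a)) = 'i **: wdg (dzc a) (dzbarc a) :> E.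
Proof.
rewrite ext_conjZ ext_conjM ext_conj_dz ext_conj_dzbar conjCi.
have := @wedge_covecC R n (rshift n a) (lshift n a) e1.
by rewrite !wedge1r => ->; rewrite extNZ extZN opprK.
Qed.

Lemma stdw_real : cnj stdw = stdw.
Proof. by rewrite ext_conj_sum; apply: eq_bigr => a _; exact: cnj_dz_dzbar. Qed.

Lemma herm_stdw a b : herm_mx stdw a b = (a == b)%:R.
Proof.
have := iprod2_w stdw11 a b; rewrite /stdw !iprod_sum (bigD1 a) //= big1 => [|c ca].
  rewrite addr0 !iprodZ iprod_wedge_same iprodD iprodN.
  have -> : iprod (lshift n a) (dzbarc a) = 0 :> E.
    rewrite /dzbarc (covecE (rshift n a)) iprod_wedge_neq ?eq_lrshift //.
    by rewrite iprod1 wedge0r oppr0.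
  rewrite wedge0r iprod0 subr0 /dzbarc (covecE (rshift n a)) iprod_wedge iprod1 wedge0r subr0.
  rewrite (inj_eq (@rshift_inj _ _)) extZA => /(congr1 (fun u : E => u finset.set0)).
  rewrite !extZE e1_coef eqxx !mulr1 => /(mulfI (neq0Ci _)) <-.
  by rewrite eq_sym.
rewrite !iprodZ iprod_wedge (inj_eq (@lshift_inj _ _)) eq_sym (negbTE ca) ext0Z sub0r.
have -> : iprod (lshift n a) (dzbarc c) = 0 :> E.
  rewrite /dzbarc (covecE (rshift n c)) iprod_wedge_neq ?eq_lrshift //.
  by rewrite iprod1 wedge0r oppr0.
by rewrite wedge0r oppr0 iprod0 extZ0.
Qed.

Lemma wdg_dx_dy a : 'i **: wdg (dzc a) (dzbarc a) = 2%:R **: wdg (dx a) (dy a) :> E.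
Proof.
rewrite /dx /dy dzE dzbarE !escaleE wedgeZl wedgeZr !extZA wedgeDl !wedgeBr.
have sq s : wdg (cov s) (cov s) = 0 :> E.
  have := wedge_sqr0 (@wedge_covecC R n) s e1; by rewrite wedge1r.
have anti : wdg (dzbarc a) (dzc a) = - wdg (dzc a) (dzbarc a) :> E.
  by have := @wedge_covecC R n (rshift n a) (lshift n a) e1; rewrite !wedge1r.
rewrite !sq anti subr0 sub0r -opprD -[X in X + X]extZ1 -extZDl extZN extZA -extNZ.
congr (_ **: _).
have n2 : (2%:R : C) != 0 by rewrite pnatr_eq0.
rewrite (_ : 1 + 1 = 2%:R :> C) // mulfV // mul1r invfM mulrAC mulVf // mul1r.
by rewrite invCi opprK.
Qed.

Lemma posdef_stdw : mxposdef (herm_mx stdw).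
Proof.
move=> x x0; have [a xa] : exists a, x 0 a != 0.
  apply/existsP; apply: contraNT x0; rewrite negb_exists => /forallP xa.
  apply/eqP/rowP => a; rewrite mxE; apply/eqP; have := xa a.
  by rewrite negbK.
have -> : \sum_a \sum_b herm_mx stdw a b * x 0 a * (x 0 b)^* =
    \sum_a x 0 a * (x 0 a)^*.
  apply: eq_bigr => c _; rewrite (bigD1 c) //= big1 => [|d dc].
    by rewrite herm_stdw eqxx mul1r addr0.
  by rewrite herm_stdw eq_sym (negbTE dc) !mul0r.
rewrite (bigD1 a) //= ltr_wpDr ?mul_conjC_gt0 //.
by apply: sumr_ge0 => b _; exact: mul_conjC_ge0.
Qed.

(** Each [i dz_a /\ dzbar_a] equals [2 dx_a /\ dy_a], so the n-th divided power is [2^n] times the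
    reference form; [top_dpow_neq0] for [stdw] shows that the latter is non-zero. *)
Lemma density_stdw : density (dpow stdw n%:Z) = 2%:R ^+ n.
Proof.
have e2 a : has_degree 2 ('i **: wdg (dzc a) (dzbarc a) : E).
  by apply: gradedZ; exact: degree2_dz_dzbar.
have ee a : wdg ('i **: wdg (dzc a) (dzbarc a)) ('i **: wdg (dzc a) (dzbarc a)) = 0 :> E.
  rewrite wedgeZl wedgeZr wedgeA [wdg (dzbarc a) (wdg _ _)](@wedge_covecC R n).
  by rewrite wedgeNr (wedge_sqr0 (@wedge_covecC R n)) oppr0 !extZ0.
have [pE _] := dpow_sum (index_enum 'I_n) e2 ee.
have se : size (index_enum 'I_n) = n.
  by rewrite /index_enum unlock -enumT size_enum_ord.
rewrite se in pE; set V := \big[wdg/e1]_(a < n) wdg (dx a) (dy a) : E.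
have VE : dpow stdw n%:Z = 2%:R ^+ n **: V.
  rewrite pE (_ : 2%:R ^+ n = 2%:R ^+ size (index_enum 'I_n)) ; last by rewrite se.
  rewrite /V; elim: (index_enum _) => [|a r IH]; first by rewrite !big_nil expr0 extZ1.
  by rewrite !big_cons IH wdg_dx_dy wedgeZl wedgeZr extZA exprS.
have V0 : top V != 0.
  have := top_dpow_neq0 stdw11 (mxposdef_unit posdef_stdw).
  by rewrite VE topZ mulf_eq0 negb_or => /andP[].
rewrite VE /density wdgE e1E -/V -!topE topZ mulfK //.
Qed.

Lemma cnj_dpow w m : cnj w = w -> cnj (dpow w m%:Z) = dpow w m%:Z.
Proof.
move=> wr; elim: m => [|m IH]; first by rewrite divpow0 ext_conj1.
by rewrite divpowS ext_conjZ ext_conjM IH wr conjCV conjC_nat.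
Qed.

Lemma density_dpow_real w : cnj w = w ->
  ofR (reC (density (dpow w n%:Z))) = density (dpow w n%:Z).
Proof.
move=> wr; have := density_conj (dpow w n%:Z); rewrite (cnj_dpow _ wr) conjCxE.
case: (density _) => x y [/eqP]; rewrite -addr_eq0 -mulr2n mulrn_eq0 /= => /eqP -> //.
Qed.

(* Deform w to the standard metric through positive definite forms: the
   density of the n-th power never vanishes, hence keeps its sign. *)
Lemma density_dpow_gt0 w : has_bidegree 1 1 w -> cnj w = w -> posdef w ->
  0 < density (dpow w n%:Z).
Proof.
move=> w11 wr wpos.
pose p (t : R) := ofR (1 - t) **: stdw + ofR t **: w.
pose g (t : R) := reC (density (dpow (p t) n%:Z)).
have conj_ofR (x : R) : (ofR x : C)^* = ofR x by rewrite conjCxE /= oppr0.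
have pr t : cnj (p t) = p t.
  by rewrite /p ext_conjD !ext_conjZ stdw_real wr !conj_ofR.
have p11 t : has_bidegree 1 1 (p t).
  apply: (@gradedP _ _ (fun S => _ /\ _)); first exact: stdw11.
  by apply: (@gradedZ _ _ (fun S => _ /\ _)).
have ppos t : 0 <= t <= 1 -> mxposdef (herm_mx (p t)).
  move=> /andP[t0 t1] x x0.
  have -> : \sum_a \sum_b herm_mx (p t) a b * x 0 a * (x 0 b)^* =
      ofR (1 - t) * (\sum_a \sum_b herm_mx stdw a b * x 0 a * (x 0 b)^*) +
      ofR t * (\sum_a \sum_b herm_mx w a b * x 0 a * (x 0 b)^*).
    rewrite !mulr_sumr -big_split; apply: eq_bigr => a _ /=.
    rewrite !mulr_sumr -big_split; apply: eq_bigr => b _ /=.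
    have e : herm_mx (ofR t **: w) a b = ofR t * herm_mx w a b.
      by rewrite !mxE extZE mulrCA.
    by rewrite herm_mxP e; ring.
  have s0 := posdef_stdw x0; have w0 := wpos x x0.
  have [->|tn0] := eqVneq t 0.
    by rewrite subr0 mul1r mul0r addr0.
  have t_gt0 : 0 < (ofR t : C) by rewrite ofR_gt0 lt0r tn0.
  have t1_ge0 : 0 <= (ofR (1 - t) : C) by rewrite (lecR 0) subr_ge0.
  apply: ltr_wpDl; last exact: mulr_gt0.
  by rewrite mulr_ge0 // ltW.
have gc t : contat t g.
  apply: cont_reC; apply: ccont_density; apply: econt_dpow; apply: econtD.
    apply: econtZ; last exact: econt_cst.
    apply: ccont_ofR.
    split; apply: (@continuousB _ R^o _ (fun=> 1) id); [exact: cst_continuous|exact].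
  by apply: econtZ; [apply: ccont_ofR; exact: contat_id|exact: econt_cst].
have gn0 t : 0 <= t <= 1 -> g t != 0.
  move=> t01; apply/eqP => gt0.
  have := top_dpow_neq0 (p11 t) (mxposdef_unit (ppos t t01)).
  have V0 := top_dpow_neq0 stdw11 (mxposdef_unit posdef_stdw).
  have := density_dpow_real (pr t); rewrite -/(g t) gt0 => /esym/eqP.
  (* The quotient could also vanish because its denominator is zero; the density [2^n] of [stdw]
     excludes this. *)
  rewrite /density -topE mulf_eq0 => /orP[->//|]; rewrite invr_eq0 => /eqP dV.
  have := density_stdw; rewrite /density dV invr0 mulr0 => /esym/eqP.
  by rewrite expf_eq0 pnatr_eq0 andbF.
have g0 : 0 < g 0.
  rewrite /g /p subr0 extZ1 ext0Z addr0 density_stdw.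
  rewrite -natrX (_ : (_%:R : C) = ofR ((2 ^ n)%:R)) /= ?ltr0n ?expn_gt0 //.
  by rewrite ofRE rmorph_nat.
have g1 : 0 < g 1.
  rewrite ltNge; apply/negP => g1.
  have cw : {within `[0, 1], continuous g}.
    by apply: continuous_subspaceT => t; have [] := gc t.
  have [|c c01 gc0] := @IVT R g 0 1 0 ler01 cw.
    rewrite ge_min le_max g1 orbT (ltW g0) //.
  suff /gn0 : 0 <= c <= 1 by rewrite gc0 eqxx.
  by move: c01; rewrite in_itv.
rewrite -density_dpow_real // ofR_gt0.
by move: g1; rewrite /g /p subrr ext0Z add0r extZ1.
Qed.

Lemma density_wdg_gt0 w x : (0 < n)%N -> has_bidegree 1 1 w -> cnj w = w -> posdef w ->
  has_bidegree 1 1 x -> posdef x -> 0 < density (wdg x (dpow w (n - 1)%:Z)).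
Proof.
move=> n0 w11 wr wpos x11 xpos.
have hu := mxposdef_unit wpos.
rewrite /density -topE (top_wdg_dpow w11 hu n0 x11) -mulrA topE.
apply: mulr_gt0; last exact: density_dpow_gt0.
apply: mxtrace_inv_gt0 => // a b; exact: herm_conj.
Qed.

End Positivity.

(** * Differentiation of families of forms *)

Section RealDifferentiation.
Context {R : realType}.
Local Notation C := (Cx R).
Implicit Types (f g : R -> C) (l m : C).

(* Caratheodory's form of differentiability at 0. *)
Definition rdiff g l := exists q : R -> C,
  [/\ \forall t \near (0 : R), g t = g 0 + ofR t * q t, contat (0 : R) q & q 0 = l].

Lemma rdiff_real (g : R -> R) (q : R -> R) :
  (\forall t \near (0 : R), g t = g 0 + t * q t) -> contat (0 : R) q ->
  derivable g 0 1 /\ derive1 g 0 = q 0.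
Proof.
move=> gq [qc].
have H : h^-1 *: ((g \o shift 0) h - g 0) @[h --> (0 : R)^'] --> q 0.
  apply: (cvg_trans _ (cvg_trans (cvg_app q (@nbhs_dnbhs R (0 : R))) qc)).
  apply: near_eq_cvg; near=> h.
  have h0 : h != 0 by near: h; exact: nbhs_dnbhs_neq.
  rewrite /= addr0; have -> : g h = g 0 + h * q h.
    by near: h; exact: nbhs_dnbhs.
  by rewrite addrAC subrr add0r scalerA mulVf // scale1r.
have H' : h^-1 *: ((g \o shift 0) (h *: 1) - g 0) @[h --> (0 : R)^'] --> q 0.
  by under eq_fun do rewrite /GRing.scale /= mulr1.
split; first by apply/cvg_ex; exists (q 0).
by rewrite derive1E; apply/cvg_lim.
Unshelve. all: by end_near.
Qed.

Lemma rdiffP g l : rdiff g l -> rderivable g 0 /\ rderive g 0 = l.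
Proof.
move=> [q [gq qc <-]].
have [|d1 e1] := @rdiff_real (fun t => reC (g t)) (fun t => reC (q t)) _ (cont_reC qc).
  by apply: filterS gq => t ->; rewrite reCD reCM /= mul0r subr0.
have [|d2 e2] := @rdiff_real (fun t => imC (g t)) (fun t => imC (q t)) _ (cont_imC qc).
  by apply: filterS gq => t ->; rewrite imCD imCM /= mul0r addr0.
by split=> //; rewrite /rderive e1 e2; case: (q 0).
Qed.

Lemma contat_ofR (t : R) : contat t (@ofR R).
Proof. by split; exact: continuous_ofR. Qed.

Lemma rdiff_contat g l : rdiff g l -> contat (0 : R) g.
Proof.
move=> [q [gq qc _]]; apply: contat_near_ext gq _.
exact: (ccontD (ccont_cst _ _) (ccontM (contat_ofR _) qc)).
Qed.

Lemma rdiffM f g l m : rdiff f l -> rdiff g m ->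
  rdiff (fun t => f t * g t) (l * g 0 + f 0 * m).
Proof.
move=> df dg; have gc := rdiff_contat dg.
case: df dg => [p [fp pc <-]] [q [gq qc <-]].
exists (fun t => p t * g t + f 0 * q t); split=> //; last first.
  exact: (ccontD (ccontM pc gc) (ccontM (ccont_cst _ _) qc)).
apply: filterS2 fp gq => t ft gt; rewrite {1}ft mulrDl {1}gt; ring.
Qed.

Lemma rdiffX g l (m : nat) : rdiff g l ->
  rdiff (fun t => g t ^+ m) (m%:R * g 0 ^+ m.-1 * l).
Proof.
move=> dg; elim: m => [|m IH].
  exists (fun=> 0); split; [|exact: ccont_cst|by rewrite !mul0r].
  by apply: filterE => t; rewrite mulr0 addr0.
have := rdiffM dg IH; rewrite (_ : _ + _ = m.+1%:R * g 0 ^+ m.+1.-1 * l).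
  by congr (rdiff _ _); apply/funext => t; rewrite exprS.
by case: m {IH} => [|m] /=; rewrite ?expr0 ?exprS -?natr1; ring.
Qed.

Lemma rdiffV g l : g 0 != 0 -> rdiff g l ->
  rdiff (fun t => (g t)^-1) (- l / g 0 ^+ 2).
Proof.
move=> g0 dg; have gc := rdiff_contat dg; case: dg => [q [gq qc <-]].
exists (fun t => - q t / (g t * g 0)); split; last by rewrite expr2.
  have [gc'] := gc.
  apply: filterS2 gq (@cvgr_neq0 _ _ _ (nbhs (0 : R)) _ _ _ gc' g0) => t e gt0.
  have -> : ofR t * (- q t / (g t * g 0)) = - (g t - g 0) / (g t * g 0).
    by rewrite e; ring.
  by field; rewrite g0.
apply: ccontM; last by apply: ccontV; [rewrite mulf_neq0|exact: ccontM (ccont_cst _ _)].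
apply: contat_ext (ccontB (ccont_cst 0 _) qc) => t; by rewrite sub0r.
Qed.

Lemma rdiff_cst c : rdiff (fun=> c) 0.
Proof.
exists (fun=> 0); split=> //; last exact: ccont_cst.
by apply: filterE => t; rewrite mulr0 addr0.
Qed.

End RealDifferentiation.

Section TimeFamilies.
Context {R : realType} {n : nat}.
Local Notation C := (Cx R).
Local Notation E := (ext R n).
Local Notation V := 'rV[C]_n.
Implicit Types (p : V * R) (f g q r : V * R -> C) (F G Q H : V * R -> E).

(** The inverse matrix is a separate argument, so that the expression is bilinear and the product
    rule applies to it. *)
Definition lamk (K : 'M[C]_n) (u : E) : E :=
  \sum_d \sum_a (- 'i * K d a) **: iprod (rshift n d) (iprod (lshift n a) u).

Lemma lam_lamk (w u : E) : lam w u = lamk (invmx (herm_mx w)) u.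
Proof.
apply: eq_bigr => d _; rewrite upE iprod_sum; apply: eq_bigr => a _.
by rewrite iprodZ.
Qed.

Lemma has_bidegree_lamk a b K (u : E) :
  has_bidegree a.+1 b.+1 u -> has_bidegree a b (lamk K u).
Proof.
move=> ab; apply: (@graded_sum _ _ (fun S => _ /\ _)) => d.
apply: (@graded_sum _ _ (fun S => _ /\ _)) => c.
apply: (@gradedZ _ _ (fun S => _ /\ _)).
exact: has_bidegree_iprod_dzbar (has_bidegree_iprod_dz ab).
Qed.

(* At the point p = (z, t), F = F0 + t Q where F0 stands for the value of F at
   time 0; the quotient Q is continuous up to t = 0, where it is the derivative. *)
Definition ctime p f0 f q :=
  [/\ f p = f0 p + ofR p.2 * q p, contat p f0, contat p f & contat p q].

Definition etime p F0 F Q :=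
  [/\ F p = F0 p + ofR p.2 **: Q p, econt F0 p, econt F p & econt Q p].

Section Rules.
Variable p : V * R.

Lemma etime_cst F : econt F p -> etime p F F (fun=> 0).
Proof. by move=> Fp; split=> //; [rewrite extZ0 addr0|exact: econt_cst]. Qed.

Lemma etimeD F0 F Q G0 G H : etime p F0 F Q -> etime p G0 G H ->
  etime p (fun p => F0 p + G0 p) (fun p => F p + G p) (fun p => Q p + H p).
Proof.
move=> [e1 c1 c2 c3] [e2 c4 c5 c6]; split; try exact: econtD.
by rewrite e1 e2 extZDr addrACA.
Qed.

Lemma etimeZ f0 f q F0 F Q : ctime p f0 f q -> etime p F0 F Q ->
  etime p (fun p => f0 p **: F0 p) (fun p => f p **: F p)
    (fun p => q p **: F p + f0 p **: Q p).
Proof.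
move=> [e1 c1 c2 c3] [e2 c4 c5 c6]; split; try exact: econtZ.
  by rewrite e1 extZDl {1}e2 !extZDr !extZA -addrA (mulrC (f0 p)) [X in _ + X]addrC.
by apply: econtD; exact: econtZ.
Qed.

(** The exact Leibniz rule for difference quotients: the first factor varies with the second at the
    final time, then the second varies with the first at time 0. *)
Lemma etime_wdg F0 F Q G0 G H : etime p F0 F Q -> etime p G0 G H ->
  etime p (fun p => wdg (F0 p) (G0 p)) (fun p => wdg (F p) (G p))
    (fun p => wdg (Q p) (G p) + wdg (F0 p) (H p)).
Proof.
move=> [e1 c1 c2 c3] [e2 c4 c5 c6]; split; try exact: econt_wdg.
  by rewrite e1 wedgeDl {1}e2 wedgeDr wedgeZr wedgeZl extZDr -addrA [X in _ + X]addrC.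
by apply: econtD; exact: econt_wdg.
Qed.

Lemma etime_iprod s F0 F Q : etime p F0 F Q ->
  etime p (fun p => iprod s (F0 p)) (fun p => iprod s (F p)) (fun p => iprod s (Q p)).
Proof.
by move=> [e c1 c2 c3]; split; try exact: econt_iprod; rewrite e iprodD iprodZ.
Qed.

Lemma etime_sum (J : finType) (F0 F Q : J -> V * R -> E) :
  (forall j, etime p (F0 j) (F j) (Q j)) ->
  etime p (fun p => \sum_j F0 j p) (fun p => \sum_j F j p) (fun p => \sum_j Q j p).
Proof.
move=> FQ; split; try by apply: econt_sum => j; case: (FQ j).
by rewrite extZ_sum -big_split; apply: eq_bigr => j _; case: (FQ j).
Qed.

Lemma etime_cnj F0 F Q : etime p F0 F Q ->
  etime p (fun p => cnj (F0 p)) (fun p => cnj (F p)) (fun p => cnj (Q p)).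
Proof.
move=> [e c1 c2 c3]; split; try exact: econt_cnj.
by rewrite e ext_conjD ext_conjZ conjCxE /= oppr0.
Qed.

(** The quotient obtained by repeating the asymmetric Leibniz rule along
    [w_(m+1) = w /\ w_m / (m + 1)]. It takes the usual closed form once the two times coincide. *)
Fixpoint dpow_quot F0 F Q (m : nat) p : E :=
  if m is m'.+1 then
    (m'.+1%:R)^-1 **: (wdg (Q p) (dpow (F p) m'%:Z) + wdg (F0 p) (dpow_quot F0 F Q m' p))
  else 0.

Lemma etime_dpow F0 F Q m : etime p F0 F Q ->
  etime p (fun p => dpow (F0 p) m%:Z) (fun p => dpow (F p) m%:Z) (dpow_quot F0 F Q m).
Proof.
move=> FQ; elim: m => [|m IH].
  have := etime_cst (econt_cst e1 p).
  by congr etime; apply/funext => ?; rewrite divpow0.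
have c : ctime p (fun=> (m.+1%:R)^-1) (fun=> (m.+1%:R)^-1) (fun=> 0).
  by split; try exact: ccont_cst; rewrite mulr0 addr0.
have := etimeZ c (etime_wdg FQ IH).
congr etime; apply/funext => ?; rewrite ?divpowS //=.
by rewrite ext0Z add0r.
Qed.

(** When the values at the two times agree, [Q] of degree 2 can be commuted to the front and the
    factors contribute equal terms. For [m = 0] both sides vanish, in accordance with
    [w_(-1) = 0]. *)
Lemma dpow_quot0 F0 F Q m : has_degree 2 (Q p) -> F p = F0 p ->
  dpow_quot F0 F Q m p = wdg (Q p) (dpow (F p) (m%:Z - 1)).
Proof.
move=> Q2 F0E; elim: m => [|m IH] /=; first by rewrite dpowN1 wedge0r.
have -> : m.+1%:Z - 1 = m%:Z by rewrite intS addrC addKr.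
rewrite IH -F0E -wedgeA -(degree2_comm (F p) Q2) wedgeA.
case: m {IH} => [|m]; first by rewrite dpowN1 !wedge0r addr0 invr1 extZ1.
have -> : m.+1%:Z - 1 = m%:Z by rewrite intS addrC addKr.
rewrite wedge_divpow (wedgeZr m.+1%:R) -[X in X + _]extZ1 -extZDl extZA nat1r.
by rewrite mulVf ?extZ1 // pnatr_eq0.
Qed.

Lemma ctime_density F0 F Q : etime p F0 F Q ->
  ctime p (fun p => density (F0 p)) (fun p => density (F p)) (fun p => density (Q p)).
Proof.
move=> [e c1 c2 c3]; split; try exact: ccont_density.
by rewrite e addrC densityP addrC.
Qed.

Lemma ctime_herm F0 F Q a b : etime p F0 F Q ->
  ctime p (fun p => herm_mx (F0 p) a b) (fun p => herm_mx (F p) a b)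
    (fun p => herm_mx (Q p) a b).
Proof.
move=> [e c1 c2 c3]; split; try exact: ccont_herm.
by rewrite e addrC herm_mxP addrC.
Qed.

(** The resolvent identity [M^-1 - M0^-1 = - M^-1 (M - M0) M0^-1]. *)
Lemma ctime_invmx m (M0 M G : V * R -> 'M[C]_m) :
  M0 p \in unitmx -> M p \in unitmx ->
  (forall a b, ctime p (fun p => M0 p a b) (fun p => M p a b) (fun p => G p a b)) ->
  forall a b, ctime p (fun p => invmx (M0 p) a b) (fun p => invmx (M p) a b)
    (fun p => - (invmx (M p) *m G p *m invmx (M0 p)) a b).
Proof.
move=> u0 u1 MG a b.
have c0 i j : contat p (fun p => invmx (M0 p) i j).
  by apply: ccont_invmx => // i' j'; case: (MG i' j').
have c1 i j : contat p (fun p => invmx (M p) i j).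
  by apply: ccont_invmx => // i' j'; case: (MG i' j').
split=> //.
  have MGE : M p = M0 p + ofR p.2 *: G p.
    by apply/matrixP => i j; rewrite !mxE; case: (MG i j).
  have e : invmx (M0 p) = invmx (M p) + ofR p.2 *: (invmx (M p) *m G p *m invmx (M0 p)).
    rewrite -[LHS]mul1mx -[in LHS](mulVmx u1) [X in _ *m X *m _ = _]MGE mulmxDr mulmxDl.
    by rewrite mulmxK // -scalemxAr -scalemxAl.
  have := congr1 (fun N : 'M[C]_m => N a b) e.
  by rewrite /= mxE [X in _ + X]mxE => ->; ring.
have h : contat p (fun p => \sum_k (\sum_l invmx (M p) a l * G p l k) * invmx (M0 p) k b).
  apply: ccont_sum => k _; apply: ccontM => //; apply: ccont_sum => l _.
  by apply: ccontM => //; case: (MG l k).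
apply: contat_ext (ccontB (ccont_cst 0 p) h) => p'.
rewrite sub0r; congr (- _); rewrite mxE; apply: eq_bigr => k _; by rewrite mxE.
Qed.

Lemma etime_lamk (K0 K G : V * R -> 'M[C]_n) F0 F Q :
  (forall a b, ctime p (fun p => K0 p a b) (fun p => K p a b) (fun p => G p a b)) ->
  etime p F0 F Q ->
  etime p (fun p => lamk (K0 p) (F0 p)) (fun p => lamk (K p) (F p))
    (fun p => lamk (G p) (F p) + lamk (K0 p) (Q p)).
Proof.
move=> KG FQ.
have H (d a : 'I_n) : etime p
    (fun p => (- 'i * K0 p d a) **: iprod (rshift n d) (iprod (lshift n a) (F0 p)))
    (fun p => (- 'i * K p d a) **: iprod (rshift n d) (iprod (lshift n a) (F p)))
    (fun p => (- 'i * G p d a) **: iprod (rshift n d) (iprod (lshift n a) (F p)) +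
      (- 'i * K0 p d a) **: iprod (rshift n d) (iprod (lshift n a) (Q p))).
  have c : ctime p (fun p => - 'i * K0 p d a) (fun p => - 'i * K p d a)
      (fun p => - 'i * G p d a).
    case: (KG d a) => e c0 c1 c2; split; try exact: (ccontM (ccont_cst _ _)).
    by rewrite e; ring.
  exact: etimeZ c (etime_iprod _ (etime_iprod _ FQ)).
have := etime_sum (fun d => etime_sum (fun a => H d a)).
congr etime; apply/funext => p'.
rewrite /lamk -big_split; apply: eq_bigr => d _; rewrite -big_split.
by apply: eq_bigr => a _.
Qed.

End Rules.
End TimeFamilies.

(** * Directional derivatives and the operator dbar in a chart *)

Section ChartCalculus.
Context {R : realType} {n : nat}.
Local Notation C := (Cx R).
Local Notation E := (ext R n).
Local Notation V := 'rV[C]_n.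
Implicit Types (D : set V) (f g : V -> C) (v z : V).

Lemma smooth_on_cont D f z : smooth_on D f -> D z -> contat z f.
Proof. by move=> /(_ 0%N)[fc _] Dz; split; exact: fc. Qed.

Lemma smooth_on_dirderivable D f v z : smooth_on D f -> D z -> dirderivable v f z.
Proof. by move=> /(_ 1%N)[_ /(_ v)[h _]] Dz; exact: h. Qed.

Lemma smooth_on_dirderive D f v z : smooth_on D f -> D z -> contat z (dirderive v f).
Proof. by move=> /(_ 1%N)[_ /(_ v)[_ [h _]]] Dz; split; exact: h. Qed.

Lemma derive1_lin (c : R) (a b : R -> R) : derivable a 0 1 -> derivable b 0 1 ->
  derive1 (fun t => a t + c * b t) 0 = derive1 a 0 + c * derive1 b 0.
Proof.
move=> da db; rewrite !derive1E.
have dcb : derivable (c \*: b) 0 1 by exact: derivableZ.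
by rewrite (deriveD da dcb) deriveZ.
Qed.

Lemma dirderive_lin (c : R) f g v z : dirderivable v f z -> dirderivable v g z ->
  dirderive v (fun z => f z + ofR c * g z) z = dirderive v f z + ofR c * dirderive v g z.
Proof.
move=> [f1 f2] [g1 g2]; rewrite /dirderive /rderive.
under [X in mkC (derive1 X _)]eq_fun do rewrite reCD reCM /= mul0r subr0.
under [X in mkC _ (derive1 X _)]eq_fun do rewrite imCD imCM /= mul0r addr0.
rewrite (derive1_lin c f1 g1) (derive1_lin c f2 g2).
by apply/eqP; rewrite eq_complex /= !mul0r subr0 addr0 !eqxx.
Qed.

Lemma dirderive_near0 D f v z : open D -> D z -> (forall z, D z -> f z = 0) ->
  dirderive v f z = 0.
Proof.
move=> Do Dz f0.
have near0 : \forall t \near (0 : R), f (z + ofR t *: v) = 0.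
  have h : {for (0 : R), continuous (fun t : R => z + ofR t *: v)}.
    apply: continuousD; first exact: cst_continuous.
    apply: continuousZl; exact: continuous_ofR.
  have : \forall z' \near z + ofR 0 *: v, D z'.
    by rewrite (_ : ofR 0 = 0 :> C) // scale0r addr0; exact: open_nbhs_nbhs.
  move=> H; have H' : \forall t \near (0 : R), D (z + ofR t *: v) by exact: (h _ H).
  move: H'; apply: filterS => t; exact: f0.
have [|_] := @rdiffP R (fun t => f (z + ofR t *: v)) 0; last by [].
have f00 : f (z + ofR 0 *: v) = 0 by rewrite (_ : ofR 0 = 0 :> C) // scale0r addr0 f0.
have e t : f (z + ofR t *: v) = 0 -> f (z + ofR t *: v) = f (z + ofR 0 *: v) + ofR t * 0.
  by move=> ->; rewrite f00 mulr0 add0r.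
exists (fun=> 0); split=> //; last exact: ccont_cst.
exact: (filterS e near0).
Qed.
End ChartCalculus.

Section FormCalculus.
Context {R : realType} {n : nat} {X : complexManifold R n}.
Local Notation C := (Cx R).
Local Notation E := (ext R n).
Implicit Types (u v w : dform X) (i : chart_index X) (z : 'rV[C]_n).

Definition dcoef b u i z : E := [ffun S => dzbar_derive b (fun z' => u i z' S) z].

Lemma dbarE u i z : dbar u i z = \sum_b wdg (dzbarc b) (dcoef b u i z).
Proof. by rewrite /dbar wdgE; apply: eq_bigr => b _; rewrite dzbarE. Qed.

Lemma smooth_econt u i z : smooth_form u -> chart_img i z -> econt (u i) z.
Proof. by move=> [us _] iz; split=> S; exact: smooth_on_cont (us i S) iz. Qed.

Lemma dbar_econt u i z : smooth_form u -> chart_img i z -> econt (dbar u i) z.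
Proof.
move=> [us _] iz; apply: econt_ext (@dbarE u i) _.
apply: econt_sum => b; apply: econt_wdg; first exact: econt_cst.
split=> S; apply: contat_ext => [t|]; first by rewrite ffunE.
apply: ccontM; first exact: ccont_cst.
apply: ccontD; first exact: smooth_on_dirderive (us i S) iz.
by apply: ccontM; [exact: ccont_cst|exact: smooth_on_dirderive (us i S) iz].
Qed.

Lemma dbar_lin u v t i z : smooth_form u -> smooth_form v -> chart_img i z ->
  dbar (fadd u (fscale (ofR t) v)) i z = dbar u i z + ofR t **: dbar v i z.
Proof.
move=> [us _] [vs _] iz; rewrite !dbarE extZ_sum -big_split; apply: eq_bigr => b _ /=.
rewrite -wedgeZr -wedgeDr; congr wdg; apply/ffunP => S.
rewrite extDE extZE !ffunE /dzbar_derive.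
have e : (fun z' => fadd u (fscale (ofR t) v) i z' S) =
    (fun z' => u i z' S + ofR t * v i z' S).
  by apply/funext => z'; rewrite /fadd /fscale escaleE extDE extZE.
have d x := dirderive_lin t (smooth_on_dirderivable x (us i S) iz)
  (smooth_on_dirderivable x (vs i S) iz).
rewrite e (d (delta_mx 0 b)) (d ('i *: delta_mx 0 b)).
move: (dirderive _ _ z) (dirderive _ _ z) (dirderive _ _ z) (dirderive _ _ z) => x1 x2 x3 x4.
by ring.
Qed.

(** A coefficient of the wrong type vanishes on the whole chart image, which is open, so its
    derivatives vanish there as well. *)
Lemma dbar_bidegree u i z : (forall z, chart_img i z -> has_bidegree 1 1 (u i z)) ->
  chart_img i z -> has_bidegree 1 2 (dbar u i z).
Proof.
move=> u11 iz; rewrite dbarE; apply: (@graded_sum _ _ (fun S => _ /\ _)) => b.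
apply: has_bidegree_dzbar => S; rewrite ffunE; apply: contraNP => nS.
have u0 z' : chart_img i z' -> u i z' S = 0.
  by move=> /u11/(_ S) h; have [//|/h] := eqVneq (u i z' S) 0.
have d x := dirderive_near0 x (@chart_img_open _ _ X i) iz u0.
by rewrite /dzbar_derive !d mulr0 addr0 mulr0.
Qed.
End FormCalculus.

(** * Integration on the manifold *)

Section Charts.
Context {R : realType} {n : nat} {X : complexManifold R n}.
Local Notation C := (Cx R).
Local Notation E := (ext R n).
Local Notation V := 'rV[C]_n.
Hypothesis Xc : compact [set: X].
Variable P : partition_of_unity X.
Implicit Types (k : pu_index P).

Local Notation img k := (chart_img (pu_chart k)).

(* The support of the k-th function of the partition, seen in its chart. *)
Definition pu_supp k : set V :=
  chart_map (pu_chart k) @` closure [set x | pu_fun k x != 0].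

Lemma compact_pu_supp k : compact (pu_supp k).
Proof.
apply: continuous_compact.
  apply: continuous_in_subspaceT => x /set_mem/pu_support Dx.
  exact: chart_map_continuous.
exact: (subclosed_compact (@closed_closure _ _) Xc).
Qed.

Lemma pu_supp_img k : pu_supp k `<=` img k.
Proof. by move=> _ [x /pu_support Dx <-]; exists x. Qed.

Lemma closed_pu_supp k : closed (pu_supp k).
Proof. apply: (compact_closed _ (@compact_pu_supp k)); exact: norm_hausdorff. Qed.

Definition pu_loc k (z : V) : R :=
  if z \in img k then pu_fun k (chart_inv (pu_chart k) z) else 0.

Lemma pu_loc_out k z : ~ pu_supp k z -> pu_loc k z = 0.
Proof.
move=> Kz; rewrite /pu_loc; case: ifPn => // /set_mem[x Dx xz].
apply/eqP; apply/negPn/negP => h; apply: Kz; exists x => //.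
apply: subset_closure => /=; move: h.
by rewrite -xz chart_mapK.
Qed.

Lemma near_pu_supp_out k z : ~ pu_supp k z -> \forall z' \near z, ~ pu_supp k z'.
Proof. by move=> Kz; apply: open_nbhs_nbhs; split=> //; exact/closed_openC/closed_pu_supp. Qed.

Lemma near_img i (z : V) : chart_img (X := X) i z -> \forall z' \near z, chart_img i z'.
Proof. by move=> iz; apply: open_nbhs_nbhs; split=> //; exact: chart_img_open. Qed.

(** Two open sets cover the space: the complement of the closed support, where the extension is
    zero, and the image of the chart, where it is smooth. *)
Lemma pu_loc_cont k z : contat z (fun z => ofR (pu_loc k z) : C).
Proof.
have [Kz|Kz] := pselect (pu_supp k z); last first.
  apply: contat_near_ext (ccont_cst 0 z).
  by apply: filterS (near_pu_supp_out Kz) => z' /pu_loc_out ->.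
have iz := pu_supp_img Kz.
apply: contat_near_ext (smooth_on_cont (@pu_smooth _ _ _ P k (pu_chart k)) iz).
by apply: filterS (near_img iz) => z' iz'; rewrite /pu_loc mem_set.
Qed.

Lemma pu_supp_box : exists2 M : R, 0 <= M & forall k, pu_supp k `<=` @box R M n.
Proof.
pose Q (M : R) (z : V) := forall j, `|reC (z 0 j)| <= M /\ `|imC (z 0 j)| <= M.
have H k : \forall M \near +oo, pu_supp k `<=` Q M.
  move: (@compact_pu_supp k) => /compact_near_coveringP; apply => z _.
  have near_le (h : V -> R) : contat z h -> \forall z' \near z & M \near +oo, `|h z'| <= M.
    move=> [hc]; exists ([set z' | `|h z - h z'| < 1], [set M | `|h z| + 1 <= M]).
      split=> /=; last exact: nbhs_pinfty_ge.
      by move/(@cvgrPdist_lt _ _ _ (nbhs z)) : hc => /(_ 1 ltr01).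
    move=> [z' M] /= [h1 h2]; apply: le_trans h2.
    rewrite -[h z'](subKr (h z)) (le_trans (ler_normB _ _)) // lerD2l.
    by rewrite ltW.
  have cz j : contat z (fun z : V => z 0 j) by split; exact: coord_continuous.
  pose Q1 (j : 'I_n) (M : R) (z : V) := `|reC (z 0 j)| <= M /\ `|imC (z 0 j)| <= M.
  have J : forall j : 'I_n, \forall z' \near z & M \near +oo, Q1 j M z'.
    move=> j; have := near_le _ (cont_reC (cz j)); have := near_le _ (cont_imC (cz j)).
    by apply: filterS2.
  exact: (@filter_forall _ _ (fun j (q : V * R) => Q1 j q.2 q.1) _ _ J).
have {}H : \forall M \near +oo, forall k, pu_supp k `<=` Q M by exact: filter_forall.
have [M [M0 HM]] : exists M : R, 0 <= M /\ forall k, pu_supp k `<=` Q M.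
  have H0 : \forall M \near (+oo : set_system R), 0 <= M by exact: nbhs_pinfty_ge.
  by have [M [? ?]] := filter_ex (filterI H0 H); exists M.
by exists M.
Qed.

Definition dfun := chart_index X -> V -> C.
Implicit Types (f g : dfun).

(** The integral once densities are taken. Working with scalar families lets the integrand be split
    into pieces such as [star_pair] that are not presented as forms. *)
Definition dint f : C :=
  \sum_k cint_Cn (fun z => ofR (pu_loc k z) * f (pu_chart k) z).

Lemma fintE (u : dform X) : fint P u = dint (fun i z => density (u i z)).
Proof.
apply: eq_bigr => k _; congr cint_Cn; apply/funext => z; rewrite /pu_loc.
by case: ifP => //; rewrite mul0r.
Qed.

Lemma dint_eq f g : (forall i z, chart_img i z -> f i z = g i z) -> dint f = dint g.
Proof.
move=> fg; apply: eq_bigr => k _; congr cint_Cn; apply/funext => z.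
have [Kz|/pu_loc_out ->] := pselect (pu_supp k z); last by rewrite !mul0r.
by rewrite fg //; exact: pu_supp_img.
Qed.

Definition dcont f := forall i z, chart_img i z -> contat z (f i).

Lemma loc_cont k (h : V -> C) : (forall z, pu_supp k z -> contat z h) ->
  forall z, contat z (fun z => ofR (pu_loc k z) * h z).
Proof.
move=> hc z; have [Kz|Kz] := pselect (pu_supp k z).
  by apply: ccontM; [exact: pu_loc_cont|exact: hc].
apply: contat_near_ext (ccont_cst 0 z).
by apply: filterS (near_pu_supp_out Kz) => z' /pu_loc_out ->; rewrite mul0r.
Qed.

Lemma cint_Cn_lin k (c : C) (h g : V -> C) :
  (forall z, contat z h) -> (forall z, contat z g) ->
  (forall z, ~ pu_supp k z -> h z = 0) -> (forall z, ~ pu_supp k z -> g z = 0) ->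
  cint_Cn (fun z => c * h z + g z) = c * cint_Cn h + cint_Cn g.
Proof.
move=> hc gc hK gK; have [M M0 KM] := pu_supp_box; have [B IB] := integral_on_Cn M0 n.
have out (h' : V -> C) : (forall z, ~ pu_supp k z -> h' z = 0) ->
    forall z, ~ @box R M n z -> h' z = 0.
  by move=> h'K z zM; apply: h'K => /KM.
have [hM gM] := (out _ hK, out _ gK).
have lin (a b : R) (h1 h2 h3 : V -> R) :
    [/\ forall z, contat z h1, forall z, contat z h2 & forall z, contat z h3] ->
    [/\ forall z, ~ @box R M n z -> h1 z = 0, forall z, ~ @box R M n z -> h2 z = 0 &
       forall z, ~ @box R M n z -> h3 z = 0] ->
    int_Cn (fun z => a * h1 z + (b * h2 z + h3 z)) = a * int_Cn h1 + (b * int_Cn h2 + int_Cn h3).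
  move=> [c1 c2 c3] [s1 s2 s3]; rewrite -(int_linear IB b c2 c3 s2 s3).
  apply: (int_linear IB a c1 _ s1) => z.
    apply: contatD => //; apply: contatM => //; exact: contat_const.
  by move=> zM; rewrite s2 // s3 // mulr0 addr0.
have re0 (h' : V -> C) z : h' z = 0 -> reC (h' z) = 0 by move=> ->.
have im0 (h' : V -> C) z : h' z = 0 -> imC (h' z) = 0 by move=> ->.
have conts : [/\ forall z, contat z (fun z => reC (h z)), forall z, contat z (fun z => imC (h z)),
    forall z, contat z (fun z => reC (g z)) & forall z, contat z (fun z => imC (g z))].
  by split=> z; (apply: cont_reC + apply: cont_imC).
have outs : [/\ forall z, ~ @box R M n z -> reC (h z) = 0, forall z, ~ @box R M n z -> imC (h z) = 0,
    forall z, ~ @box R M n z -> reC (g z) = 0 & forall z, ~ @box R M n z -> imC (g z) = 0].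
  by split=> z zM; (apply: re0 + apply: im0); (exact: hM + exact: gM).
case: conts => c1 c2 c3 c4; case: outs => s1 s2 s3 s4.
have e1 : int_Cn (fun z => reC (c * h z + g z)) =
    reC c * int_Cn (fun z => reC (h z)) +
    (- imC c * int_Cn (fun z => imC (h z)) + int_Cn (fun z => reC (g z))).
  rewrite -lin //; congr int_Cn; apply/funext => z.
  by rewrite reCD reCM mulNr addrA.
have e2 : int_Cn (fun z => imC (c * h z + g z)) =
    reC c * int_Cn (fun z => imC (h z)) +
    (imC c * int_Cn (fun z => reC (h z)) + int_Cn (fun z => imC (g z))).
  rewrite -lin //; congr int_Cn; apply/funext => z.
  by rewrite imCD imCM addrA.
rewrite /cint_Cn e1 e2; case: c {e1 e2} => x y /=.
by apply/eqP; rewrite eq_complex /= mulNr !addrA !eqxx.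
Qed.

Lemma dint_lin (c : C) f g : dcont f -> dcont g ->
  dint (fun i z => c * f i z + g i z) = c * dint f + dint g.
Proof.
move=> fc gc; rewrite mulr_sumr -big_split; apply: eq_bigr => k _ /=.
rewrite -(cint_Cn_lin (k := k)).
- by congr cint_Cn; apply/funext => z; rewrite mulrDr mulrCA.
- by apply: loc_cont => z /pu_supp_img; exact: fc.
- by apply: loc_cont => z /pu_supp_img; exact: gc.
- by move=> z /pu_loc_out ->; rewrite mul0r.
- by move=> z /pu_loc_out ->; rewrite mul0r.
Qed.

Lemma dint0 : dint (fun _ _ => 0) = 0.
Proof.
rewrite /dint big1 // => k _; rewrite (_ : (fun _ => _) = fun _ => 0).
  by rewrite /cint_Cn !int_Cn0.
by apply/funext => z; rewrite mulr0.
Qed.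

Lemma dint_conj f : dcont f -> dint (fun i z => (f i z)^*) = (dint f)^*.
Proof.
move=> fc; rewrite /dint (big_morph Num.conj (@conjCD R) (@conjC0 _)).
apply: eq_bigr => k _; rewrite conjCxE /cint_Cn /=; congr mkC.
  by congr int_Cn; apply/funext => z; rewrite conjCxE !reCM /= !mul0r.
have [M M0 KM] := pu_supp_box; have [B IB] := integral_on_Cn M0 n.
pose h z := ofR (pu_loc k z) * f (pu_chart k) z.
have hc : forall z, contat z h by apply: loc_cont => z /pu_supp_img; exact: fc.
have h0 z : ~ @box R M n z -> imC (h z) = 0.
  by move=> zM; rewrite /h pu_loc_out ?mul0r // => /KM.
have := int_linear IB (-1) (fun z => cont_imC (hc z)) (fun z => contat_const z 0) h0 (fun _ _ => erefl).
rewrite int_Cn0 addr0 mulN1r => <-; congr int_Cn; apply/funext => z.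
by rewrite addr0 conjCxE /h !imCM /= mul0r !addr0 mulN1r mulrN.
Qed.

(** At a given point the functions of the partition sum to 1, so one of them is non-zero there. Its
    integral is positive and the others are non-negative. *)
Lemma dint_gt0 f : dcont f -> (forall i z, chart_img i z -> 0 < f i z) ->
  (exists x : X, True) -> 0 < dint f.
Proof.
move=> fc f0 [x _]; have [M M0 KM] := pu_supp_box.
pose g k z := pu_loc k z * reC (f (pu_chart k) z).
have gE k z : ofR (pu_loc k z) * f (pu_chart k) z = ofR (g k z).
  have [Kz|/pu_loc_out h] := pselect (pu_supp k z); last by rewrite /g h !mul0r.
  have [-> _] := gt0_ofR (f0 _ _ (pu_supp_img Kz)).
  by rewrite /g !ofRE /= rmorphM.
have gc k z : contat z (g k).
  have := cont_reC (loc_cont (fun z Kz => fc _ _ (@pu_supp_img k z Kz)) z).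
  by apply: contat_ext => z'; rewrite gE.
have g0 k z : 0 <= g k z.
  have [Kz|/pu_loc_out h] := pselect (pu_supp k z); last by rewrite /g h mul0r.
  apply: mulr_ge0; first by rewrite /pu_loc; case: ifP => // _; exact: pu_ge0.
  by have [_ /ltW] := gt0_ofR (f0 _ _ (pu_supp_img Kz)).
have gM k z : ~ @box R M n z -> g k z = 0.
  by move=> zM; rewrite /g pu_loc_out ?mul0r // => /KM.
have termE k : cint_Cn (fun z => ofR (pu_loc k z) * f (pu_chart k) z) = ofR (int_Cn (g k)).
  rewrite (_ : (fun z => _) = fun z => ofR (g k z)); last by apply/funext => z; exact: gE.
  by rewrite /cint_Cn /= int_Cn0.
have [k xk] : exists k, pu_fun k x != 0.
  apply/existsP; apply: contraT; rewrite negb_exists => /forallP h.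
  have := pu_sum1 P x; rewrite big1 => [/eqP|k _]; first by rewrite eq_sym oner_eq0.
  by apply/eqP; rewrite -[_ == _]negbK h.
have Dx : chart_dom (pu_chart k) x by apply: pu_support; exact: subset_closure.
have iz : img k (chart_map (pu_chart k) x) by exists x.
rewrite /dint (bigD1 k) //= ltr_wpDr //.
  by apply: sumr_ge0 => k' _; rewrite termE (lecR 0) int_Cn_ge0.
rewrite termE ofR_gt0; apply: (int_Cn_gt0 M0 (gc k) (gM k) (g0 k) (v0 := chart_map (pu_chart k) x)).
apply: mulr_gt0; last by have [] := gt0_ofR (f0 _ _ iz).
by rewrite /pu_loc mem_set // chart_mapK // lt0r xk pu_ge0.
Qed.

Lemma dint_empty f : ~ (exists x : X, True) -> dint f = 0.
Proof.
move=> X0; rewrite -[RHS]dint0; apply: dint_eq => i z [x _ _]; case: X0; by exists x.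
Qed.

Lemma contat_slice (U : topologicalType) (h : V * R -> U) z t :
  contat (z, t) h -> contat z (fun z => h (z, t)).
Proof. exact: (contat_comp (contat_pair (contat_id z) (contat_const z t))). Qed.

Section Differentiation.
Variables (W : chart_index X -> set (V * R)) (f0 f q : chart_index X -> V * R -> C).
Hypothesis fq : forall i p, W i p -> ctime p (f0 i) (f i) (q i).
Hypothesis f0E : forall i z t, chart_img i z -> f0 i (z, t) = f i (z, 0).
Hypothesis W0 : forall k, \forall t \near (0 : R),
  forall z, pu_supp k z -> W (pu_chart k) (z, t).

Let loc k (h : V * R -> C) t z := ofR (pu_loc k z) * h (z, t).

(** On the support, [q] is jointly continuous at time 0; off the support, the cut-off function kills
    the integrand near the point for every time. So [contat_integral] applies over one box. *)
Lemma contat_cint_loc k : contat (0 : R) (fun t => cint_Cn (loc k (q (pu_chart k)) t)).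
Proof.
have [M M0 KM] := pu_supp_box; have [B IB] := integral_on_Cn M0 n.
pose i := pu_chart k.
have qc t : (forall z, pu_supp k z -> W i (z, t)) -> forall z, contat z (loc k (q i) t).
  by move=> Wt; apply: loc_cont => z /Wt/fq[_ _ _]; exact: contat_slice.
have q0 t z : ~ @box R M n z -> loc k (q i) t z = 0.
  by move=> zM; rewrite /loc pu_loc_out ?mul0r // => /KM.
have qj z : contat (z, 0 : R) (fun p => loc k (q i) p.2 p.1).
  have lc : contat (z, 0 : R) (fun p => ofR (pu_loc k p.1) : C).
    exact: (contat_comp (g := fun z => ofR (pu_loc k z) : C) (contat_fst (z, 0 : R)) (pu_loc_cont k z)).
  have [Kz|Kz] := pselect (pu_supp k z).
    apply: ccontM => //; have [_ _ _] := fq (nbhs_singleton (W0 k) _ Kz).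
    by apply: contat_ext => -[].
  apply: contat_near_ext (ccont_cst 0 _).
  have [h] := contat_fst (z, 0 : R).
  have h' : \forall p \near (z, 0 : R), ~ pu_supp k p.1 by exact: h _ (near_pu_supp_out Kz).
  by apply: filterS h' => p /pu_loc_out; rewrite /loc => ->; rewrite mul0r.
apply: ccont_mkC.
  apply: (contat_integral IB (@compact_box R M n)
      (g := fun t z => reC (loc k (q i) t z))) => [|t z zM|z _].
  - by apply: filterS (W0 k) => t Wt z; apply: cont_reC; exact: qc.
  - by rewrite q0.
  - exact: (cont_reC (qj z)).
apply: (contat_integral IB (@compact_box R M n)
    (g := fun t z => imC (loc k (q i) t z))) => [|t z zM|z _].
- by apply: filterS (W0 k) => t Wt z; apply: cont_imC; exact: qc.
- by rewrite q0.
- exact: (cont_imC (qj z)).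
Qed.

Lemma cint_loc_expand k : \forall t \near (0 : R),
  cint_Cn (loc k (f (pu_chart k)) t) =
  cint_Cn (loc k (f (pu_chart k)) 0) + ofR t * cint_Cn (loc k (q (pu_chart k)) t).
Proof.
have W00 := nbhs_singleton (W0 k).
apply: filterS (W0 k) => t Wt.
rewrite addrC -(cint_Cn_lin (k := k)).
- congr cint_Cn; apply/funext => z; rewrite /loc.
  have [Kz|/pu_loc_out ->] := pselect (pu_supp k z); last by rewrite !mul0r mulr0 addr0.
  have [-> _ _ _] := fq (Wt z Kz); rewrite f0E /=; last exact: pu_supp_img.
  by ring.
- by apply: loc_cont => z /Wt/fq[_ _ _]; exact: contat_slice.
- by apply: loc_cont => z /W00/fq[_ _ + _]; exact: contat_slice.
- by move=> z; rewrite /loc => /pu_loc_out ->; rewrite mul0r.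
- by move=> z; rewrite /loc => /pu_loc_out ->; rewrite mul0r.
Qed.

(** The integral of a Caratheodory quotient is a Caratheodory quotient of the integral, its
    continuity at 0 being that of a parametric integral. *)
Lemma dint_rdiff : rdiff (fun t => dint (fun i z => f i (z, t))) (dint (fun i z => q i (z, 0))).
Proof.
exists (fun t => dint (fun i z => q i (z, t))); split=> //; last first.
  by apply: ccont_sum => k _; exact: contat_cint_loc.
have H : \forall t \near (0 : R), forall k, cint_Cn (loc k (f (pu_chart k)) t) =
    cint_Cn (loc k (f (pu_chart k)) 0) + ofR t * cint_Cn (loc k (q (pu_chart k)) t).
  exact: (@filter_forall _ _ (fun k t => cint_Cn (loc k (f (pu_chart k)) t) =
    cint_Cn (loc k (f (pu_chart k)) 0) + ofR t * cint_Cn (loc k (q (pu_chart k)) t))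
    _ _ cint_loc_expand).
apply: filterS H => t Ht; rewrite /dint mulr_sumr -big_split.
by apply: eq_bigr => k _; exact: Ht.
Qed.
End Differentiation.

End Charts.

(** * The first variation of the integrand *)

Section PointwiseVariation.
Context {R : realType} {n : nat}.
Local Notation C := (Cx R).
Local Notation E := (ext R n).
Implicit Types (w u v g b x : E).

Lemma densityE u : density u = top u * density (ext_basis [set: 'I_(n + n)]%SET : E).
Proof. by rewrite /density -!topE (topE (ext_basis _)) ffunE eqxx mul1r. Qed.

Lemma densityZ (c : C) u : density (c **: u) = c * density u.
Proof. by rewrite !(densityE (_ **: _)) !(densityE u) topZ mulrA. Qed.

Lemma densityD u v : density (u + v) = density u + density v.
Proof. by rewrite (densityE (u + v)) (densityE u) (densityE v) topD mulrDl. Qed.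

(** Euler's formula strips covectors from [u]; each one applies [grade] to [v] as it passes, which
    for two forms of degree 3 gives the sign -1. *)
Lemma degree3_anti u v : has_degree 3 u -> has_degree 3 v -> wdg u v = - wdg v u.
Proof.
have H k : forall u, has_degree k u -> forall v, wdg u v = wdg (iter k grade v) u.
  elim: k => [|k IH] {}u ku {}v; first by rewrite (degree0E ku) wedgeZl wedgeZr wedge1l wedge1r.
  have k0 : (k.+1%:R : C) != 0 by rewrite pnatr_eq0.
  rewrite -[u]extZ1 -(mulVf k0) -extZA -(euler ku) wedgeZl wedgeZr; congr (_ **: _).
  rewrite wedge_suml wedge_sumr; apply: eq_bigr => s _.
  rewrite wedgeA (IH _ (has_degree_iprod ku)) -wedgeA covec_comm wedgeA.
  by congr wdg; elim: k {IH ku k0} => [//|k IH] /=; rewrite IH.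
move=> u3 v3; rewrite (H 3 u u3) /=.
by rewrite gradeK (grade_degree v3) -signr_odd /= expr1 extZN1 wedgeNl.
Qed.

Lemma has_bidegree_wdg11 p q w b : has_bidegree 1 1 w -> has_bidegree p q b ->
  has_bidegree p.+1 q.+1 (wdg w b).
Proof.
move=> w11 bpq; rewrite (wE w11) wedge_suml; apply: (@graded_sum _ _ (fun S => _ /\ _)) => a.
rewrite wedge_suml; apply: (@graded_sum _ _ (fun S => _ /\ _)) => c.
rewrite wedgeZl wedgeA; apply: (@gradedZ _ _ (fun S => _ /\ _)).
by apply: has_bidegree_dz; apply: has_bidegree_dzbar.
Qed.

Section Fixed.
Variable w : E.
Hypothesis w11 : has_bidegree 1 1 w.
Hypothesis wr : cnj w = w.
Hypothesis hu : herm_mx w \in unitmx.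
Variable m : nat.
Hypothesis nm : n = m.+3.
Variable u : E.
Hypothesis u12 : has_bidegree 1 2 u.
Hypothesis u0 : lam w u = 0.

(** The term produced by varying the first factor [u] in [i u /\ ubar /\ w_m], kept as a wedge
    product so that it is visibly linear in [v]. *)
Definition star_pair v := density ('i **: wdg (wdg v (cnj u)) (dpow w m%:Z)).

Lemma star_pairE v : has_bidegree 1 2 v ->
  star_pair v = ext_inner w v u * density (dpow w n%:Z).
Proof.
move=> v12; rewrite /star_pair densityZ (densityE (wdg _ _)) mulrA.
rewrite (star_primitive w11 wr hu m u12 v12 u0) -mulrA -densityE.
by have -> : n%:Z = m.+3%:Z by congr Posz.
Qed.

Lemma star_pairP (c : C) v v' : star_pair (c **: v + v') = c * star_pair v + star_pair v'.
Proof.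
by rewrite /star_pair !wedgePl extZDr densityD extZA (mulrC 'i) -extZA (densityZ c).
Qed.

Lemma star_pairD v v' : star_pair (v + v') = star_pair v + star_pair v'.
Proof. by rewrite -[v]extZ1 star_pairP mul1r extZ1. Qed.

Lemma star_pairB v v' : star_pair (v - v') = star_pair v - star_pair v'.
Proof. by rewrite addrC -extZN1 star_pairP mulN1r addrC. Qed.

Lemma star_pair_w b : has_bidegree 0 1 b -> star_pair (wdg w b) = 0.
Proof.
move=> b01; rewrite star_pairE; last exact: has_bidegree_wdg11.
by rewrite (inner_herm w11 wr) -(inner_wedge w11 wr hu) u0 inner0l conjC0 mul0r.
Qed.

(** Conjugation exchanges the two 3-forms at the cost of a sign, which the conjugate of [i]
    compensates. Varying the second factor therefore gives the conjugate of varying the first,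
    whence the twice real parts. *)
Lemma star_pair_conj v : has_bidegree 1 2 v ->
  density ('i **: wdg (wdg u (cnj v)) (dpow w m%:Z)) = (star_pair v)^*.
Proof.
move=> v12; rewrite /star_pair -density_conj ext_conjZ !ext_conjM ext_conjK conjCi (cnj_dpow _ wr).
have v3 := bidegree_degree (has_bidegree_conj v12).
have u3 := bidegree_degree u12.
by rewrite (degree3_anti v3 u3) wedgeNl extNZ extZN opprK.
Qed.

Lemma inner_star v : has_bidegree 1 2 v ->
  density (ext_inner w u v **: dpow w n%:Z) = (star_pair v)^*.
Proof.
move=> v12; rewrite (inner_herm w11 wr) star_pairE // densityZ conjCM -density_conj.
by rewrite (cnj_dpow _ wr).
Qed.

End Fixed.
End PointwiseVariation.

Section Variation.
Context {R : realType} {n : nat} {X : complexManifold R n}.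
Local Notation C := (Cx R).
Local Notation E := (ext R n).
Local Notation V := 'rV[C]_n.
Variables (om ga : dform X).
Hypothesis om_metric : hermitian_metric om.
Hypothesis ga_real : smooth_real11 ga.
Variable m : nat.
Hypothesis nm : n = m.+3.
Implicit Types (i : chart_index X) (p : V * R) (z : V).

Let om_smooth : smooth_form om. Proof. by case: om_metric => -[]. Qed.
Let ga_smooth : smooth_form ga. Proof. by case: ga_real. Qed.
Let om11 i z : chart_img i z -> has_bidegree 1 1 (om i z).
Proof. by case: om_metric => -[_ h] _ /h[]. Qed.
Let om_cnj i z : chart_img i z -> cnj (om i z) = om i z.
Proof. by case: om_metric => -[_ h] _ /h[_]; rewrite cnjE. Qed.
Let om_unit i z : chart_img i z -> herm_mx (om i z) \in unitmx.
Proof. by case: om_metric => _ h /h; exact: mxposdef_unit. Qed.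
Let ga11 i z : chart_img i z -> has_bidegree 1 1 (ga i z).
Proof. by case: ga_real => _ h /h[]. Qed.
Let ga_cnj i z : chart_img i z -> cnj (ga i z) = ga i z.
Proof. by case: ga_real => _ h /h[_]; rewrite cnjE. Qed.

(* The suffixes 0, t, q stand for the value at time 0, the value at time t, and
   the difference quotient between them. *)
Definition w0 i p : E := om i p.1.
Definition wt i p : E := om i p.1 + ofR p.2 **: ga i p.1.
Definition wq i p : E := ga i p.1.
Definition d0 i p : E := dbar om i p.1.
Definition dt i p : E := dbar om i p.1 + ofR p.2 **: dbar ga i p.1.
Definition dq i p : E := dbar ga i p.1.
Definition k0 i p : 'M[C]_n := invmx (herm_mx (w0 i p)).
Definition kt i p : 'M[C]_n := invmx (herm_mx (wt i p)).
Definition kq i p : 'M[C]_n := - (kt i p *m herm_mx (wq i p) *m k0 i p).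
Let c1 : C := (n%:R - 1)^-1.
Definition b0 i p : E := c1 **: lamk (k0 i p) (d0 i p).
Definition bt i p : E := c1 **: lamk (kt i p) (dt i p).
Definition bq i p : E := c1 **: (lamk (kq i p) (dt i p) + lamk (k0 i p) (dq i p)).
Definition u0 i p : E := d0 i p - wdg (w0 i p) (b0 i p).
Definition ut i p : E := dt i p - wdg (wt i p) (bt i p).
Definition uq i p : E := dq i p - (wdg (wq i p) (bt i p) + wdg (w0 i p) (bq i p)).
Definition phi0 i p : E :=
  'i **: wdg (wdg (u0 i p) (cnj (u0 i p))) (dpow (w0 i p) m%:Z).
Definition phit i p : E :=
  'i **: wdg (wdg (ut i p) (cnj (ut i p))) (dpow (wt i p) m%:Z).
Definition phiq i p : E :=
  'i **: (wdg (wdg (uq i p) (cnj (ut i p)) + wdg (u0 i p) (cnj (uq i p))) (dpow (wt i p) m%:Z)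
    + wdg (wdg (u0 i p) (cnj (u0 i p))) (dpow_quot (w0 i) (wt i) (wq i) m p)).

(** Invertibility rather than positivity: the explicit formulas for [Lambda] and [prim] rest on it,
    and as an open condition it persists near time 0. *)
Definition good i p := chart_img i p.1 /\ herm_mx (wt i p) \in unitmx.

Lemma econt_fst (F : V -> E) p : econt F p.1 -> econt (fun p : V * R => F p.1) p.
Proof. by move=> [Fp]; split=> S; exact: (contat_comp (g := fun z => F z S) (contat_fst p) (Fp S)). Qed.

Lemma contat_time p : contat p (fun p : V * R => ofR p.2 : C).
Proof. exact: (contat_comp (g := @ofR R) (contat_snd p) (contat_ofR _)). Qed.

Lemma etime_affine (F Q : V -> E) p : econt F p.1 -> econt Q p.1 ->
  etime p (fun p => F p.1) (fun p => F p.1 + ofR p.2 **: Q p.1) (fun p => Q p.1).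
Proof.
move=> Fp Qp; split=> //; try exact: econt_fst.
by apply: econtD; [exact: econt_fst|apply: econtZ (contat_time p) (econt_fst Qp)].
Qed.

Lemma etime_w i p : chart_img i p.1 -> etime p (w0 i) (wt i) (wq i).
Proof. by move=> ip; apply: etime_affine; exact: smooth_econt. Qed.

Lemma etime_d i p : chart_img i p.1 -> etime p (d0 i) (dt i) (dq i).
Proof. by move=> ip; apply: etime_affine; exact: dbar_econt. Qed.

Lemma ctime_cst (c : C) p : ctime p (fun=> c) (fun=> c) (fun=> 0).
Proof. by split; try exact: ccont_cst; rewrite mulr0 addr0. Qed.

Lemma etimeZc (c : C) p (F0 F Q : V * R -> E) : etime p F0 F Q ->
  etime p (fun p => c **: F0 p) (fun p => c **: F p) (fun p => c **: Q p).
Proof.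
move=> FQ; have := etimeZ (ctime_cst c p) FQ; congr etime; apply/funext => p'.
by rewrite ext0Z add0r.
Qed.

Lemma etimeB p (F0 F Q G0 G H : V * R -> E) : etime p F0 F Q -> etime p G0 G H ->
  etime p (fun p => F0 p - G0 p) (fun p => F p - G p) (fun p => Q p - H p).
Proof.
move=> FQ GH; have := etimeD FQ (etimeZc (-1) GH).
by congr etime; apply/funext => p'; rewrite extZN1.
Qed.

Lemma etime_b i p : good i p -> etime p (b0 i) (bt i) (bq i).
Proof.
move=> [ip pu]; apply: etimeZc; apply: etime_lamk (etime_d ip) => a b.
rewrite (_ : (fun p => kq i p a b) = fun p => - (kt i p *m herm_mx (wq i p) *m k0 i p) a b).
  exact: (ctime_invmx (om_unit ip : herm_mx (w0 i p) \in unitmx) pu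
    (fun a b => ctime_herm a b (etime_w ip)) a b).
by apply/funext => p'; rewrite /kq mxE.
Qed.

Lemma etime_u i p : good i p -> etime p (u0 i) (ut i) (uq i).
Proof.
move=> gp; have [ip _] := gp.
exact: etimeB (etime_d ip) (etime_wdg (etime_w ip) (etime_b gp)).
Qed.

Lemma etime_phi i p : good i p -> etime p (phi0 i) (phit i) (phiq i).
Proof.
move=> gp; have [ip _] := gp; apply: etimeZc.
apply: etime_wdg (etime_wdg (etime_u gp) (etime_cnj (etime_u gp))) _.
exact: etime_dpow (etime_w ip).
Qed.

Lemma at0 i z : [/\ wt i (z, 0) = om i z, w0 i (z, 0) = om i z,
  dt i (z, 0) = dbar om i z & kt i (z, 0) = k0 i (z, 0)].
Proof.
have e (x y : E) : x + (ofR 0 : C) **: y = x by rewrite ext0Z addr0.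
by rewrite /kt /k0 /wt /dt /= !e.
Qed.

Lemma good0 i z : chart_img i z -> good i (z, 0).
Proof. by move=> iz; have [h _ _ _] := at0 i z; split; rewrite ?h //; exact: om_unit. Qed.

Lemma phi0E i z t : phi0 i (z, t) = phit i (z, 0).
Proof.
have [h1 h2 h3 h4] := at0 i z.
by rewrite /phit /phi0 /ut /u0 /bt /b0 h1 h3 h4.
Qed.

Let n1 : (1 < n)%N. Proof. by rewrite nm. Qed.

Lemma wt11 i p : chart_img i p.1 -> has_bidegree 1 1 (wt i p).
Proof.
move=> ip; apply: (@gradedD _ _ (fun S => _ /\ _)); first exact: om11.
by apply: (@gradedZ _ _ (fun S => _ /\ _)); exact: ga11.
Qed.

Lemma wt_cnj i p : chart_img i p.1 -> cnj (wt i p) = wt i p.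
Proof.
move=> ip; rewrite /wt ext_conjD ext_conjZ om_cnj // ga_cnj //.
by rewrite conjCxE /= oppr0.
Qed.

Lemma dt12 i p : chart_img i p.1 -> has_bidegree 1 2 (dt i p).
Proof.
move=> ip; apply: (@gradedD _ _ (fun S => _ /\ _)).
  by apply: dbar_bidegree => // z; exact: om11.
apply: (@gradedZ _ _ (fun S => _ /\ _)).
by apply: dbar_bidegree => // z; exact: ga11.
Qed.

Lemma utE i z t : good i (z, t) ->
  fprim (fadd om (fscale (ofR t) ga)) (dbar (fadd om (fscale (ofR t) ga))) i z = ut i (z, t).
Proof.
move=> [iz wu]; rewrite /fprim dbar_lin // /fadd /fscale escaleE.
rewrite -/(wt i (z, t)) -/(dt i (z, t)).
rewrite (primE (wt11 (p := (z, t)) iz) (wt_cnj (p := (z, t)) iz) wu n1).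
  by rewrite lam_lamk.
exact: (bidegree_degree (dt12 (p := (z, t)) iz)).
Qed.

Lemma phitE i z t : good i (z, t) ->
  density (fscale 'i (fwedge (fwedge (fprim (fadd om (fscale (ofR t) ga))
      (dbar (fadd om (fscale (ofR t) ga))))
    (fconj (fprim (fadd om (fscale (ofR t) ga)) (dbar (fadd om (fscale (ofR t) ga))))))
    (fdivpow (fadd om (fscale (ofR t) ga)) (n%:Z - 3))) i z) = density (phit i (z, t)).
Proof.
move=> gz; rewrite /fscale escaleE /fwedge wdgE /fconj cnjE /fdivpow dpowE.
rewrite -/(fscale (ofR t) ga) utE // /fadd /fscale escaleE -/(wt i (z, t)).
by have -> : n%:Z - 3 = m%:Z by rewrite nm -addn3 PoszD -addrA addr0.
Qed.

Section AtZero.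
Variables (i : chart_index X) (z : V).
Hypothesis iz : chart_img i z.
Local Notation w := (om i z).
Local Notation u := (prim w (dbar om i z)).

Lemma om_d3 : has_degree 3 (dbar om i z).
Proof. by apply: (bidegree_degree (p := 1) (q := 2)); apply: dbar_bidegree => // ?; exact: om11. Qed.

Lemma ga_d12 : has_bidegree 1 2 (dbar ga i z).
Proof. by apply: dbar_bidegree => // ?; exact: ga11. Qed.

Lemma bt01 (p := (z, 0 : R)) : has_bidegree 0 1 (bt i p) /\ has_bidegree 0 1 (bq i p).
Proof.
have d12 := @dt12 i p iz; have q12 := ga_d12; split.
  by apply: (@gradedZ _ _ (fun S => _ /\ _)); apply: has_bidegree_lamk.
apply: (@gradedZ _ _ (fun S => _ /\ _)); apply: (@gradedD _ _ (fun S => _ /\ _)).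
  exact: has_bidegree_lamk.
exact: has_bidegree_lamk.
Qed.

(** The 1-form in the Lefschetz decomposition of [dbar omega] and the (0,1)-part of the Lee form are
    both the contraction of [dbar omega] divided by [n - 1]. This is how theta enters the
    variation. *)
Lemma theta_bt : theta01 om i z = bt i (z, 0).
Proof.
have [h1 h2 h3 h4] := at0 i z.
rewrite /theta01 /fscale escaleE /fLambda (LambdaE (om11 iz) (om_cnj iz) (om_unit iz)).
by rewrite lam_lamk /bt /kt h1 h3.
Qed.

Lemma u_ut : u = ut i (z, 0) /\ u = u0 i (z, 0).
Proof.
have [h1 h2 h3 h4] := at0 i z.
rewrite (primE (om11 iz) (om_cnj iz) (om_unit iz) n1 om_d3) lam_lamk.
by rewrite /ut /u0 /bt /b0 h1 h3 h4 /k0 h2.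
Qed.

Lemma u12 : has_bidegree 1 2 u.
Proof.
have [-> _] := u_ut; apply: (@gradedB _ _ (fun S => _ /\ _)).
  exact: (dt12 (p := (z, 0)) iz).
by apply: has_bidegree_wdg11; [exact: (wt11 (p := (z, 0)) iz)|case: bt01].
Qed.

Lemma gaprimE : prim w (dbar ga i z) =
  dbar ga i z - wdg w (c1 **: lamk (invmx (herm_mx w)) (dbar ga i z)).
Proof.
have d3 := bidegree_degree ga_d12.
by rewrite (primE (om11 iz) (om_cnj iz) (om_unit iz) n1 d3) lam_lamk.
Qed.

Lemma gaprim_b01 : has_bidegree 0 1 (c1 **: lamk (invmx (herm_mx w)) (dbar ga i z)).
Proof. by apply: (@gradedZ _ _ (fun S => _ /\ _)); apply: has_bidegree_lamk; exact: ga_d12. Qed.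

Lemma gaprim12 : has_bidegree 1 2 (prim w (dbar ga i z)).
Proof.
rewrite gaprimE; apply: (@gradedB _ _ (fun S => _ /\ _)); first exact: ga_d12.
apply: has_bidegree_wdg11; [exact: om11|exact: gaprim_b01].
Qed.

Lemma theta_wdg12 : has_bidegree 1 2 (wdg (theta01 om i z) (ga i z)).
Proof.
have [b01 _] := bt01; rewrite theta_bt -(degree2_comm _ (bidegree_degree (ga11 iz))).
by apply: has_bidegree_wdg11 => //; exact: ga11.
Qed.

Lemma density_phiq :
  density (phiq i (z, 0)) =
  density ('i **: wdg (wdg (wdg u (cnj u)) (ga i z)) (dpow w (n%:Z - 4))) +
  ((star_pair w m u (prim w (dbar ga i z)) - star_pair w m u (wdg (theta01 om i z) (ga i z))) +
   (star_pair w m u (prim w (dbar ga i z)) - star_pair w m u (wdg (theta01 om i z) (ga i z)))^*).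
Proof.
have [h1 h2 h3 h4] := at0 i z; have [uE u0E] := u_ut; have [b01 bq01] := bt01.
have lam0 : lam w u = 0.
  exact: (lam_prim (om11 iz) (om_cnj iz) (om_unit iz) n1 om_d3).
have g2 : has_degree 2 (wq i (z, 0)) := bidegree_degree (ga11 iz).
have uq12 : has_bidegree 1 2 (uq i (z, 0)).
  apply: (@gradedB _ _ (fun S => _ /\ _)); first exact: ga_d12.
  apply: (@gradedD _ _ (fun S => _ /\ _)); apply: has_bidegree_wdg11 => //.
    exact: ga11.
  exact: om11.
have sE : star_pair w m u (uq i (z, 0)) =
    star_pair w m u (prim w (dbar ga i z)) - star_pair w m u (wdg (theta01 om i z) (ga i z)).
  (* [bq] and the non-primitive part of [dbar ga] occur only in multiples of [w], which the pairing
     annihilates; the derivative of the inverse matrix is thus never evaluated. *)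
  have sw := star_pair_w (om11 iz) (om_cnj iz) (om_unit iz) nm u12 lam0.
  have sB := star_pairB w m u; have sD := star_pairD w m u.
  have cm : wdg (bt i (z, 0)) (ga i z) = wdg (wq i (z, 0)) (bt i (z, 0)).
    exact: esym (degree2_comm _ g2).
  have e : star_pair w m u (prim w (dbar ga i z)) = star_pair w m u (dq i (z, 0)).
    by apply: etrans (congr1 _ gaprimE) _; rewrite sB (sw _ gaprim_b01) subr0.
  rewrite /uq sB sD h2 (sw _ bq01) addr0; congr (_ - _); first exact: esym e.
  by rewrite theta_bt cm.
rewrite -sE /phiq -uE -u0E h1 dpow_quot0 //.
rewrite h1 extZDr wedgeDl extZDr !densityD addrC; congr (_ + _).
  congr density; rewrite -wedgeA; congr (_ **: wdg _ (dpow _ _)).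
  (* [m - 1] and [n - 4] agree as integers; for [n = 3] both give the zero divided power. *)
  by rewrite nm -addn3 PoszD -addrA.
by congr (_ + _); exact: (star_pair_conj (om_cnj iz) m u12 uq12).
Qed.

End AtZero.

Lemma econt_prim_dbar i z : chart_img i z ->
  econt (fun z => prim (om i z) (dbar ga i z)) z.
Proof.
move=> iz; pose F z := dbar ga i z -
  wdg (om i z) (c1 **: lamk (invmx (herm_mx (om i z))) (dbar ga i z)).
have Fc : econt F z.
  have oc : econt (om i) z by exact: smooth_econt.
  have dc : econt (dbar ga i) z by exact: dbar_econt.
  apply: econtB => //; apply: econt_wdg => //; apply: econtZ; first exact: ccont_cst.
  apply: econt_sum => d; apply: econt_sum => a; apply: econtZ.
    apply: ccontM; first exact: ccont_cst.
    apply: ccont_invmx; first exact: om_unit.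
    by move=> a' b'; exact: ccont_herm.
  by do 2!apply: econt_iprod.
have [{}Fc] := Fc; split=> S; apply: contat_near_ext (Fc S).
by apply: filterS (near_img iz) => z' iz'; rewrite gaprimE.
Qed.

Lemma dcont_ext (f g : dfun (X := X)) :
  (forall i z, chart_img i z -> f i z = g i z) -> dcont g -> dcont f.
Proof.
move=> fg gc i z iz; apply: contat_near_ext (gc i z iz).
by apply: filterS (near_img iz) => z' iz'; exact: fg.
Qed.

Lemma u_econt i z : chart_img i z -> econt (fun z => prim (om i z) (dbar om i z)) z.
Proof.
move=> iz; have [_ _ uc _] := etime_u (good0 iz).
split=> S; have [h] := uc; have := contat_slice (h S).
apply: contat_near_ext; apply: filterS (near_img iz) => z' iz'.
by have [-> _] := u_ut iz'.
Qed.

Lemma theta_econt i z : chart_img i z -> econt (theta01 om i) z.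
Proof.
move=> iz; have [_ _ uc _] := etime_b (good0 iz).
split=> S; have [h] := uc; have := contat_slice (h S).
apply: contat_near_ext; apply: filterS (near_img iz) => z' iz'.
by rewrite theta_bt.
Qed.

End Variation.

(** * The first variation of the functionals *)

Lemma rdiff_near_ext {R : realType} (f g : R -> Cx R) l :
  (\forall t \near (0 : R), f t = g t) -> rdiff g l -> rdiff f l.
Proof.
move=> fg [q [gq qc ql]]; have fg0 := nbhs_singleton fg; exists q; split=> //.
by apply: filterS2 fg gq => t -> ->; rewrite fg0.
Qed.

Section FirstVariation.
Context {R : realType} {n : nat} {X : complexManifold R n}.
Local Notation C := (Cx R).
Local Notation E := (ext R n).
Local Notation V := 'rV[C]_n.
Hypothesis Xc : compact [set: X].
Variable P : partition_of_unity X.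

Lemma dint_eq_supp (f g : dfun (X := X)) :
  (forall (k : pu_index P) z, pu_supp k z -> f (pu_chart k) z = g (pu_chart k) z) ->
  dint P f = dint P g.
Proof.
move=> fg; apply: eq_bigr => k _; congr cint_Cn; apply/funext => z.
have [Kz|/pu_loc_out ->] := pselect (pu_supp k z); last by rewrite !mul0r.
by rewrite fg.
Qed.

Variables (om ga : dform X).
Hypothesis om_metric : hermitian_metric om.
Hypothesis ga_real : smooth_real11 ga.
Variable m : nat.
Hypothesis nm : n = m.+3.

Let u := fprim om (dbar om).
Let pert (t : R) := fadd om (fscale (ofR t) ga).

(** The determinant is jointly continuous and non-zero at each [(z, 0)] with [z] in the support;
    compactness of the support yields one neighbourhood of 0 valid for all [z]. *)
Lemma near_good (k : pu_index P) : \forall t \near (0 : R),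
  forall z, pu_supp k z -> good om ga (pu_chart k) (z, t).
Proof.
set i := pu_chart k.
pose Q (t : R) (z : V) : Prop := herm_mx (wt om ga i (z, t)) \in unitmx.
have H : \forall t \near (0 : R), pu_supp k `<=` Q t.
  move: (@compact_pu_supp _ _ _ Xc P k) => /compact_near_coveringP cov.
  apply: (cov _ (nbhs (0 : R)) Q) => z Kz.
  have iz := pu_supp_img Kz.
  have dc : contat (z, 0 : R) (fun p => \det (herm_mx (wt om ga i p))).
    apply: ccont_det => a b; apply: ccont_herm.
    by have [] := etime_w om_metric ga_real (p := (z, 0 : R)) iz.
  have d0 : \det (herm_mx (wt om ga i (z, 0))) != 0.
    by have [_] := good0 ga om_metric iz; rewrite unitmxE unitfE.
  have [dc'] := dc.
  have nz : \forall p \near (z, 0 : R), \det (herm_mx (wt om ga i p)) != 0.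
    exact: (@cvgr_neq0 _ _ _ (nbhs (z, 0 : R)) _ _ _ dc' d0).
  by apply: filterS nz => -[z' t'] /=; rewrite /Q unitmxE unitfE.
by apply: filterS H => t Ht z Kz; split; [exact: pu_supp_img Kz|exact: Ht].
Qed.

Lemma L_rdiff : rdiff (fun t => L_functional P (pert t))
  (dint P (fun i z => density (phiq om ga m i (z, 0)))).
Proof.
have H : \forall t \near (0 : R), forall (k : pu_index P) z, pu_supp k z ->
    good om ga (pu_chart k) (z, t).
  exact: (@filter_forall _ _ (fun (k : pu_index P) t => forall z, pu_supp k z ->
    good om ga (pu_chart k) (z, t)) _ _ near_good).
apply: (rdiff_near_ext (g := fun t => dint P (fun i z => density (phit om ga m i (z, t))))).
  apply: filterS H => t gt; rewrite /L_functional fintE; apply: dint_eq_supp => k z Kz.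
  exact: (phitE om_metric ga_real nm (gt k z Kz)).
apply: (dint_rdiff Xc (W := good om ga)
  (f0 := fun i p => density (phi0 om m i p))
  (f := fun i p => density (phit om ga m i p))
  (q := fun i p => density (phiq om ga m i p))).
- move=> i p gp; apply: ctime_density; exact: (etime_phi om_metric ga_real).
- by move=> i z t iz; rewrite (@phi0E _ _ _ om ga).
- exact: near_good.
Qed.

Lemma dcont_star (v : dform X) :
  (forall i z, chart_img i z -> econt (v i) z) ->
  dcont (fun i z => star_pair (om i z) m (u i z) (v i z)).
Proof.
move=> vc i z iz; apply: ccont_density; apply: econtZ; first exact: ccont_cst.
apply: econt_wdg; last by apply: econt_dpow; apply: smooth_econt => //; case: om_metric => -[].
apply: econt_wdg; first exact: vc.
apply: econt_cnj; exact: (u_econt om_metric ga_real nm iz).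
Qed.

Lemma L_derive_formula :
  dint P (fun i z => density (phiq om ga m i (z, 0))) =
    fint P (fscale 'i (fwedge (fwedge (fwedge u (fconj u)) ga) (fdivpow om (n%:Z - 4))))
    + 2 * 'Re (finner P om u (fprim om (dbar ga)))
    - 2 * 'Re (finner P om (fwedge (theta01 om) ga) u).
Proof.
pose th := fwedge (theta01 om) ga.
pose A i z := star_pair (om i z) m (u i z) (fprim om (dbar ga) i z).
pose B i z := star_pair (om i z) m (u i z) (th i z).
pose D i z := density ('i **: wdg (wdg (wdg (u i z) (cnj (u i z))) (ga i z)) (dpow (om i z) (n%:Z - 4))).
have om_sm : smooth_form om by case: om_metric => -[].
have ga_sm : smooth_form ga by case: ga_real.
have Ac : dcont A by apply: dcont_star => i z iz; exact: (econt_prim_dbar om_metric ga_real nm iz).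
have Bc : dcont B.
  apply: dcont_star => i z iz; rewrite /th /fwedge wdgE.
  by apply: econt_wdg; [exact: (theta_econt om_metric ga_real iz)|exact: smooth_econt].
have ABc : dcont (fun i z => A i z - B i z) by move=> i z iz; apply: ccontB; [exact: Ac|exact: Bc].
have ABcc : dcont (fun i z => (A i z - B i z)^*) by move=> i z iz; apply: ccont_conj; exact: ABc.
have qE i z : chart_img i z -> density (phiq om ga m i (z, 0)) =
    1 * D i z + (1 * (A i z - B i z) + (A i z - B i z)^*).
  move=> iz; rewrite !mul1r (density_phiq om_metric ga_real nm iz).
  by rewrite /A /B /th /fwedge wdgE.
have qc : dcont (fun i z => density (phiq om ga m i (z, 0))).
  move=> i z iz; have [_ _ _ c] := etime_phi om_metric ga_real m (good0 ga om_metric iz).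
  exact: contat_slice (ccont_density c).
have Sc : dcont (fun i z => 1 * (A i z - B i z) + (A i z - B i z)^*).
  move=> i z iz; apply: ccontD; last exact: ABcc.
  by apply: ccontM; [exact: ccont_cst|exact: ABc].
have Dc : dcont D.
  (* Continuity of [D] is obtained by subtraction, which avoids a separate treatment of the possibly
     negative exponent [n - 4]. *)
  apply: (dcont_ext (g := fun i z => density (phiq om ga m i (z, 0)) -
    (1 * (A i z - B i z) + (A i z - B i z)^*))) => i z iz.
    by rewrite qE // mul1r addrK.
  by apply: ccontB; [exact: qc|exact: Sc].
rewrite (dint_eq P qE).
rewrite (dint_lin Xc P 1 Dc Sc) (dint_lin Xc P 1 ABc ABcc) !mul1r (dint_conj Xc P ABc).
have -> : dint P (fun i z => A i z - B i z) = dint P A - dint P B.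
  have -> : (fun i z => A i z - B i z) = (fun i z => -1 * B i z + A i z).
    by apply/funext => i; apply/funext => z; rewrite mulN1r addrC.
  by rewrite (dint_lin Xc P (-1) Bc Ac) mulN1r addrC.
have -> : fint P (fscale 'i (fwedge (fwedge (fwedge u (fconj u)) ga) (fdivpow om (n%:Z - 4)))) = dint P D.
  by rewrite fintE /fscale /fwedge /fconj /fdivpow wdgE cnjE dpowE /D; apply: dint_eq => i z iz; rewrite escaleE.
have om11 i z : chart_img i z -> has_bidegree 1 1 (om i z).
  by case: om_metric => -[_ h] _ /h[].
have omr i z : chart_img i z -> cnj (om i z) = om i z.
  by case: om_metric => -[_ h] _ /h[_]; rewrite cnjE.
have omu i z : chart_img i z -> herm_mx (om i z) \in unitmx.
  by case: om_metric => _ h /h; exact: mxposdef_unit.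
have n1 : (1 < n)%N by rewrite nm.
have u12' i z : chart_img i z -> has_bidegree 1 2 (u i z) by exact: (u12 om_metric ga_real nm).
have lam0 i z (iz : chart_img i z) : lam (om i z) (u i z) = 0.
  exact: (lam_prim (om11 i z iz) (omr i z iz) (omu i z iz) n1 (om_d3 om_metric iz)).
(* Here [u] stands in the first argument, so the pairing appears conjugated; the real part removes
   the difference. *)
have -> : finner P om u (fprim om (dbar ga)) = (dint P A)^*.
  rewrite -(dint_conj Xc P Ac) /finner fintE; apply: dint_eq => i z iz.
  rewrite escaleE dpowE.
  apply: (inner_star (om11 i z iz) (omr i z iz) (omu i z iz) nm (u12' i z iz) (lam0 i z iz)).
  exact: (gaprim12 om_metric ga_real nm iz).
have -> : finner P om th u = dint P B.
  rewrite /finner fintE; apply: dint_eq => i z iz; rewrite escaleE dpowE densityZ /B.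
  rewrite (star_pairE (om11 i z iz) (omr i z iz) (omu i z iz) nm (u12' i z iz) (lam0 i z iz)) //.
  by rewrite /th /fwedge wdgE; exact: (theta_wdg12 om_metric ga_real iz).
have n2 : (2%:R : C) != 0 by rewrite pnatr_eq0.
rewrite !ReE conjCK !(mulrC 2) !divfK // conjCD conjCN.
move: (dint P D) (dint P A)^* (dint P A) (dint P B)^* (dint P B) => d a' a b' b.
by ring.
Qed.
End FirstVariation.

(** * The normalising volume *)

Section Volume.
Context {R : realType} {n : nat} {X : complexManifold R n}.
Hypothesis Xc : compact [set: X].
Variable P : partition_of_unity X.
Hypothesis n1 : (0 < n)%N.
Implicit Types (om ga rho : dform X).

Let vol om rho := fint P (fwedge om (fdivpow rho (n%:Z - 1))).

Lemma volE om rho : vol om rho =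
  dint P (fun i z => density (wdg (om i z) (dpow (rho i z) (n - 1)%:Z))).
Proof.
rewrite /vol fintE /fwedge /fdivpow wdgE dpowE.
by have -> : n%:Z - 1 = (n - 1)%:Z by rewrite subzn.
Qed.

Lemma dcont_vol om rho : smooth_form om -> smooth_form rho ->
  dcont (fun i z => density (wdg (om i z) (dpow (rho i z) (n - 1)%:Z))).
Proof.
move=> oms rhos i z iz; apply: ccont_density; apply: econt_wdg; first exact: smooth_econt.
by apply: econt_dpow; exact: smooth_econt.
Qed.

Lemma vol_lin om ga rho t : smooth_form om -> smooth_form ga -> smooth_form rho ->
  vol (fadd om (fscale (ofR t) ga)) rho = vol om rho + ofR t * vol ga rho.
Proof.
move=> oms gas rhos; rewrite !volE addrC -(dint_lin Xc P _ (dcont_vol gas rhos) (dcont_vol oms rhos)).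
apply: dint_eq => i z iz.
by rewrite /fadd /fscale escaleE addrC wedgePl densityP.
Qed.

Lemma vol_neq0 om rho : hermitian_metric om -> hermitian_metric rho ->
  (exists x : X, True) -> vol om rho != 0.
Proof.
move=> [[oms om11] omp] [[rhos rho11] rhop] X0; rewrite volE; apply: lt0r_neq0.
apply: (dint_gt0 Xc P) => // [|i z iz]; first exact: dcont_vol.
have [oz11 oz_real] := om11 i z iz; have [rz11 rz_real] := rho11 i z iz.
by apply: density_wdg_gt0 => //; [rewrite -cnjE|exact: rhop|exact: omp].
Qed.
End Volume.

Theorem proposition6p6 (R : realType) (n : nat) (n_ge3 : (3 <= n)%N)
    (X : complexManifold R n) (X_compact : compact [set: X])
    (P : partition_of_unity X)
    (rho : dform X) (rho_metric : hermitian_metric rho)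
    (omega : dform X) (omega_metric : hermitian_metric omega)
    (gamma : dform X) (gamma_real11 : smooth_real11 gamma) :
  let u := fprim omega (dbar omega) in
  let vol_omega := fint P (fwedge omega (fdivpow rho (n%:Z - 1))) in
  let vol_gamma := fint P (fwedge gamma (fdivpow rho (n%:Z - 1))) in
  [/\ functional_derivable (L_functional P) omega gamma,
      functional_derivable (Ltilde_functional P rho) omega gamma,
      functional_derive (Ltilde_functional P rho) omega gamma =
        (vol_omega ^+ (n - 1))^-1 *
        (functional_derive (L_functional P) omega gamma
         - (n%:R - 1) * (vol_gamma / vol_omega) * L_functional P omega)
    & functional_derive (L_functional P) omega gamma =
        fint P (fscale 'i (fwedge (fwedge (fwedge u (fconj u)) gamma)
                                  (fdivpow omega (n%:Z - 4))))
        + 2 * 'Re (finner P omega u (fprim omega (dbar gamma)))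
        - 2 * 'Re (finner P omega (fwedge (theta01 omega) gamma) u)].
Proof.
move=> u vol_omega vol_gamma.
(* With [n = m + 3], the exponent of [omega_(n-3)] becomes the natural number [m]. *)
have [m nm] : exists m, n = m.+3 by exists (n - 3)%N; rewrite -addn3 subnK.
have n0 : (0 < n)%N by rewrite nm.
have oms : smooth_form omega by case: omega_metric => -[].
have gas : smooth_form gamma by case: gamma_real11.
have rhos : smooth_form rho by case: rho_metric => -[].
pose pert (t : R) := fadd omega (fscale (ofR t) gamma).
have dL := L_rdiff X_compact P omega_metric gamma_real11 nm.
have [L1 L2] := rdiffP dL.
have LE := L_derive_formula X_compact P omega_metric gamma_real11 nm.
have pert0 : pert 0 = omega.
  apply/funext => i; apply/funext => z.
  by rewrite /pert /fadd /fscale escaleE ext0Z addr0.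
have dLt : rdiff (fun t => Ltilde_functional P rho (pert t))
    ((vol_omega ^+ (n - 1))^-1 *
        (functional_derive (L_functional P) omega gamma
         - (n%:R - 1) * (vol_gamma / vol_omega) * L_functional P omega)).
  have [X0|X0] := pselect (exists x : X, True); last first.
    have fint0 (v : dform X) : fint P v = 0 by rewrite fintE dint_empty.
    have -> : functional_derive (L_functional P) omega gamma = 0.
      by rewrite [LHS]L2 dint_empty.
    rewrite /L_functional fint0 mulr0 subrr mulr0.
    rewrite (_ : (fun t => _) = fun=> 0); first exact: rdiff_cst.
    by apply/funext => t; rewrite /Ltilde_functional /L_functional fint0 mul0r.
  have v0 : vol_omega != 0 := vol_neq0 X_compact P n0 omega_metric rho_metric X0.
  have dV : rdiff (fun t => fint P (fwedge (pert t) (fdivpow rho (n%:Z - 1)))) vol_gamma.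
    (* The volume is affine in [t], so its difference quotient is constant. *)
    exists (fun=> vol_gamma); split=> //; last exact: ccont_cst.
    by apply: filterE => t; rewrite pert0; exact: (vol_lin X_compact P n0 t oms gas rhos).
  have dX := rdiffX (n - 1) dV.
  have := rdiffM dL (rdiffV _ dX); rewrite -/(pert 0) pert0 -/vol_omega.
  move=> /(_ (expf_neq0 _ v0)); congr rdiff.
  rewrite [functional_derive _ _ _]L2.
  have -> : (n%:R - 1 : Cx R) = (n - 1)%:R by rewrite natrB.
  have -> : (n - 1)%N = m.+2 by rewrite nm subn1.
  (* As [n - 1 = m + 2], splitting off powers leaves a rational identity in [vol_omega] and
     [vol_omega ^ m], both non-zero. *)
  rewrite /= !exprS; move: (dint P _) (L_functional P _) (vol_omega ^+ m) (expf_neq0 m v0) => l L vm vm0.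
  by field; rewrite v0 vm0.
have [Lt1 Lt2] := rdiffP dLt.
split; [exact: L1|exact: Lt1|exact: Lt2|exact: etrans L2 LE].
Qed.
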